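(* Let $T\in(0,\infty)$, let $X_0,X_1$ be Banach spaces with $X_1\hookrightarrow X_0$ densely and continuously, and let $A\colon[0,T]\to\mathcal{L}(X_1,X_0)$ be strongly measurable in the strong operator topology. Let $p\in(1,\infty)$, $\kappa\in[0,p-1)$ and $q\in(p,\infty)$. Suppose that there is a constant $C_A$ such that \[\|Av\|_{L^p(0,T,w_\kappa;X_0)}\le C_A\|v\|_{\mathrm{MR}^p(0,T,w_\kappa)}\quad\text{for all } v\in \mathrm{MR}^p(0,T,w_\kappa),\] and that $A$ has maximal $L^p(0,T,w_\kappa)$-regularity. Let $B\colon[0,T]\to\mathcal{L}(X_{1-1/q,1},X_0)$ be strongly measurable in the strong operator topology and suppose that $\|B(t)\|_{\mathcal{L}(X_{1-1/q,1},X_0)}\le b(t)$ for $t\in[0,T]$, where $b\in L^q(0,T)$. Then $A+B$ has maximal $L^p(0,T,w_\kappa)$-regularity, and $M_{p,\kappa,A+B}(0,T)\le C$, where $C$ depends only on $p,q,\kappa,X_0,X_1,M_{p,\kappa,A}(0,T)$ and $\|b\|_{L^q(0,T)}$.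
   Context: For $\theta\in(0,1)$ and $r\in[1,\infty]$, $X_{\theta,r}:=(X_0,X_1)_{\theta,r}$ denotes the real interpolation space; since $X_1\hookrightarrow X_{1-1/q,1}$, $B(t)$ is regarded as an element of $\mathcal{L}(X_1,X_0)$ and $(A+B)(t)=A(t)+B(t)$. For $\mu\ge0$, $w_\mu(t)=|t|^\mu$ (the weight is never shifted, also on subintervals). $L^p(a,b,w_\kappa;X)$ is the space of strongly measurable $f\colon(a,b)\to X$ with $\|f\|^p=\int_a^b t^\kappa\|f(t)\|_X^p\,dt<\infty$; $W^{1,p}(a,b,w_\kappa;X)$ is defined analogously. $\mathrm{MR}^p(a,b,w_\kappa):=L^p(a,b,w_\kappa;X_1)\cap W^{1,p}(a,b,w_\kappa;X_0)$ with norm $\max\{\|u\|_{L^p(a,b,w_\kappa;X_1)},\|u\|_{W^{1,p}(a,b,w_\kappa;X_0)}\}$. For an operator family $\mathcal{A}\colon[0,T]\to\mathcal{L}(X_1,X_0)$, $0\le a<b\le T$, $f\in L^1(a,b;X_0)$ and $u_a\in X_0$, a strong solution of $u'+\mathcal{A}u=f$ on $(a,b)$, $u(a)=u_a$, is a function $u\in L^1(a,b;X_1)\cap W^{1,1}(a,b;X_0)$ with $\mathcal{A}u\in L^1(a,b;X_0)$, $u(a)=u_a$ (using the continuous version) and $u'(t)+\mathcal{A}(t)u(t)=f(t)$ for a.e. $t$. $\mathcal{A}$ has maximal $L^p(a,b,w_\kappa)$-regularity if for every $f\in L^p(a,b,w_\kappa;X_0)$ there exists a unique strong solution $u\in\mathrm{MR}^p(a,b,w_\kappa)$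 of $u'+\mathcal{A}u=f$ on $(a,b)$ with $u(a)=0$, and there is a constant $C$ independent of $f$ such that for every $\tau\in(a,b]$ and every strong solution $v\in\mathrm{MR}^p(a,\tau,w_\kappa)$ of $v'+\mathcal{A}v=f$ on $(a,\tau)$ with $v(a)=0$ one has $\|v\|_{\mathrm{MR}^p(a,\tau,w_\kappa)}\le C\|f\|_{L^p(a,\tau,w_\kappa;X_0)}$. The infimum of such $C$ is denoted $M_{p,\kappa,\mathcal{A}}(a,b)$. *)

(* Defs.v *)
From HB Require Import structures.
From mathcomp Require Import all_boot all_order all_algebra.
From mathcomp Require Import all_classical all_reals all_analysis.
Set Implicit Arguments. Unset Strict Implicit. Unset Printing Implicit Defensive.
Import Order.TTheory GRing.Theory Num.Theory.
Import numFieldNormedType.Exports.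
Local Open Scope classical_set_scope.
Local Open Scope ring_scope.

Definition leb (R : realType) := (@lebesgue_measure R).

Record step (R : realType) (X : normedModType R) := Step {
  st_n : nat; st_A : nat -> set R; st_x : nat -> X }.

Definition step_fun (R : realType) (X : normedModType R) (s : step X) (t : R) : X :=
  \sum_(i < st_n s) (\1_(st_A s i) t) *: st_x s i.

Definition step_meas (R : realType) (X : normedModType R) (s : step X) : Prop :=
  forall i, measurable (st_A s i).

Definition step_integrable (R : realType) (X : normedModType R) (D : set R) (s : step X) : Prop :=
  step_meas s /\ forall i, (i < st_n s)%N -> (@leb R (st_A s i `&` D) < +oo)%E.

Definition step_int (R : realType) (X : normedModType R) (D : set R) (s : step X) : X :=
  \sum_(i < st_n s) fine (@leb R (st_A s i `&` D)) *: st_x s i.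

Definition strongly_meas (R : realType) (X : normedModType R) (D : set R) (f : R -> X) : Prop :=
  exists s : nat -> step X, (forall n, step_meas (s n)) /\
    {ae @leb R, forall t, D t -> step_fun (s n) t @[n --> \oo] --> f t}.

Definition is_bochner (R : realType) (X : normedModType R) (D : set R) (f : R -> X) (v : X) : Prop :=
  strongly_meas D f /\
  exists s : nat -> step X, (forall n, step_integrable D (s n)) /\
    ((fun n => (\int[@leb R]_(t in D) (`|step_fun (s n) t - f t|)%:E)%E) @ \oo --> 0%E) /\
    ((fun n => step_int D (s n)) @ \oo --> v).

Definition wLp_int (R : realType) (X : normedModType R) (p kappa a b : R) (f : R -> X) : \bar R :=
  (\int[@leb R]_(t in `]a, b[%classic) ((`|t| `^ kappa) * (`|f t| `^ p))%:E)%E.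

Definition wLp (R : realType) (X : normedModType R) (p kappa a b : R) (f : R -> X) : Prop :=
  strongly_meas `]a, b[%classic f /\ (wLp_int p kappa a b f < +oo)%E.

Definition wLp_norm (R : realType) (X : normedModType R) (p kappa a b : R) (f : R -> X) : R :=
  (fine (wLp_int p kappa a b f)) `^ (p^-1).

(* g (in L^p(a,b,w_kappa;X)) is the derivative of u on (a,b), and c is the value at a of
   the continuous version of u:  u(t) = c + \int_a^t g  for a.e. t in (a,b) *)
Definition is_deriv (R : realType) (X : normedModType R) (p kappa a b : R) (u g : R -> X) (c : X) : Prop :=
  wLp p kappa a b g /\
  {ae @leb R, forall t, `]a, b[%classic t -> is_bochner `]a, t[%classic g (u t - c)}.

Definition wW1p (R : realType) (X : normedModType R) (p kappa a b : R) (u : R -> X) : Prop :=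
  wLp p kappa a b u /\ exists g c, is_deriv p kappa a b u g c.

(* J : X1 -> X0 is the embedding X1 -> X0 *)
Definition MR (R : realType) (X0 X1 : normedModType R) (J : X1 -> X0) (p kappa a b : R) (u : R -> X1) : Prop :=
  wLp p kappa a b u /\ wW1p p kappa a b (J \o u).

(* ||u||_{MR^p(a,b,w_kappa)}, computed with a derivative g of J o u; the W^{1,p} norm is
   (||u||_p^p + ||u'||_p^p)^{1/p} *)
Definition MR_norm (R : realType) (X0 X1 : normedModType R) (J : X1 -> X0) (p kappa a b : R)
    (u : R -> X1) (g : R -> X0) : R :=
  Num.max (wLp_norm p kappa a b u)
    ((wLp_norm p kappa a b (J \o u) `^ p + wLp_norm p kappa a b g `^ p) `^ (p^-1)).

Definition MR_norm_le (R : realType) (X0 X1 : normedModType R) (J : X1 -> X0) (p kappa a b : R)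
    (u : R -> X1) (K : R) : Prop :=
  forall g c, is_deriv p kappa a b (J \o u) g c -> MR_norm J p kappa a b u g <= K.

Definition strong_sol (R : realType) (X0 X1 : normedModType R) (J : X1 -> X0)
    (Aop : R -> X1 -> X0) (a b : R) (f : R -> X0) (ua : X0) (u : R -> X1) : Prop :=
  wLp 1 0 a b u /\ wLp 1 0 a b (J \o u) /\
  wLp 1 0 a b (fun t => Aop t (u t)) /\
  exists g, is_deriv 1 0 a b (J \o u) g ua /\
    {ae @leb R, forall t, `]a, b[%classic t -> g t + Aop t (u t) = f t}.

Definition MR_est (R : realType) (X0 X1 : normedModType R) (J : X1 -> X0)
    (p kappa : R) (Aop : R -> X1 -> X0) (a b : R) (K : R) : Prop :=
  forall f : R -> X0, wLp p kappa a b f ->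
  forall tau, a < tau <= b ->
  forall v : R -> X1, MR J p kappa a tau v -> strong_sol J Aop a tau f 0 v ->
    MR_norm_le J p kappa a tau v (K * wLp_norm p kappa a tau f).

Definition max_reg (R : realType) (X0 X1 : normedModType R) (J : X1 -> X0)
    (p kappa : R) (Aop : R -> X1 -> X0) (a b : R) : Prop :=
  (forall f : R -> X0, wLp p kappa a b f ->
     exists u : R -> X1, MR J p kappa a b u /\ strong_sol J Aop a b f 0 u /\
       forall v : R -> X1, MR J p kappa a b v -> strong_sol J Aop a b f 0 v ->
         {ae @leb R, forall t, `]a, b[%classic t -> v t = u t}) /\
  exists K, MR_est J p kappa Aop a b K.

Definition MR_const (R : realType) (X0 X1 : normedModType R) (J : X1 -> X0)
    (p kappa : R) (Aop : R -> X1 -> X0) (a b : R) : R :=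
  inf [set K | MR_est J p kappa Aop a b K].

Definition Kfun (R : realType) (X0 X1 : normedModType R) (J : X1 -> X0) (t : R) (x : X0) : R :=
  inf [set r | exists (x0 : X0) (x1 : X1), x = x0 + J x1 /\ r = `|x0| + t * `|x1|].

Definition interp_int (R : realType) (X0 X1 : normedModType R) (J : X1 -> X0) (theta : R) (x : X0) : \bar R :=
  (\int[@leb R]_(t in `]0%R, +oo[%classic) ((t `^ (- theta)) * Kfun J t x / t)%:E)%E.

Definition in_interp (R : realType) (X0 X1 : normedModType R) (J : X1 -> X0) (theta : R) (x : X0) : Prop :=
  (interp_int J theta x < +oo)%E.

Definition interp_norm (R : realType) (X0 X1 : normedModType R) (J : X1 -> X0) (theta : R) (x : X0) : R :=
  fine (interp_int J theta x).

Definition Lq_norm (R : realType) (q a b : R) (f : R -> R) : R :=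
  (fine (\int[@leb R]_(t in `]a, b[%classic) (`|f t| `^ q)%:E)%E) `^ (q^-1).

(* f in L^q(a,b) (f measurable assumed separately) *)
Definition Lq_fin (R : realType) (q a b : R) (f : R -> R) : Prop :=
  (\int[@leb R]_(t in `]a, b[%classic) (`|f t| `^ q)%:E < +oo)%E.

(* Main.v *)
(* Write Phi_t(f) for the p-th power of the norm of f in L^p(0, t, w_kappa), S for the solution
   operator of A, and beta(t) for the integral of |b|^q over (0, t).

   If u(0) = 0, then for almost every t the K-functional satisfies
   K(h, u(t)) <= C h^(1 - 1/p) (t^-kappa (Phi_t(u) + Phi_t(u')))^(1/p) for all h > 0.  Splitting the
   interpolation integral at (delta / b(t))^q, which depends on b rather than on u, gives
     t^kappa |B(t) u(t)|^p <= C delta^p t^kappa |u(t)|^p + C_delta |b(t)|^q (Phi_t(u) + Phi_t(u')).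
   After integration this is an estimate of Gronwall type: if Phi_t(F) <= D exp(lambda beta(t)) for
   all t, then Phi_t(B S F) <= rho D exp(lambda beta(t)), where rho is as small as we please once
   delta is small and lambda is large, both depending on p, q, kappa and the constant of A only.
   Hence F = f - B S F is solved by Picard iteration in L^p(0, T, w_kappa; X_0), u = S F solves the
   perturbed problem, and the same bound applied to F = f - B v gives the a priori estimate with a
   constant that involves b only through exp(lambda beta(T)), and T not at all. *)
Require Import Defs.
From HB Require Import structures.
From mathcomp Require Import all_boot all_order all_algebra.
From mathcomp Require Import all_classical all_reals all_analysis measurable_realfun.
From mathcomp Require Import ring lra.
Set Implicit Arguments. Unset Strict Implicit. Unset Printing Implicit Defensive.
Import Order.TTheory GRing.Theory Num.Theory.
Import numFieldNormedType.Exports.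
Import HBNNSimple.
Local Open Scope classical_set_scope.
Local Open Scope ring_scope.

(** * Integrals of almost everywhere measurable functions *)

(** A familiar way to make a perturbation small is to cut (0, T) into pieces on which b is small in
    L^q. Restarting at an interior time would bring in nonzero initial values, while the weight is
    not shifted, and the number of pieces would enter the constant. The factor exp(lambda beta(t))
    works on all of (0, T) at once. It uses the regularity estimate of A on every (0, t) with one
    and the same constant, which is what the quantifier over tau in [MR_est] supplies. The argument
    runs with p-th powers instead of norms because |b|^q then enters linearly, as Gronwall requires.
    The price is the factor 2^p in |x + y|^p <= 2^p (|x|^p + |y|^p), and it explains the ratio rho =
    2^-p / 2: it gives 2^p rho = 1/2 in the a priori bound, and it makes the Picard increments
    summable after the factors 2^(p(n+1)) needed for pointwise convergence. Hoelder's inequality is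
    replaced throughout by the Young type bound x <= a + a^(1-p) x^p, whose threshold a is chosen
    afterwards to balance both terms. *)

(* For nonnegative [f] the integral is a supremum over simple functions below [f], so that
   monotonicity holds without measurability. *)
Lemma ge0_le_lower_integral (d : measure_display) (T : measurableType d) (R : realType)
  (mu : {measure set T -> \bar R}) (D : set T) (f g : T -> \bar R) :
  (forall x, D x -> 0 <= f x)%E -> (forall x, D x -> f x <= g x)%E ->
  (\int[mu]_(x in D) f x <= \int[mu]_(x in D) g x)%E.
Proof.
move=> f0 fg.
have g0 x : D x -> (0 <= g x)%E by move=> Dx; apply: le_trans (fg x Dx); exact: f0.
rewrite !ge0_integralE//=; apply: ge_ereal_sup => _ [h hf <-].
apply: ereal_sup_ubound; exists h => // x; apply: le_trans (hf x) _.
by rewrite !patchE; case: ifPn => // /set_mem /fg.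
Qed.

Lemma ae_ge0_le_lower_integral (d : measure_display) (T : measurableType d) (R : realType)
  (mu : {measure set T -> \bar R}) (D : set T) (f g : T -> \bar R) :
  (forall x, D x -> 0 <= f x)%E -> (forall x, D x -> 0 <= g x)%E ->
  {ae mu, forall x, D x -> (f x <= g x)%E} ->
  (\int[mu]_(x in D) f x <= \int[mu]_(x in D) g x)%E.
Proof.
move=> f0 g0 [N [mN N0 subN]].
rewrite ge0_integralE//=; apply: ge_ereal_sup => _ [h hf <-].
rewrite -integralT_nnsfun (ge0_negligible_integral mN)//; last 2 first.
- by apply/measurable_EFinP; exact: measurable_funP.
- by move=> x _; rewrite lee_fin.
rewrite integral_mkcond [leRHS]integral_mkcond; apply: ge0_le_lower_integral.
  by move=> x _; rewrite patchE; case: ifPn => // _; rewrite lee_fin.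
move=> x _; rewrite !patchE; case: ifPn => [/set_mem [_ Nx]|_]; last first.
  by case: ifPn => // /set_mem /g0.
have := hf x; rewrite patchE; case: ifPn => // /set_mem Dx hx.
apply: le_trans hx _; apply: contrapT => fg; apply: Nx; apply: subN => /= H.
exact/fg/H.
Qed.

Lemma ae_eq_lower_integral (d : measure_display) (T : measurableType d) (R : realType)
  (mu : {measure set T -> \bar R}) (D : set T) (f g : T -> \bar R) :
  (forall x, D x -> 0 <= f x)%E -> (forall x, D x -> 0 <= g x)%E ->
  {ae mu, forall x, D x -> f x = g x} ->
  (\int[mu]_(x in D) f x = \int[mu]_(x in D) g x)%E.
Proof.
move=> f0 g0 fg; apply/le_anti/andP; split; apply: ae_ge0_le_lower_integral => //.
  by apply: filterS fg => x H Dx; rewrite H.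
by apply: filterS fg => x H Dx; rewrite H.
Qed.

Lemma ge0_le_lower_integral_subset (d : measure_display) (T : measurableType d) (R : realType)
  (mu : {measure set T -> \bar R}) (D E : set T) (f : T -> \bar R) :
  D `<=` E -> (forall x, E x -> 0 <= f x)%E ->
  (\int[mu]_(x in D) f x <= \int[mu]_(x in E) f x)%E.
Proof.
move=> DE f0; rewrite integral_mkcond [leRHS]integral_mkcond; apply: ge0_le_lower_integral.
  by move=> x _; rewrite patchE; case: ifPn => // /set_mem /DE /f0.
move=> x _; rewrite !patchE; case: ifPn => [/set_mem /DE Ex|_]; first by rewrite mem_set.
by case: ifPn => // /set_mem /f0.
Qed.

Lemma le_integral_leb (R : realType) (D : set R) (f g : R -> R) :
  (forall t, D t -> 0 <= f t) -> (forall t, D t -> 0 <= g t) ->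
  {ae @leb R, forall t, D t -> f t <= g t} ->
  (\int[@leb R]_(t in D) (f t)%:E <= \int[@leb R]_(t in D) (g t)%:E)%E.
Proof.
by move=> f0 g0 fg; apply: (@ae_ge0_le_lower_integral _ _ _ (@lebesgue_measure R)).
Qed.

Lemma eq_integral_leb (R : realType) (D : set R) (f g : R -> R) :
  (forall t, D t -> 0 <= f t) -> (forall t, D t -> 0 <= g t) ->
  {ae @leb R, forall t, D t -> f t = g t} ->
  (\int[@leb R]_(t in D) (f t)%:E = \int[@leb R]_(t in D) (g t)%:E)%E.
Proof.
move=> f0 g0 fg; apply: (@ae_eq_lower_integral _ _ _ (@lebesgue_measure R)) => //.
by apply: (@filterS _ (almost_everywhere (@lebesgue_measure R)) _ _ _ _ fg) => t H /H ->.
Qed.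

Lemma le_integral_leb_subset (R : realType) (D E : set R) (f : R -> R) :
  D `<=` E -> (forall t, E t -> 0 <= f t) ->
  (\int[@leb R]_(t in D) (f t)%:E <= \int[@leb R]_(t in E) (f t)%:E)%E.
Proof.
by move=> DE f0; apply: (@ge0_le_lower_integral_subset _ _ _ (@lebesgue_measure R)).
Qed.

(* Strong measurability only gives Borel measurability up to a null set, since
   [lebesgue_measure] lives on the (incomplete) Borel sigma-algebra. *)
Definition ae_borel (R : realType) (D : set R) (f : R -> R) : Prop :=
  exists h : R -> R, [/\ measurable_fun setT h, (forall t, 0 <= h t) &
    {ae @leb R, forall t, D t -> f t = h t}].

Lemma ae_leS (R : realType) (P Q : R -> Prop) :
  (forall t, P t -> Q t) -> {ae @leb R, forall t, P t} -> {ae @leb R, forall t, Q t}.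
Proof. by move=> PQ; apply: (@filterS _ (almost_everywhere (@lebesgue_measure R))). Qed.

Lemma ae_leS2 (R : realType) (P Q S : R -> Prop) :
  (forall t, P t -> Q t -> S t) -> {ae @leb R, forall t, P t} -> {ae @leb R, forall t, Q t} ->
  {ae @leb R, forall t, S t}.
Proof. by move=> PQ; apply: (@filterS2 _ (almost_everywhere (@lebesgue_measure R))). Qed.

Lemma ae_leb_all (R : realType) (P : R -> Prop) : (forall t, P t) -> {ae @leb R, forall t, P t}.
Proof. by move=> H; apply: (@filterS _ (almost_everywhere (@lebesgue_measure R)) _ setT) => //; exact: filterT. Qed.

Lemma ae_borel_sub (R : realType) (D E : set R) (f : R -> R) :
  D `<=` E -> ae_borel E f -> ae_borel D f.
Proof.
move=> DE [h [mh h0 fh]]; exists h; split => //.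
by apply: ae_leS fh => t H /DE /H.
Qed.

Lemma ae_borel_measurable (R : realType) (D : set R) (f : R -> R) :
  measurable D -> (forall t, D t -> 0 <= f t) -> measurable_fun D f -> ae_borel D f.
Proof.
move=> mD f0 mf; exists (f \_ D); split.
- by apply/measurable_restrict => //; rewrite setTI.
- by move=> t; rewrite patchE; case: ifPn => // /set_mem /f0.
- by apply: ae_leb_all => t Dt; rewrite patchE mem_set.
Qed.

Lemma ae_borelM (R : realType) (D : set R) (f g : R -> R) :
  ae_borel D f -> ae_borel D g -> ae_borel D (fun t => f t * g t).
Proof.
move=> [h [mh h0 fh]] [k [mk k0 gk]]; exists (fun t => h t * k t); split.
- exact: measurable_funM.
- by move=> t; rewrite mulr_ge0.
- by apply: ae_leS2 fh gk => t Hf Hg Dt; rewrite Hf// Hg.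
Qed.

Lemma ae_borelD (R : realType) (D : set R) (f g : R -> R) :
  ae_borel D f -> ae_borel D g -> ae_borel D (fun t => f t + g t).
Proof.
move=> [h [mh h0 fh]] [k [mk k0 gk]]; exists (fun t => h t + k t); split.
- exact: measurable_funD.
- by move=> t; rewrite addr_ge0.
- by apply: ae_leS2 fh gk => t Hf Hg Dt; rewrite Hf// Hg.
Qed.

Lemma ae_borel_powR (R : realType) (D : set R) (f : R -> R) (p : R) :
  ae_borel D f -> ae_borel D (fun t => f t `^ p).
Proof.
move=> [h [mh h0 fh]]; exists (fun t => h t `^ p); split.
- exact: (measurableT_comp (measurable_powR p)).
- by move=> t; rewrite powR_ge0.
- by apply: ae_leS fh => t Hf Dt; rewrite Hf.
Qed.

Lemma ae_borel_cst (R : realType) (D : set R) (c : R) : 0 <= c -> ae_borel D (fun=> c).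
Proof. by move=> c0; exists (cst c); split => //; exact: ae_leb_all. Qed.

Lemma ae_borel_weight (R : realType) (D : set R) (kappa : R) :
  ae_borel D (fun t => `|t| `^ kappa).
Proof.
exists (fun t => `|t| `^ kappa); split => //; last exact: ae_leb_all.
apply: (measurableT_comp (measurable_powR kappa)).
exact: normr_measurable.
Qed.

(** A supremum over simple functions is additive only for measurable integrands; passing to Borel
    representatives changes none of the three integrals. *)
Lemma lower_integralD (R : realType) (D : set R) (f g : R -> R) : measurable D ->
  (forall t, D t -> 0 <= f t) -> (forall t, D t -> 0 <= g t) ->
  ae_borel D f -> ae_borel D g ->
  (\int[@leb R]_(t in D) (f t + g t)%:E =
   \int[@leb R]_(t in D) (f t)%:E + \int[@leb R]_(t in D) (g t)%:E)%E.
Proof.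
move=> mD f0 g0 [h [mh h0 fh]] [k [mk k0 gk]].
rewrite (eq_integral_leb f0 (fun t _ => h0 t) fh) (eq_integral_leb g0 (fun t _ => k0 t) gk).
rewrite (@eq_integral_leb _ D (fun t => f t + g t) (fun t => h t + k t)); first last.
- by apply: ae_leS2 fh gk => t H1 H2 Dt; rewrite H1// H2.
- by move=> x Dx; rewrite addr_ge0.
- by move=> x Dx; rewrite addr_ge0 ?f0 ?g0.
under eq_integral do rewrite EFinD.
by apply: (@ge0_integralD _ _ _ (@lebesgue_measure R)) => //; 
   try (by move=> x _; rewrite lee_fin); apply/measurable_EFinP; exact: measurable_funTS.
Qed.

Lemma lower_integralZ (R : realType) (D : set R) (c : R) (f : R -> R) : measurable D -> 0 <= c ->
  (forall t, D t -> 0 <= f t) -> ae_borel D f ->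
  (\int[@leb R]_(t in D) (c * f t)%:E = c%:E * \int[@leb R]_(t in D) (f t)%:E)%E.
Proof.
move=> mD c0 f0 [h [mh h0 fh]].
rewrite (eq_integral_leb f0 (fun t _ => h0 t) fh).
rewrite (@eq_integral_leb _ D (fun t => c * f t) (fun t => c * h t)); first last.
- by apply: ae_leS fh => t H1 Dt; rewrite H1.
- by move=> x Dx; rewrite mulr_ge0.
- by move=> x Dx; rewrite mulr_ge0 ?f0.
under eq_integral do rewrite EFinM.
by apply: (@ge0_integralZl_EFin _ _ _ (@lebesgue_measure R)) => //; 
   try (by move=> x _; rewrite lee_fin); apply/measurable_EFinP; exact: measurable_funTS.
Qed.

Lemma lower_integralU (R : realType) (A B : set R) (f : R -> R) :
  measurable A -> measurable B -> [disjoint A & B] ->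
  (forall t, (A `|` B) t -> 0 <= f t) -> ae_borel (A `|` B) f ->
  (\int[@leb R]_(t in A `|` B) (f t)%:E =
   \int[@leb R]_(t in A) (f t)%:E + \int[@leb R]_(t in B) (f t)%:E)%E.
Proof.
move=> mA mB AB f0 [h [mh h0 fh]].
rewrite (eq_integral_leb f0 (fun t _ => h0 t) fh).
rewrite (@eq_integral_leb _ A f h)//; first last.
- by apply: ae_leS fh => t H At; rewrite H//; left.
- by move=> x Ax; rewrite f0//; left.
rewrite (@eq_integral_leb _ B f h)//; first last.
- by apply: ae_leS fh => t H At; rewrite H//; right.
- by move=> x Ax; rewrite f0//; right.
apply: (@ge0_integral_setU _ _ _ (@lebesgue_measure R)) => //; last by move=> x _; rewrite lee_fin.
by apply/measurable_EFinP; apply: measurable_funTS.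
Qed.

(** * Strong measurability *)

Definition step_add (R : realType) (X : normedModType R) (s s' : step X) : step X :=
  Step (st_n s + st_n s')
    (fun i => if (i < st_n s)%N then st_A s i else st_A s' (i - st_n s))
    (fun i => if (i < st_n s)%N then st_x s i else st_x s' (i - st_n s)).

Definition step_map (R : realType) (X Y : normedModType R) (phi : X -> Y) (s : step X) : step Y :=
  Step (st_n s) (st_A s) (phi \o st_x s).

Definition step_restr (R : realType) (X : normedModType R) (E : set R) (s : step X) : step X :=
  Step (st_n s) (fun i => st_A s i `&` E) (st_x s).

Lemma step_add_meas (R : realType) (X : normedModType R) (s s' : step X) :
  step_meas s -> step_meas s' -> step_meas (step_add s s').
Proof. by move=> ms ms' i /=; case: ifP. Qed.

Lemma step_fun_add (R : realType) (X : normedModType R) (s s' : step X) (t : R) :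
  step_fun (step_add s s') t = step_fun s t + step_fun s' t.
Proof.
rewrite /step_fun /= big_split_ord /=; congr (_ + _); apply: eq_bigr => i _ /=.
  by rewrite ltn_ord.
by rewrite ltnNge leq_addr /= addKn.
Qed.

Lemma step_int_add (R : realType) (X : normedModType R) (D : set R) (s s' : step X) :
  step_int D (step_add s s') = step_int D s + step_int D s'.
Proof.
rewrite /step_int /= big_split_ord /=; congr (_ + _); apply: eq_bigr => i _ /=.
  by rewrite ltn_ord.
by rewrite ltnNge leq_addr /= addKn.
Qed.

Lemma step_fun_map (R : realType) (X Y : normedModType R) (phi : {linear X -> Y}) (s : step X) (t : R) :
  step_fun (step_map phi s) t = phi (step_fun s t).
Proof. by rewrite /step_fun linear_sum; apply: eq_bigr => i _; rewrite linearZ. Qed.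

Lemma step_int_map (R : realType) (X Y : normedModType R) (phi : {linear X -> Y}) (D : set R) (s : step X) :
  step_int D (step_map phi s) = phi (step_int D s).
Proof. by rewrite /step_int linear_sum; apply: eq_bigr => i _; rewrite linearZ. Qed.

Lemma step_fun_restr (R : realType) (X : normedModType R) (E : set R) (s : step X) (t : R) :
  step_fun (step_restr E s) t = \1_E t *: step_fun s t.
Proof.
rewrite /step_fun scaler_sumr; apply: eq_bigr => i _ /=.
by rewrite indicI /= mulrC scalerA.
Qed.

(** A step function takes finitely many values, so every predicate [P], Borel or not, has a
    measurable preimage and no sigma-algebra on [X] is involved. The induction splits along the last
    set and absorbs [x n] into [P]. *)
Lemma measurable_step_pred (R : realType) (X : normedModType R) (n : nat) (A : nat -> set R)
  (x : nat -> X) (P : X -> Prop) : (forall i, measurable (A i)) ->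
  measurable [set t | P (\sum_(i < n) \1_(A i) t *: x i)].
Proof.
move=> mA; elim: n P => [|n IH] P.
  have [P0|P0] := pselect (P 0).
    by rewrite (_ : [set _ | _] = setT)//; apply/seteqP; split => t //=; rewrite big_ord0.
  by rewrite (_ : [set _ | _] = set0)//; apply/seteqP; split => t //=; rewrite big_ord0.
rewrite (_ : [set _ | _] =
  (A n `&` [set t | (fun y => P (y + x n)) (\sum_(i < n) \1_(A i) t *: x i)]) `|`
  (~` A n `&` [set t | P (\sum_(i < n) \1_(A i) t *: x i)])).
  by apply: measurableU; apply: measurableI => //; [exact: (IH (fun y => P (y + x n)))|exact: measurableC].
apply/seteqP; split => t /=; rewrite big_ord_recr /= indicE.
  have [At|At] := pselect (A n t); [rewrite mem_set// scale1r|rewrite memNset// scale0r addr0]; by [left|right].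
by case=> -[At]; [rewrite mem_set// scale1r|rewrite memNset// scale0r addr0].
Qed.

Lemma measurable_fun_step (R : realType) (X : normedModType R) (s : step X) (phi : X -> R) :
  step_meas s -> measurable_fun setT (fun t => phi (step_fun s t)).
Proof.
move=> ms _ Y mY; rewrite setTI.
exact: (@measurable_step_pred _ _ (st_n s) (st_A s) (st_x s) (fun y => Y (phi y))).
Qed.

Lemma integral_leb_cst (R : realType) (D : set R) (c : R) : measurable D ->
  (\int[@leb R]_(t in D) c%:E = c%:E * @leb R D)%E.
Proof. by move=> mD; apply: (@integral_cst _ _ _ (@lebesgue_measure R)). Qed.

Lemma leb_split (R : realType) (A E : set R) : measurable A -> measurable E ->
  (@leb R E < +oo)%E -> fine (@leb R E) = fine (@leb R (E `&` A)) + fine (@leb R (E `&` ~` A)).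
Proof.
move=> mA mE E0; rewrite -fineD.
- rewrite addrC -[X in _ = fine (_ + X)%E]/(@lebesgue_measure R (E `&` A)); congr fine.
  by rewrite -setDE; exact: (@measureDI _ _ _ (@lebesgue_measure R)).
- rewrite ge0_fin_numE; last exact: (@measure_ge0 _ _ _ (@lebesgue_measure R)).
  apply: le_lt_trans E0; apply: (@le_measure _ _ _ (@lebesgue_measure R)); rewrite ?inE//.
  exact: measurableI.
- rewrite ge0_fin_numE; last exact: (@measure_ge0 _ _ _ (@lebesgue_measure R)).
  apply: le_lt_trans E0; apply: (@le_measure _ _ _ (@lebesgue_measure R)); rewrite ?inE//.
  by apply: measurableI => //; exact: measurableC.
Qed.

Lemma leb_subset (R : realType) (A E : set R) : measurable A -> measurable E -> A `<=` E ->
  (@leb R A <= @leb R E)%E.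
Proof. by move=> mA mE AE; apply: (@le_measure _ _ _ (@lebesgue_measure R)); rewrite ?inE. Qed.

(* Induction on the number of sets, splitting [E] along the last one: the sets of a
   [step] may overlap, so the values of [step_fun] are not directly the [st_x s i]. *)
Lemma norm_sum_le_integral (R : realType) (X : normedModType R) (n : nat) (A : nat -> set R)
  (x : nat -> X) (y : X) (E : set R) :
  (forall i, measurable (A i)) -> measurable E -> (@leb R E < +oo)%E ->
  ((`|fine (@leb R E) *: y + \sum_(i < n) fine (@leb R (A i `&` E)) *: x i|)%:E <=
   \int[@leb R]_(t in E) (`|y + \sum_(i < n) \1_(A i) t *: x i|)%:E)%E.
Proof.
move=> mA; elim: n y E => [|n IH] y E mE E0.
  rewrite big_ord0 addr0 normrZ.
  under eq_integral do rewrite big_ord0 addr0.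
  rewrite integral_leb_cst// mulrC EFinM ger0_norm; last by apply: fine_ge0; exact: (@measure_ge0 _ _ _ (@lebesgue_measure R)).
  by rewrite fineK// ge0_fin_numE//; exact: (@measure_ge0 _ _ _ (@lebesgue_measure R)).
have mnA : measurable (~` A n) by exact: measurableC.
have mE1 : measurable (E `&` A n) by exact: measurableI.
have mE2 : measurable (E `&` ~` A n) by exact: measurableI.
have E10 : (@leb R (E `&` A n) < +oo)%E by apply: le_lt_trans E0; apply: leb_subset.
have E20 : (@leb R (E `&` ~` A n) < +oo)%E by apply: le_lt_trans E0; apply: leb_subset.
(* The shift [y] collects the values of the sets already split off: on [A n] it becomes [y + x n],
   off [A n] it stays [y], and the induction hypothesis applies to both pieces. *)
have -> : fine (@leb R E) *: y + \sum_(i < n.+1) fine (@leb R (A i `&` E)) *: x i =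
  (fine (@leb R (E `&` A n)) *: (y + x n) + \sum_(i < n) fine (@leb R (A i `&` (E `&` A n))) *: x i) +
  (fine (@leb R (E `&` ~` A n)) *: y + \sum_(i < n) fine (@leb R (A i `&` (E `&` ~` A n))) *: x i).
  rewrite big_ord_recr /= (leb_split (mA n) mE E0) (setIC (A n) E).
  rewrite (eq_bigr (fun i : 'I_n => fine (@leb R (A i `&` (E `&` A n))) *: x i + fine (@leb R (A i `&` (E `&` ~` A n))) *: x i)).
    by rewrite big_split /= scalerDl scalerDr [LHS](AC (2*(2*1)) ((1*5*3)*(2*4))).
  move=> i _; rewrite -scalerDl !setIA -leb_split//; first exact: measurableI.
  by apply: le_lt_trans E0; apply: leb_subset => //; exact: measurableI.
apply: (@le_trans _ _ (`|fine (@leb R (E `&` A n)) *: (y + x n) + \sum_(i < n) fine (@leb R (A i `&` (E `&` A n))) *: x i|%:E +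
  `|fine (@leb R (E `&` ~` A n)) *: y + \sum_(i < n) fine (@leb R (A i `&` (E `&` ~` A n))) *: x i|%:E)%E).
  by rewrite -EFinD lee_fin ler_normD.
rewrite [X in (_ <= integral _ X _)%E](_ : E = (E `&` A n) `|` (E `&` ~` A n)); last by rewrite -setIUr setUCr setIT.
rewrite lower_integralU//.
- apply: leeD.
    apply: le_trans (IH _ _ mE1 E10) _.
    apply: le_integral_leb => //; apply: ae_leb_all => t [_ At].
    by rewrite big_ord_recr /= indicE mem_set// scale1r addrAC addrA.
  apply: le_trans (IH _ _ mE2 E20) _.
  apply: le_integral_leb => //; apply: ae_leb_all => t [_ At].
  by rewrite big_ord_recr /= indicE memNset// scale0r addr0.
- by apply/disj_setPRL => t [_ +] [_].
- apply: (@ae_borel_sub _ _ setT) => //; apply: ae_borel_measurable => //.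
  exact: (@measurable_fun_step _ _ (Step n.+1 A x) (fun z => `|y + z|)).
Qed.

Lemma norm_step_int_le (R : realType) (X : normedModType R) (D : set R) (s : step X) :
  step_meas s -> measurable D -> (@leb R D < +oo)%E ->
  ((`|step_int D s|)%:E <= \int[@leb R]_(t in D) (`|step_fun s t|)%:E)%E.
Proof.
move=> ms mD D0; have := @norm_sum_le_integral _ _ (st_n s) (st_A s) (st_x s) 0 D ms mD D0.
by rewrite scaler0 add0r; under eq_integral do rewrite add0r.
Qed.

Lemma sm_sub (R : realType) (X : normedModType R) (D E : set R) (f : R -> X) :
  D `<=` E -> strongly_meas E f -> strongly_meas D f.
Proof.
by move=> DE [s [ms sf]]; exists s; split => //; apply: ae_leS sf => t H /DE /H.
Qed.

Lemma sm_ae_eq (R : realType) (X : normedModType R) (D : set R) (f g : R -> X) :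
  {ae @leb R, forall t, D t -> f t = g t} -> strongly_meas D f -> strongly_meas D g.
Proof.
move=> fg [s [ms sf]]; exists s; split => //; apply: ae_leS2 fg sf => t fg H Dt.
by rewrite -fg//; exact: H.
Qed.

Lemma smD (R : realType) (X : normedModType R) (D : set R) (f g : R -> X) :
  strongly_meas D f -> strongly_meas D g -> strongly_meas D (fun t => f t + g t).
Proof.
move=> [s [ms sf]] [s' [ms' sg]]; exists (fun n => step_add (s n) (s' n)); split.
  by move=> n; exact: step_add_meas.
apply: ae_leS2 sf sg => t Hf Hg Dt.
under eq_fun do rewrite step_fun_add.
by apply: cvgD; [exact: Hf|exact: Hg].
Qed.

Lemma sm_linear (R : realType) (X Y : normedModType R) (phi : {linear X -> Y}) (D : set R) (f : R -> X) :
  continuous phi -> strongly_meas D f -> strongly_meas D (fun t => phi (f t)).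
Proof.
move=> cphi [s [ms sf]]; exists (fun n => step_map phi (s n)); split; first by move=> n i; exact: ms.
apply: ae_leS sf => t Hf Dt.
under eq_fun do rewrite step_fun_map.
by apply: (@cvg_comp _ _ _ (fun n => step_fun (s n) t) phi); [exact: Hf|exact: cphi].
Qed.

Lemma smZ (R : realType) (X : normedModType R) (D : set R) (c : R) (f : R -> X) :
  strongly_meas D f -> strongly_meas D (fun t => c *: f t).
Proof. by move=> sf; apply: (@sm_linear _ _ _ ( *:%R c)) => //; exact: scaler_continuous. Qed.

Lemma smN (R : realType) (X : normedModType R) (D : set R) (f : R -> X) :
  strongly_meas D f -> strongly_meas D (fun t => - f t).
Proof. by move=> sf; under eq_fun do rewrite -scaleN1r; exact: smZ. Qed.

Lemma smB (R : realType) (X : normedModType R) (D : set R) (f g : R -> X) :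
  strongly_meas D f -> strongly_meas D g -> strongly_meas D (fun t => f t - g t).
Proof. by move=> sf sg; apply: smD => //; exact: smN. Qed.

Lemma sm_cst0 (R : realType) (X : normedModType R) (D : set R) :
  strongly_meas D (fun=> 0 : X).
Proof.
exists (fun=> Step 0 (fun=> set0) (fun=> 0)); split; first by move=> n i; exact: measurable0.
apply: ae_leb_all => t _.
by rewrite /step_fun /= big_ord0; exact: cvg_cst.
Qed.

Lemma sm_indic (R : realType) (X : normedModType R) (D E : set R) (f : R -> X) :
  measurable E -> strongly_meas (D `&` E) f -> strongly_meas D (fun t => \1_E t *: f t).
Proof.
move=> mE [s [ms sf]]; exists (fun n => step_restr E (s n)); split => //.
  by move=> n i; apply: measurableI => //; exact: ms.
apply: ae_leS sf => t Hf Dt.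
under eq_fun do rewrite step_fun_restr.
rewrite indicE; have [Et|Et] := pselect (E t).
  by rewrite mem_set// scale1r; under eq_fun do rewrite scale1r; exact: Hf.
by rewrite memNset// scale0r; under eq_fun do rewrite scale0r; exact: cvg_cst.
Qed.

(** The upper limit of the norms of the step functions is a Borel representative; [fine] and the
    outer absolute value keep it real and nonnegative where the sequence diverges. *)
Lemma sm_norm (R : realType) (X : normedModType R) (D : set R) (f : R -> X) :
  strongly_meas D f -> ae_borel D (fun t => `|f t|).
Proof.
move=> [s [ms sf]].
exists (fun t => `|fine (limn_esup (fun n => (`|step_fun (s n) t|)%:E))|); split => //.
  apply: (measurableT_comp (@normr_measurable R setT)).
  apply: (measurableT_comp (fine_measurable _)) => //.
  apply: measurable_fun_limn_esup => n; apply/measurable_EFinP.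
  exact: (measurable_fun_step (fun x => `|x|)).
apply: ae_leS sf => t Hf Dt.
have /cvg_limn_einf_sup[_ ->] : (fun n => (`|step_fun (s n) t|)%:E) @ \oo --> (`|f t|)%:E.
  by apply: cvg_EFin; [exact: nearW|apply: cvg_norm; exact: Hf].
by rewrite /= normr_id.
Qed.

Lemma cvg_le_cst (R : realType) (u : nat -> R) (l c : R) (k : nat) :
  u @ \oo --> l -> (forall n, (k <= n)%N -> u n <= c) -> l <= c.
Proof.
move=> cu H; rewrite -(cvg_lim (@Rhausdorff R) cu); apply: limr_le; first exact: cvgP cu.
by exists k.
Qed.

Lemma cvge_le (R : realType) (u v : nat -> \bar R) (l m : \bar R) :
  u @ \oo --> l -> v @ \oo --> m -> (forall n, (u n <= v n)%E) -> (l <= m)%E.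
Proof.
move=> cu cv H; rewrite -(cvg_lim (@ereal_hausdorff R) cu) -(cvg_lim (@ereal_hausdorff R) cv).
by apply: lee_lim; [exact: cvgP cu|exact: cvgP cv|exact: nearW].
Qed.

(** A diagonal sequence in the manner of Egorov and Borel-Cantelli: [k n] is so large that the
    approximants of [f_ n] from there on oscillate by more than 2^-n only on a set of measure at
    most 2^-(n+1). Almost every t lies in finitely many of these sets, and outside them [s n (k n)]
    is within 2^-n of [f_ n]. *)
Lemma sm_lim (R : realType) (X : normedModType R) (D : set R) (f_ : nat -> R -> X) (f : R -> X) :
  measurable D -> (@leb R D < +oo)%E -> (forall n, strongly_meas D (f_ n)) ->
  {ae @leb R, forall t, D t -> (fun n => f_ n t) @ \oo --> f t} -> strongly_meas D f.
Proof.
move=> mD D0 sf ff.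
have [s hs] := choice sf.
(* Oscillation is measured between approximants and not against [f_ n], which makes [E n k] a Borel
   set. *)
pose E n k := D `&` \bigcup_(i in [set i | (k <= i)%N]) \bigcup_(j in [set j | (k <= j)%N])
  [set t | (2^-1) ^+ n < `|step_fun (s n i) t - step_fun (s n j) t| ].
have mE n k : measurable (E n k).
  apply: measurableI => //; apply: bigcup_measurable => i _; apply: bigcup_measurable => j _.
  pose s' := step_add (s n i) (step_map (GRing.opp : {linear X -> X}) (s n j)).
  have ms' : step_meas s'.
    by apply: step_add_meas; [exact: (hs n).1|move=> l /=; exact: (hs n).1].
  have := @measurable_step_pred _ _ (st_n s') (st_A s') (st_x s') (fun y => (2^-1) ^+ n < `|y|) ms'.
  congr measurable; apply/seteqP; split => t /=;
  by rewrite -/(step_fun s' t) step_fun_add step_fun_map.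
have Enull n : exists k, (@leb R (E n k) <= (2^-1 ^+ n.+1)%:E)%E.
  (* Continuity from above, which uses the finite measure of [D]; the intersection is null because
     [s n] converges almost everywhere on [D]. *)
  have : (@lebesgue_measure R \o E n) @ \oo --> @lebesgue_measure R (\bigcap_k E n k).
    apply: nonincreasing_cvg_mu => //.
    - by apply: le_lt_trans D0; apply: leb_subset => //; move=> t [].
    - by move=> i; exact: mE.
    - by apply: bigcap_measurable => // i _; exact: mE.
    - move=> k l kl; apply/subsetPset => t [Dt [i /= li [j lj H]]]; split => //.
      by exists i; [exact: leq_trans li|exists j => //; exact: leq_trans lj].
  have -> : @lebesgue_measure R (\bigcap_k E n k) = 0%E.
    have : (@lebesgue_measure R).-negligible (\bigcap_k E n k).
      apply: negligibleS (hs n).2 => t Ht /= cvt.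
      have Dt : D t by have [] := Ht 0%N I.
      have /cvgrPdist_lt /(_ ((2^-1) ^+ n.+1)) := cvt Dt.
      rewrite exprn_gt0 ?invr_gt0// => /(_ isT)[k _ Hk].
      have [_ [i ki [j kj]]] := Ht k I.
      apply/negP; rewrite -leNgt.
      have -> : step_fun (s n i) t - step_fun (s n j) t = (f_ n t - step_fun (s n j) t) - (f_ n t - step_fun (s n i) t).
        by rewrite opprB [RHS]addrC addrA subrK.
      apply: le_trans (ler_normB _ _) _.
      have := Hk i ki; have := Hk j kj => /= /ltW h1 /ltW h2.
      apply: le_trans (lerD h1 h2) _; rewrite exprS -mulrDl -mulr2n -[_ *+ 2]mulr_natr mulVf//.
      by rewrite mul1r.
    by move/negligibleP; apply; apply: bigcap_measurable => // i _; exact: mE.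
  move/fine_cvgP => [[k0 _ Hk0] /cvgrPdist_lt /(_ ((2^-1) ^+ n.+1))].
  rewrite exprn_gt0 ?invr_gt0// => /(_ isT)[k _ Hk].
  exists (maxn k0 k); rewrite -(@fineK _ (@leb R _)); last exact: Hk0 (leq_maxl _ _).
  have := Hk _ (leq_maxr k0 k); rewrite /= sub0r normrN => /ltW; rewrite lee_fin.
  exact: le_trans (ler_norm _).
have [k hk] := choice Enull.
exists (fun n => s n (k n)); split; first by move=> n; exact: (hs n).1.
have lim0 : @lebesgue_measure R (lim_sup_set (fun n => E n (k n))) = 0%E.
  apply: lim_sup_set_cvg0; first by move=> n; exact: mE.
  apply: (@le_lt_trans _ _ (\sum_(0 <= i <oo) (cst 0 i + (1 / (2 ^ i.+1)%:R)%:E))%E).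
    apply: lee_nneseries => [n *|n *]; first exact: (@measure_ge0 _ _ _ (@lebesgue_measure R)).
    by rewrite add0e natrX mul1r -exprVn; exact: hk.
  by apply: le_lt_trans (epsilon_trick _ _ _) _ => //; rewrite eseries0// add0e ltry.
have mlim : measurable (lim_sup_set (fun n => E n (k n)) : set R).
  by apply: bigcap_measurable => // n _; apply: bigcup_measurable => // j _; exact: mE.
have good : {ae @leb R, forall t, ~ lim_sup_set (fun n => E n (k n)) t}.
  exists (lim_sup_set (fun n => E n (k n))); split; [exact: mlim|exact: lim0|].
  by move=> t /= /contrapT.
have allc : {ae @leb R, forall t, forall n, D t -> step_fun (s n m) t @[m --> \oo] --> f_ n t}.
  by apply: (@ae_foralln _ _ _ (@lebesgue_measure R)) => n; exact: (hs n).2.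
have := ae_leS2 (fun t a b => conj a b) good allc.
move=> good2; apply: ae_leS2 ff good2 => t ft [Nt ct] Dt.
have [n0 Hn0] : exists n0, forall n, (n0 <= n)%N -> ~ E n (k n) t.
  apply: contrapT => H; apply: Nt => n _.
  apply: contrapT => H2; apply: H; exists n => m nm Em; apply: H2; by exists m.
have dist n : (n0 <= n)%N -> `|f_ n t - step_fun (s n (k n)) t| <= (2^-1) ^+ n.
  move=> nn; have cc := ct n Dt.
  have c2 : (fun m => `|step_fun (s n m) t - step_fun (s n (k n)) t|) @ \oo --> `|f_ n t - step_fun (s n (k n)) t|.
    by apply: cvg_norm; apply: cvgB => //; exact: cvg_cst.
  apply: (@cvg_le_cst _ _ _ _ (k n) c2) => m km; rewrite leNgt; apply/negP => H.
  by apply: (Hn0 n nn); split => //; exists m => //; exists (k n) => /=.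
have -> : f t = f t - 0 by rewrite subr0.
rewrite (_ : (fun n => step_fun (s n (k n)) t) = (fun n => f_ n t - (f_ n t - step_fun (s n (k n)) t))); last first.
  by apply/funext => n; rewrite opprB addrC subrK.
apply: cvgB; first exact: ft.
apply/norm_cvg0P.
apply: (@squeeze_cvgr _ _ _ _ (fun=> 0) (fun n => (2^-1) ^+ n)).
- by exists n0 => // n /= nn; rewrite normr_ge0 dist.
- exact: cvg_cst.
- by apply: cvg_expr; rewrite ger0_norm ?invr_ge0// invf_lt1// ltr1n.
Qed.

(** * Bochner integrals and weighted spaces *)

Lemma sm_step (R : realType) (X : normedModType R) (D : set R) (s : step X) :
  step_meas s -> strongly_meas D (step_fun s).
Proof.
move=> ms; exists (fun=> s); split => //.
by apply: ae_leb_all => t _; exact: cvg_cst.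
Qed.

Lemma integral_norm_ge0 (R : realType) (X : normedModType R) (D : set R) (f : R -> X) :
  (0 <= \int[@leb R]_(t in D) (`|f t|)%:E)%E.
Proof. by apply: (@integral_ge0 _ _ _ (@lebesgue_measure R)) => t _; rewrite lee_fin. Qed.

Lemma integral_norm_le_add (R : realType) (X : normedModType R) (D : set R) (f g h : R -> X) :
  measurable D -> strongly_meas D g -> strongly_meas D h ->
  (forall t, D t -> `|f t| <= `|g t| + `|h t|) ->
  (\int[@leb R]_(t in D) (`|f t|)%:E <=
   \int[@leb R]_(t in D) (`|g t|)%:E + \int[@leb R]_(t in D) (`|h t|)%:E)%E.
Proof.
move=> mD sg sh H; rewrite -lower_integralD//; try exact: sm_norm.
by apply: le_integral_leb; [move=> t _|move=> t _; rewrite addr_ge0|apply: ae_leb_all => t; exact: H].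
Qed.

Lemma bochnerB (R : realType) (X : normedModType R) (D : set R) (f g : R -> X) (v w : X) :
  measurable D -> is_bochner D f v -> is_bochner D g w ->
  is_bochner D (fun t => f t - g t) (v - w).
Proof.
move=> mD [smf [s [si [sf sv]]]] [smg [s' [si' [sg sw]]]]; split; first exact: smB.
exists (fun n => step_add (s n) (step_map (GRing.opp : {linear X -> X}) (s' n))).
split; [|split].
- move=> n; split.
    by apply: step_add_meas; [exact: (si n).1|move=> i; exact: (si' n).1].
  move=> i /= ilt; case: ifPn => [ii|]; first exact: (si n).2.
  rewrite -leqNgt => ni; apply: (si' n).2.
  by rewrite -(ltn_add2l (st_n (s n))) subnKC.
- apply: (@squeeze_cvge _ _ _ _ (fun=> 0%E) _ (fun n =>
    (\int[@leb R]_(t in D) (`|step_fun (s n) t - f t|)%:E +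
     \int[@leb R]_(t in D) (`|step_fun (s' n) t - g t|)%:E)%E)).
  + apply: nearW => n; rewrite integral_norm_ge0 /=.
    apply: integral_norm_le_add => //.
    * by apply: smB => //; apply: sm_step; exact: (si n).1.
    * by apply: smB => //; apply: sm_step; exact: (si' n).1.
    * move=> t _; rewrite step_fun_add step_fun_map.
      rewrite (_ : _ - _ = (step_fun (s n) t - f t) - (step_fun (s' n) t - g t)); first exact: ler_normB.
      by rewrite !opprD !opprK [LHS](AC (2*2) ((1*3)*(2*4))).
  + exact: cvg_cst.
  + by rewrite -[X in _ --> X]adde0; apply: cvgeD => //.
- rewrite (_ : (fun n => _) = (fun n => step_int D (s n) - step_int D (s' n))); first exact: cvgB.
  by apply/funext => n; rewrite step_int_add step_int_map.
Qed.

Lemma bochner_set0 (R : realType) (X : normedModType R) (g : R -> X) : is_bochner set0 g 0.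
Proof.
pose s0 : step X := Step 0 (fun=> set0) (fun=> 0).
split; first by exists (fun=> s0); split; [move=> n i; exact: measurable0|exact: ae_leb_all].
exists (fun=> s0); split; [|split].
- by move=> n; split => // i; exact: measurable0.
- by under eq_fun do rewrite integral_set0; exact: cvg_cst.
- by rewrite /step_int /= big_ord0; exact: cvg_cst.
Qed.

Lemma leb_fin (R : realType) (A E : set R) : measurable A -> measurable E -> (@leb R E < +oo)%E ->
  (@leb R (A `&` E)) \is a fin_num.
Proof.
move=> mA mE E0; rewrite ge0_fin_numE; last exact: (@measure_ge0 _ _ _ (@lebesgue_measure R)).
by apply: le_lt_trans E0; apply: leb_subset => //; exact: measurableI.
Qed.

Lemma step_intU (R : realType) (X : normedModType R) (D E : set R) (s : step X) :
  measurable D -> measurable E -> (@leb R D < +oo)%E -> (@leb R E < +oo)%E ->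
  D `&` E = set0 -> step_meas s -> step_int (D `|` E) s = step_int D s + step_int E s.
Proof.
move=> mD mE D0 E0 DE ms; rewrite /step_int -big_split /=; apply: eq_bigr => i _.
rewrite -scalerDl -fineD ?leb_fin// setIUr; congr (fine _ *: _).
have mAD : measurable (st_A s i `&` D : set R) by apply: measurableI.
have mAE : measurable (st_A s i `&` E : set R) by apply: measurableI.
apply: (@measureU _ _ _ (@lebesgue_measure R) _ _ mAD mAE).
by rewrite setIACA setIid DE setI0.
Qed.

(** The two integrals come with unrelated approximating sequences. Comparing these on [D] costs two
    error terms that tend to zero, so neither additivity nor uniqueness of the Bochner integral has
    to be proved first. Empty [D] gives the usual norm bound. *)
Lemma bochner_diff_le (R : realType) (X : normedModType R) (D E : set R) (g : R -> X) (v w : X) :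
  measurable D -> measurable E -> (@leb R D < +oo)%E -> (@leb R E < +oo)%E -> D `&` E = set0 ->
  is_bochner (D `|` E) g v -> is_bochner D g w ->
  ((`|v - w|)%:E <= \int[@leb R]_(t in E) (`|g t|)%:E)%E.
Proof.
move=> mD mE D0 E0 DE [smg [s [si [sg sv]]]] [smg' [s' [si' [sg' sw]]]].
have ms n : step_meas (s n) := (si n).1.
have ms' n : step_meas (s' n) := (si' n).1.
have mDE : measurable (D `|` E) by exact: measurableU.
have smE : strongly_meas E g by apply: sm_sub smg; exact: subsetUr.
set G := (X in (_ <= X)%E).
have key n : ((`|step_int (D `|` E) (s n) - step_int D (s' n)|)%:E <=
  (\int[@leb R]_(t in D `|` E) (`|step_fun (s n) t - g t|)%:E +
   \int[@leb R]_(t in D) (`|step_fun (s' n) t - g t|)%:E) + G)%E.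
  rewrite step_intU// addrAC.
  apply: (@le_trans _ _ ((`|step_int D (s n) - step_int D (s' n)|)%:E + (`|step_int E (s n)|)%:E)%E).
    by rewrite -EFinD lee_fin ler_normD.
  rewrite lower_integralU//; last 2 first.
  - by apply/disj_setPS; rewrite DE.
  - by apply: sm_norm; apply: smB => //; exact: sm_step.
  rewrite [leRHS](AC (3*1) ((1*3)*(2*4))).
  apply: leeD.
    rewrite (_ : _ - _ = step_int D (step_add (s n) (step_map (GRing.opp : {linear X -> X}) (s' n)))); last first.
      by rewrite step_int_add step_int_map.
    apply: le_trans (norm_step_int_le _ _ _) _ => //.
      by apply: step_add_meas => // i; exact: ms'.
    apply: integral_norm_le_add => //; try by apply: smB => //; exact: sm_step.
    move=> t _; rewrite step_fun_add step_fun_map.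
    rewrite (_ : _ + _ = (step_fun (s n) t - g t) - (step_fun (s' n) t - g t)); first exact: ler_normB.
    by rewrite opprB addrA subrK.
  apply: le_trans (norm_step_int_le _ _ _) _ => //.
  apply: integral_norm_le_add => //; first by apply: smB => //; exact: sm_step.
  by move=> t _; rewrite -{1}(subrK (g t) (step_fun (s n) t)) ler_normD.
have c1 : (fun n => (`|step_int (D `|` E) (s n) - step_int D (s' n)|)%:E) @ \oo --> (`|v - w|)%:E.
  by apply: cvg_EFin; [exact: nearW|apply: cvg_norm; exact: cvgB].
have [Goo|Gfin] := eqVneq G +oo%E; first by rewrite Goo leey.
have Gf : G \is a fin_num by rewrite ge0_fin_numE ?integral_norm_ge0// lt_neqAle Gfin leey.
have c2 : (fun n => (\int[@leb R]_(t in D `|` E) (`|step_fun (s n) t - g t|)%:E +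
   \int[@leb R]_(t in D) (`|step_fun (s' n) t - g t|)%:E) + G)%E @ \oo --> G.
  rewrite -[X in _ --> X]add0e; apply: cvgeD; first by [].
    by rewrite -[X in _ --> X]adde0; apply: cvgeD.
  exact: cvg_cst.
exact: (cvge_le c1 c2 key).
Qed.

Lemma bochner_norm_le (R : realType) (X : normedModType R) (D : set R) (g : R -> X) (v : X) :
  measurable D -> (@leb R D < +oo)%E -> is_bochner D g v ->
  ((`|v|)%:E <= \int[@leb R]_(t in D) (`|g t|)%:E)%E.
Proof.
move=> mD D0 H; rewrite -[v]subr0.
apply: (@bochner_diff_le _ _ set0) => //; rewrite ?set0I ?set0U//.
  by rewrite /leb measure0.
exact: bochner_set0.
Qed.

(** The norm of the sum is at most twice the larger norm. This crude constant 2^p needs no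
    convexity; it is the factor that the contraction ratio has to compensate. *)
Lemma powR_normD_le (R : realType) (X : normedModType R) (p : R) (x y : X) : 0 <= p ->
  `|x + y| `^ p <= 2 `^ p * (`|x| `^ p + `|y| `^ p).
Proof.
move=> p0.
have h (u v : X) : `|u| <= `|v| -> `|u + v| `^ p <= 2 `^ p * `|v| `^ p.
  move=> uv; rewrite -powRM//; apply: ge0_ler_powR => //; rewrite ?nnegrE ?mulr_ge0//.
  by apply: le_trans (ler_normD _ _) _; rewrite mulr_natl mulr2n lerD2r.
have [xy|/ltW yx] := leP (`|x|) (`|y|).
  by apply: le_trans (h _ _ xy) _; rewrite ler_wpM2l ?powR_ge0// lerDr powR_ge0.
by rewrite addrC; apply: le_trans (h _ _ yx) _; rewrite ler_wpM2l ?powR_ge0// lerDl powR_ge0.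
Qed.

Lemma wLp_integrand_ge0 (R : realType) (X : normedModType R) (p kappa : R) (f : R -> X) (t : R) :
  0 <= (`|t| `^ kappa) * (`|f t| `^ p).
Proof. by rewrite mulr_ge0 ?powR_ge0. Qed.

Lemma ae_borel_wLp (R : realType) (X : normedModType R) (p kappa : R) (D : set R) (f : R -> X) :
  strongly_meas D f -> ae_borel D (fun t => (`|t| `^ kappa) * (`|f t| `^ p)).
Proof.
by move=> sf; apply: ae_borelM; [exact: ae_borel_weight|apply: ae_borel_powR; exact: sm_norm].
Qed.

Lemma wLp_int_ge0 (R : realType) (X : normedModType R) (p kappa a b : R) (f : R -> X) :
  (0 <= wLp_int p kappa a b f)%E.
Proof.
apply: (@integral_ge0 _ _ _ (@lebesgue_measure R)) => t _.
by rewrite lee_fin wLp_integrand_ge0.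
Qed.

Lemma wLp_intD (R : realType) (X : normedModType R) (p kappa a b : R) (f g : R -> X) :
  0 <= p -> strongly_meas `]a, b[%classic f -> strongly_meas `]a, b[%classic g ->
  (wLp_int p kappa a b (fun t => (f t + g t)%R) <= (2 `^ p)%:E * (wLp_int p kappa a b f + wLp_int p kappa a b g))%E.
Proof.
move=> p0 sf sg; rewrite /wLp_int -lower_integralD//; try (by move=> t _; exact: wLp_integrand_ge0);
  try exact: ae_borel_wLp.
rewrite -lower_integralZ//; last by apply: ae_borelD; exact: ae_borel_wLp.
apply: le_integral_leb.
- by move=> t _; exact: (wLp_integrand_ge0 _ _ (fun t => f t + g t)).
- by move=> t _; rewrite mulr_ge0 ?powR_ge0// addr_ge0 ?wLp_integrand_ge0.
- apply: ae_leb_all => t _; rewrite -mulrDr mulrCA ler_wpM2l ?powR_ge0//.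
  exact: powR_normD_le.
Qed.

Lemma wLp_int_eq (R : realType) (X : normedModType R) (p kappa a b : R) (f g : R -> X) :
  {ae @leb R, forall t, `]a, b[%classic t -> f t = g t} ->
  wLp_int p kappa a b f = wLp_int p kappa a b g.
Proof.
move=> fg; apply: eq_integral_leb; try (by move=> t _; exact: wLp_integrand_ge0).
by apply: ae_leS fg => t H /H ->.
Qed.

Lemma wLp_intN (R : realType) (X : normedModType R) (p kappa a b : R) (f : R -> X) :
  wLp_int p kappa a b (fun t => - f t) = wLp_int p kappa a b f.
Proof. by rewrite /wLp_int; under eq_integral do rewrite normrN. Qed.

Lemma wLpD (R : realType) (X : normedModType R) (p kappa a b : R) (f g : R -> X) :
  0 <= p -> wLp p kappa a b f -> wLp p kappa a b g -> wLp p kappa a b (fun t => f t + g t).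
Proof.
move=> p0 [sf f0] [sg g0]; split; first exact: (smD sf sg).
apply: (le_lt_trans (wLp_intD kappa p0 sf sg)).
apply: lte_mul_pinfty; [by rewrite lee_fin powR_ge0|by []|exact: (lte_add_pinfty f0 g0)].
Qed.

Lemma wLpN (R : realType) (X : normedModType R) (p kappa a b : R) (f : R -> X) :
  wLp p kappa a b f -> wLp p kappa a b (fun t => - f t).
Proof. by move=> [sf f0]; split; [exact: smN|rewrite wLp_intN]. Qed.

Lemma wLpB (R : realType) (X : normedModType R) (p kappa a b : R) (f g : R -> X) :
  0 <= p -> wLp p kappa a b f -> wLp p kappa a b g -> wLp p kappa a b (fun t => f t - g t).
Proof. by move=> p0 wf wg; exact: (@wLpD _ _ _ _ _ _ f (fun t => - g t) p0 wf (wLpN wg)). Qed.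

Lemma subset_itvoo_r (R : realType) (a b c : R) : c <= b -> `]a, c[%classic `<=` `]a, b[%classic.
Proof. by move=> cb t /=; rewrite !in_itv /= => /andP[-> /lt_le_trans]; apply. Qed.

Lemma wLp_int_sub (R : realType) (X : normedModType R) (p kappa a b c : R) (f : R -> X) :
  c <= b -> (wLp_int p kappa a c f <= wLp_int p kappa a b f)%E.
Proof.
move=> cb; apply: le_integral_leb_subset; first exact: subset_itvoo_r.
by move=> t _; exact: wLp_integrand_ge0.
Qed.

Lemma wLp_sub (R : realType) (X : normedModType R) (p kappa a b c : R) (f : R -> X) :
  c <= b -> wLp p kappa a b f -> wLp p kappa a c f.
Proof.
move=> cb [sf f0]; split; first by apply: sm_sub sf; exact: subset_itvoo_r.
by apply: le_lt_trans f0; exact: wLp_int_sub.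
Qed.

Lemma is_deriv_sub (R : realType) (X : normedModType R) (p kappa a b c : R) (u g : R -> X) (x : X) :
  c <= b -> is_deriv p kappa a b u g x -> is_deriv p kappa a c u g x.
Proof.
move=> cb [wg H]; split; first exact: wLp_sub wg.
by apply: ae_leS H => t H tc; apply: H; exact: subset_itvoo_r tc.
Qed.

Lemma is_derivB (R : realType) (X : normedModType R) (p kappa a b : R) (u u' g g' : R -> X) (x x' : X) :
  0 <= p -> is_deriv p kappa a b u g x -> is_deriv p kappa a b u' g' x' ->
  is_deriv p kappa a b (fun t => u t - u' t) (fun t => g t - g' t) (x - x').
Proof.
move=> p0 [wg H] [wg' H']; split; first exact: (wLpB p0 wg wg').
apply: ae_leS2 H H' => t H H' tc.
rewrite (_ : _ - _ = (u t - x) - (u' t - x')); first by apply: (bochnerB _ (H tc) (H' tc)).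
by rewrite !opprD !opprK [LHS](AC (2*2) ((1*3)*(2*4))).
Qed.

Lemma MR_sub (R : realType) (X0 X1 : normedModType R) (J : X1 -> X0) (p kappa a b c : R) (u : R -> X1) :
  c <= b -> MR J p kappa a b u -> MR J p kappa a c u.
Proof.
move=> cb [wu [wJ [g [x dg]]]]; split; first exact: wLp_sub wu.
split; first exact: wLp_sub wJ.
by exists g, x; exact: is_deriv_sub dg.
Qed.

Lemma strong_sol_sub (R : realType) (X0 X1 : normedModType R) (J : X1 -> X0)
    (Aop : R -> X1 -> X0) (a b c : R) (f : R -> X0) (ua : X0) (u : R -> X1) :
  c <= b -> strong_sol J Aop a b f ua u -> strong_sol J Aop a c f ua u.
Proof.
move=> cb [wu [wJ [wA [g [dg H]]]]]; split; first exact: wLp_sub wu.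
split; first exact: wLp_sub wJ.
split; first exact: wLp_sub wA.
exists g; split; first exact: is_deriv_sub dg.
by apply: ae_leS H => t H tc; apply: H; exact: subset_itvoo_r tc.
Qed.

Lemma MRB (R : realType) (X0 X1 : normedModType R) (J : {linear X1 -> X0}) (p kappa a b : R) (u v : R -> X1) :
  0 <= p -> MR J p kappa a b u -> MR J p kappa a b v -> MR J p kappa a b (fun t => u t - v t).
Proof.
move=> p0 [wu [wJ [g [x dg]]]] [wv [wJ' [g' [x' dg']]]]; split; first exact: (wLpB p0 wu wv).
have -> : J \o (fun t => u t - v t) = (fun t => (J \o u) t - (J \o v) t).
  by apply/funext => t /=; rewrite linearB.
split; first exact: (wLpB p0 wJ wJ').
by exists (fun t => g t - g' t), (x - x'); exact: (is_derivB p0 dg dg').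
Qed.

Lemma strong_solB (R : realType) (X0 X1 : normedModType R) (J : {linear X1 -> X0})
    (Aop : R -> X1 -> X0) (a b : R) (f f' : R -> X0) (x x' : X0) (u v : R -> X1) :
  (forall t y z, Aop t (y - z) = Aop t y - Aop t z) ->
  strong_sol J Aop a b f x u -> strong_sol J Aop a b f' x' v ->
  strong_sol J Aop a b (fun t => f t - f' t) (x - x') (fun t => u t - v t).
Proof.
move=> AB [wu [wJ [wA [g [dg H]]]]] [wu' [wJ' [wA' [g' [dg' H']]]]].
split; first exact: (wLpB ler01 wu wu').
have -> : J \o (fun t => u t - v t) = (fun t => (J \o u) t - (J \o v) t).
  by apply/funext => t /=; rewrite linearB.
split; first exact: (wLpB ler01 wJ wJ').
split; first by under eq_fun do rewrite AB; exact: (wLpB ler01 wA wA').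
exists (fun t => g t - g' t); split; first exact: (is_derivB ler01 dg dg').
apply: ae_leS2 H H' => t H H' tc.
by rewrite AB -H// -H'// opprD [LHS](AC (2*2) ((1*3)*(2*4))).
Qed.

Lemma MR_est_mono (R : realType) (X0 X1 : normedModType R) (J : X1 -> X0)
    (p kappa : R) (Aop : R -> X1 -> X0) (a b K K' : R) :
  K <= K' -> MR_est J p kappa Aop a b K -> MR_est J p kappa Aop a b K'.
Proof.
move=> KK' H f wf tau htau v Mv sv g c dg; apply: le_trans (H f wf tau htau v Mv sv g c dg) _.
by rewrite ler_wpM2r// powR_ge0.
Qed.

(** The 1 covers both cases of the encoded infimum: if the set of constants is bounded below, some
    constant lies within 1 of its infimum; if it is not, some constant lies below any given number,
    whatever value [inf] takes. *)
Lemma MR_est_const (R : realType) (X0 X1 : normedModType R) (J : X1 -> X0)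
    (p kappa : R) (Aop : R -> X1 -> X0) (a b : R) :
  (exists K, MR_est J p kappa Aop a b K) ->
  MR_est J p kappa Aop a b (MR_const J p kappa Aop a b + 1).
Proof.
move=> [K HK]; set S := [set K | MR_est J p kappa Aop a b K].
have [lS|nlS] := pselect (has_lbound S).
  have hS : has_inf S by split => //; exists K.
  have [K' SK' K'lt] := inf_adherent (@ltr01 R) hS.
  by apply: MR_est_mono SK'; exact: ltW.
have [K' [SK' K'lt]] : exists K', S K' /\ K' < MR_const J p kappa Aop a b + 1.
  apply: contrapT => H; apply: nlS; exists (MR_const J p kappa Aop a b + 1) => K' SK'.
  by rewrite leNgt; apply/negP => lt; apply: H; exists K'.
by apply: MR_est_mono SK'; exact: ltW.
Qed.

(** If the set of constants is not bounded below, [inf] takes its default value 0; this is where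
    [0 <= K] enters. *)
Lemma MR_const_le (R : realType) (X0 X1 : normedModType R) (J : X1 -> X0)
    (p kappa : R) (Aop : R -> X1 -> X0) (a b K : R) :
  0 <= K -> MR_est J p kappa Aop a b K -> MR_const J p kappa Aop a b <= K.
Proof.
move=> K0 HK; rewrite /MR_const; set S := [set _ | _].
have [lS|nlS] := pselect (has_lbound S); first exact: ge_inf.
by rewrite inf_out// => -[].
Qed.

(** * Power weights and the exponential weight *)

Lemma ae_exists_itv (R : realType) (a b : R) (P : R -> Prop) : a < b ->
  {ae @leb R, forall t, P t} -> exists t, a < t < b /\ P t.
Proof.
move=> ab [N [mN N0 subN]]; apply: contrapT => H.
have sub : `]a, b[%classic `<=` (N : set R).
  move=> t /=; rewrite in_itv /= => tab; apply: subN => /= Pt; apply: H; by exists t.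
have := @leb_subset _ _ _ (measurable_itv `]a, b[) mN sub.
rewrite N0 /leb lebesgue_measure_itv /= lte_fin ab -EFinB lee_fin subr_le0.
by rewrite leNgt ab.
Qed.

Lemma derivable_powRZ (R : realType) (al x : R) : 0 < x ->
  is_derive x 1 (fun s : R => al^-1 * s `^ al) (al^-1 * (al * x `^ (al - 1))).
Proof. by move=> x0; have H := is_derive1_powR al x0; exact: is_deriveZ. Qed.

Lemma powR_cont (R : realType) (al x : R) : 0 < x -> {for x, continuous (fun s : R => s `^ al)}.
Proof.
move=> x0; apply: differentiable_continuous; apply/derivable1_diffP.
by have := is_derive1_powR al x0; case.
Qed.

Lemma integral_powR (R : realType) (al a b : R) : al != 0 -> 0 < a -> a < b ->
  (\int[@leb R]_(s in `[a, b]) (s `^ (al - 1))%:E = (al^-1 * b `^ al - al^-1 * a `^ al)%:E)%E.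
Proof.
move=> al0 a0 ab; rewrite EFinB.
have pos x : x \in `[a, b] -> 0 < x by rewrite in_itv /= => /andP[ax _]; exact: lt_le_trans ax.
apply: (@continuous_FTC2 _ (fun s => s `^ (al - 1)) (fun s => al^-1 * s `^ al)) => //.
- apply: continuous_in_subspaceT => x /set_mem /= xab; apply: powR_cont; exact: pos.
- split.
  + move=> x xab; have x0 : 0 < x by apply: pos; exact: subset_itv_oo_cc.
    by have := derivable_powRZ al x0; case.
  + apply: cvg_at_right_filter; apply: cvgM; first exact: cvg_cst.
    exact: powR_cont.
  + apply: cvg_at_left_filter; apply: cvgM; first exact: cvg_cst.
    by apply: powR_cont; exact: lt_trans ab.
- move=> x xab; have x0 : 0 < x by apply: pos; exact: subset_itv_oo_cc.
  rewrite derive1E; have := derivable_powRZ al x0 => -[_ ->].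
  by rewrite mulrA mulVf// mul1r.
Qed.

Lemma measurable_powR_EFin (R : realType) (al : R) (D : set R) : measurable D ->
  measurable_fun D (fun s : R => (s `^ al)%:E).
Proof. by move=> mD; apply/measurable_EFinP; apply: measurable_funTS; exact: measurable_powR. Qed.

Lemma integral_powR0_le (R : realType) (al x : R) : 0 < al -> 0 < x ->
  (\int[@leb R]_(s in `]0%R, x[) (s `^ (al - 1))%:E <= (x `^ al / al)%:E)%E.
Proof.
(* Exhaustion by compact intervals away from the singularity at 0; [n.+2] keeps the left end
   strictly below [x] also for n = 0. *)
move=> al0 x0; pose F n := `[x / n.+2%:R, x]%classic : set R.
have cF : (\int[@lebesgue_measure R]_(s in F n) (s `^ (al - 1))%:E)%E @[n --> \oo] -->
    (\int[@lebesgue_measure R]_(s in \bigcup_n F n) (s `^ (al - 1))%:E)%E.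
  apply: ge0_nondecreasing_set_cvg_integral.
  - move=> n m nm; apply/subsetPset => s; rewrite /F /= !in_itv /= => /andP[h ->]; rewrite andbT.
    apply: le_trans h; rewrite ler_pM2l// lef_pV2 ?posrE//.
    by rewrite ler_nat !ltnS.
  - by move=> n; exact: measurable_itv.
  - by move=> n; apply: measurable_powR_EFin; exact: measurable_itv.
  - by move=> n s _; rewrite lee_fin powR_ge0.
apply: (@le_trans _ _ (\int[@leb R]_(s in \bigcup_n F n) (s `^ (al - 1))%:E)%E).
  apply: le_integral_leb_subset; last by move=> t _; exact: powR_ge0.
  move=> s /=; rewrite in_itv /= => /andP[s0 sx].
  exists (Num.truncn (x / s)) => //; rewrite /F /= in_itv /= (ltW sx) andbT.
  rewrite ler_pdivrMr// mulrC -ler_pdivrMr//; apply: ltW; apply: lt_trans (truncnS_gt _) _.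
  by rewrite ltr_nat.
apply: (@cvge_le _ _ (fun=> (x `^ al / al)%:E) _ _ cF); first exact: cvg_cst.
move=> n; rewrite integral_powR ?gt_eqF ?divr_gt0//; last first.
  by rewrite ltr_pdivrMr// ltr_pMr// ltr1n.
by rewrite lee_fin mulrC gerBl mulr_ge0 ?powR_ge0// invr_ge0 ltW.
Qed.

Lemma integral_powRy_le (R : realType) (al x : R) : 0 < al -> 0 < x ->
  (\int[@leb R]_(s in `[x, +oo[) (s `^ (- al - 1))%:E <= (x `^ (- al) / al)%:E)%E.
Proof.
move=> al0 x0; pose F n := `[x, x + n.+1%:R]%classic : set R.
have cF : (\int[@lebesgue_measure R]_(s in F n) (s `^ (- al - 1))%:E)%E @[n --> \oo] -->
    (\int[@lebesgue_measure R]_(s in \bigcup_n F n) (s `^ (- al - 1))%:E)%E.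
  apply: ge0_nondecreasing_set_cvg_integral.
  - move=> n m nm; apply/subsetPset => s; rewrite /F /= !in_itv /= => /andP[-> h] /=.
    by apply: le_trans h _; rewrite lerD2l ler_nat ltnS.
  - by move=> n; exact: measurable_itv.
  - by move=> n; apply: measurable_powR_EFin; exact: measurable_itv.
  - by move=> n s _; rewrite lee_fin powR_ge0.
apply: (@le_trans _ _ (\int[@leb R]_(s in \bigcup_n F n) (s `^ (- al - 1))%:E)%E).
  apply: le_integral_leb_subset; last by move=> t _; exact: powR_ge0.
  move=> s /=; rewrite in_itv /= andbT => xs.
  exists (Num.truncn (s - x)) => //; rewrite /F /= in_itv /= xs /=.
  by rewrite -lerBlDl; apply: ltW; exact: truncnS_gt.
apply: (@cvge_le _ _ (fun=> (x `^ (- al) / al)%:E) _ _ cF); first exact: cvg_cst.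
move=> n; rewrite integral_powR ?oppr_eq0 ?gt_eqF//; last by rewrite ltrDl.
rewrite lee_fin invrN !mulNr opprK addrC mulrC gerBl.
by rewrite mulr_ge0 ?powR_ge0// invr_ge0 ltW.
Qed.

(** For x > a one has x = x^(1-p) x^p <= a^(1-p) x^p. Integrated with a suitable threshold a,
    possibly depending on the variable, it does the work of Hoelder's inequality. *)
Lemma le_young (R : realType) (p a x : R) : 1 <= p -> 0 < a -> 0 <= x ->
  x <= a + a `^ (1 - p) * x `^ p.
Proof.
move=> p1 a0 x0; have [xa|ax] := leP x a.
  by apply: le_trans xa _; rewrite lerDl mulr_ge0 ?powR_ge0.
have x0' : 0 < x by exact: lt_trans ax.
rewrite -[leLHS]add0r; apply: lerD; first exact: ltW.
have -> : 1 - p = - (p - 1) by rewrite opprB.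
rewrite powRN mulrC ler_pdivlMr ?powR_gt0//.
have -> : x `^ p = x * x `^ (p - 1) by rewrite mulr_powRB1//; lra.
rewrite ler_pM2l//; apply: ge0_ler_powR; rewrite ?nnegrE; try exact: ltW; lra.
Qed.

Lemma itvoo_split (R : realType) (a b c : R) : a <= b -> b < c ->
  `]a, c[%classic = `]a, b]%classic `|` `]b, c[%classic :> set R.
Proof.
move=> ab bc; apply/seteqP; split => t /=; rewrite !in_itv /=.
  by move=> /andP[at_ tc]; have [tb|bt] := leP t b; [left|right]; apply/andP.
move=> [/andP[at_ tb]|/andP[bt tc]]; apply/andP; split => //.
  exact: le_lt_trans bc.
exact: le_lt_trans bt.
Qed.

(** * Cumulative integrals and the Gronwall weight *)

Definition cumul (R : realType) (g : R -> R) (t : R) : R :=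
  fine (\int[@leb R]_(s in `]0%R, t[) (g s)%:E)%E.

Lemma cumul_fin (R : realType) (g : R -> R) (t : R) : (forall s, 0 <= g s) ->
  (\int[@leb R]_s (g s)%:E < +oo)%E ->
  (\int[@leb R]_(s in `]0%R, t[) (g s)%:E = (cumul g t)%:E)%E.
Proof.
move=> g0 gi; rewrite /cumul fineK// ge0_fin_numE.
  by apply: le_lt_trans gi; exact: le_integral_leb_subset.
by apply: (@integral_ge0 _ _ _ (@lebesgue_measure R)) => s _; rewrite lee_fin.
Qed.

Lemma cumul_mono (R : realType) (g : R -> R) : (forall s, 0 <= g s) ->
  (\int[@leb R]_s (g s)%:E < +oo)%E -> {homo cumul g : s t / s <= t}.
Proof.
move=> g0 gi s t st; rewrite -lee_fin -!cumul_fin//.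
by apply: le_integral_leb_subset => //; exact: subset_itvoo_r.
Qed.

Lemma cumul0 (R : realType) (g : R -> R) (t : R) : t <= 0 -> cumul g t = 0.
Proof.
move=> t0; rewrite /cumul [X in integral _ X](_ : _ = set0); first by rewrite integral_set0.
by apply/seteqP; split => s //=; rewrite in_itv /= => /andP[s0 /(lt_trans s0)]; rewrite ltNge t0.
Qed.

Lemma cumul_ge0 (R : realType) (g : R -> R) (t : R) : (forall s, 0 <= g s) -> 0 <= cumul g t.
Proof.
move=> g0; apply: fine_ge0.
by apply: (@integral_ge0 _ _ _ (@lebesgue_measure R)) => s _; rewrite lee_fin.
Qed.

Lemma integral_leb_oc (R : realType) (a b : R) (g : R -> R) : measurable_fun setT g ->
  (\int[@leb R]_(s in `]a, b]) (g s)%:E = \int[@leb R]_(s in `]a, b[) (g s)%:E)%E.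
Proof.
move=> mg; rewrite /leb -integral_itv_bndo_bndc//.
by apply/measurable_EFinP; exact: measurable_funTS.
Qed.

Lemma cumul_split (R : realType) (g : R -> R) (s t : R) : (forall s, 0 <= g s) ->
  measurable_fun setT g -> (\int[@leb R]_s (g s)%:E < +oo)%E -> 0 <= s -> s < t ->
  (\int[@leb R]_(r in `]s, t[) (g r)%:E = (cumul g t - cumul g s)%:E)%E.
Proof.
move=> g0 mg gi s0 st.
have H : (\int[@leb R]_(r in `]0%R, t[) (g r)%:E = \int[@leb R]_(r in `]0%R, s[) (g r)%:E + \int[@leb R]_(r in `]s, t[) (g r)%:E)%E.
  rewrite (itvoo_split s0 st) lower_integralU//; first by rewrite integral_leb_oc.
  - apply/disj_setPS => r [] /=; rewrite !in_itv /= => /andP[_ rs] /andP[sr _].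
    by move: (lt_le_trans sr rs); rewrite ltxx.
  - by apply: (@ae_borel_sub _ _ setT) => //; exact: ae_borel_measurable.
move: H; rewrite !cumul_fin// EFinB => ->.
by rewrite addeAC subee// add0e.
Qed.

Lemma cumul_continuous (R : realType) (g : R -> R) (T : R) : (forall s, 0 <= g s) ->
  measurable_fun setT g -> (\int[@leb R]_s (g s)%:E < +oo)%E -> 0 <= T ->
  {within `[0, T], continuous (cumul g)}.
Proof.
move=> g0 mg gi T0.
have -> : cumul g = (parameterized_integral (@lebesgue_measure R) 0)^~ g.
  apply/funext => t; rewrite /cumul /parameterized_integral /Rintegral; congr fine.
  rewrite (@integral_itv_bndoo _ 0 t _ true false)//.
  by apply/measurable_EFinP; exact: measurable_funTS.
apply: parameterized_integral_continuous => //; apply/integrableP; split.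
  by apply/measurable_EFinP; exact: measurable_funTS.
apply: le_lt_trans gi; rewrite (_ : integral _ _ _ = \int[@leb R]_(x in `[0%R, T]) (g x)%:E)%E; last first.
  by apply: eq_integral => x _ /=; rewrite ger0_norm.
exact: le_integral_leb_subset.
Qed.

(** Indeed (2 - z) e^z >= (2 - z)(1 + z) = 2 + z (1 - z) >= 2. A rectangle with the height of the
    right end is thus at most twice the increment of the exponential. *)
Lemma expR_increment (R : realType) (z : R) : 0 <= z <= 1 -> z * expR z <= 2 * (expR z - 1).
Proof. by move=> /andP[z0 z1]; have h2 := expR_ge1Dx z; nra. Qed.

(* A Gronwall weight: [2 / lambda] stands for the factor [1 / lambda] that the chain rule
   would give, so that only the continuity of [cumul g] is needed. *)
Lemma integral_expR_cumul (R : realType) (g : R -> R) (lam s : R) : (forall s, 0 <= g s) ->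
  measurable_fun setT g -> (\int[@leb R]_s (g s)%:E < +oo)%E -> 0 < lam -> 0 <= s ->
  (\int[@leb R]_(t in `]0%R, s[) (g t * expR (lam * cumul g t))%:E <=
   (2 / lam * (expR (lam * cumul g s) - 1))%:E)%E.
Proof.
move=> g0 mg gi lam0.
pose w t := g t * expR (lam * cumul g t).
have w0 t : 0 <= w t by rewrite mulr_ge0 ?expR_ge0.
have mw : measurable_fun setT w.
  apply: measurable_funM => //; apply: (measurableT_comp (@measurable_expR R)).
  apply: measurable_funM => //; apply: nondecreasing_measurable => //.
  exact: cumul_mono.
(* The interval is cut where [lam * cumul g] takes integer values, points that the intermediate
   value theorem provides. This quantity grows by at most 1 on each piece, so that [expR_increment]
   applies. *)
suff H n : forall s, 0 <= s -> cumul g s <= n%:R / lam ->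
    (\int[@leb R]_(t in `]0%R, s[) (w t)%:E <= (2 / lam * (expR (lam * cumul g s) - 1))%:E)%E.
  move=> s0; apply: (H (Num.truncn (cumul g s * lam)).+1) => //.
  by rewrite ler_pdivlMr// ltW// truncnS_gt.
elim: n => [|n IH] {}s s0 sn.
  have c0 : cumul g s = 0.
    by apply/le_anti; rewrite cumul_ge0// andbT; move: sn; rewrite mul0r.
  rewrite c0 mulr0 expR0 subrr mulr0.
  rewrite (_ : integral _ _ _ = \int[@leb R]_(t in `]0%R, s[) (g t)%:E)%E; first by rewrite cumul_fin// c0.
  apply: eq_integral => t /set_mem /=; rewrite in_itv /= => /andP[t0 ts].
  rewrite /w (_ : cumul g t = 0) ?mulr0 ?expR0 ?mulr1//.
  by apply/le_anti; rewrite cumul_ge0// andbT -c0; apply: cumul_mono => //; exact: ltW.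
have [|ns] := leP (cumul g s) (n%:R / lam); first exact: IH.
have [s' ss' cs'] : exists2 c, c \in `[0, s] & cumul g c = n%:R / lam.
  apply: IVT => //; first exact: cumul_continuous.
  rewrite cumul0// min_l ?cumul_ge0// max_r ?cumul_ge0//.
  by rewrite divr_ge0// ?ltW.
move: ss'; rewrite in_itv /= => /andP[s'0 s's].
have {}s's : s' < s by rewrite lt_neqAle s's andbT; apply/eqP => E; move: ns; rewrite -E cs' ltxx.
rewrite (itvoo_split s'0 s's) lower_integralU//; last 2 first.
- apply/disj_setPS => r [] /=; rewrite !in_itv /= => /andP[_ rs] /andP[sr _].
  by move: (lt_le_trans sr rs); rewrite ltxx.
- by apply: (@ae_borel_sub _ _ setT) => //; exact: ae_borel_measurable.
rewrite integral_leb_oc//.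
set z := cumul g s - cumul g s'.
have z0 : 0 <= z by rewrite subr_ge0 cs' ltW.
(* On the last piece the exponential is replaced by its value at the right end. *)
have h2 : (\int[@leb R]_(t in `]s', s[) (w t)%:E <= (expR (lam * cumul g s) * z)%:E)%E.
  rewrite EFinM -cumul_split// -lower_integralZ//; last first.
  - by apply: (@ae_borel_sub _ _ setT) => //; exact: ae_borel_measurable.
  apply: le_integral_leb => //; first by move=> t _; rewrite mulr_ge0 ?expR_ge0.
  apply: ae_leb_all => t /=; rewrite in_itv /= => /andP[_ ts].
  rewrite /w mulrC ler_wpM2r// ler_expR ler_pM2l//; apply: cumul_mono => //; exact: ltW.
apply: le_trans (leeD (IH s' s'0 _) h2) _; first by rewrite cs'.
rewrite -EFinD lee_fin.
have zl : 0 <= lam * z <= 1.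
  rewrite mulr_ge0 ?(ltW lam0)//= /z cs'.
  move: sn; rewrite ler_pdivlMr// => sn.
  rewrite mulrBr mulrCA mulfV ?gt_eqF// mulr1 lerBlDr mulrC.
  by apply: le_trans sn _; rewrite -natr1 addrC.
have := expR_increment zl.
have e1 : expR (lam * cumul g s) = expR (lam * cumul g s') * expR (lam * z).
  by rewrite -expRD -mulrDr /z addrC subrK.
rewrite e1; set a := expR (lam * cumul g s'); set b := expR (lam * z) => hz.
have a0 : 0 < a by exact: expR_gt0.
have -> : a * b * z = lam^-1 * a * (lam * z * b) by field; rewrite gt_eqF.
have -> : 2 / lam * (a * b - 1) = 2 / lam * (a - 1) + lam^-1 * a * (2 * (b - 1)) by field; rewrite gt_eqF.
by rewrite lerD2l ler_wpM2l//; apply: mulr_ge0; [rewrite invr_ge0 ltW|exact: ltW].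
Qed.

(** Young's bound with threshold a = al s^(-kappa/(p-1)): then a^(1-p) = al^(1-p) s^kappa reproduces
    the weight, and a is integrable at 0 precisely because kappa < p - 1. The parameter [al] is left
    free for optimisation. *)
Lemma integral_norm_wLp (R : realType) (X : normedModType R) (p kappa t al : R) (g : R -> X) :
  1 < p -> 0 <= kappa < p - 1 -> 0 < al -> 0 < t -> strongly_meas `]0, t[%classic g ->
  (\int[@leb R]_(s in `]0%R, t[) (`|g s|)%:E <=
   (al * (t `^ (1 - kappa / (p - 1)) / (1 - kappa / (p - 1))))%:E +
   (al `^ (1 - p))%:E * wLp_int p kappa 0 t g)%E.
Proof.
move=> p1 /andP[k0 kp] al0 t0 sg; have pm : 0 < p - 1 by lra.
set ga := kappa / (p - 1); have ga1 : 0 < 1 - ga by rewrite subr_gt0 ltr_pdivrMr// mul1r.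
have mD : measurable (`]0, t[%classic : set R) by exact: measurable_itv.
apply: (@le_trans _ _ (\int[@leb R]_(s in `]0%R, t[) (al * s `^ ((1 - ga) - 1))%:E +
   \int[@leb R]_(s in `]0%R, t[) (al `^ (1 - p) * (`|s| `^ kappa * `|g s| `^ p))%:E)%E); last first.
  apply: leeD.
    rewrite lower_integralZ//; last 3 first.
    - exact: ltW.
    - by move=> s _; exact: powR_ge0.
    - apply: ae_borel_measurable => //; first by move=> s _; exact: powR_ge0.
      by apply: measurable_funTS; exact: measurable_powR.
    rewrite EFinM lee_wpmul2l ?lee_fin ?(ltW al0)//; exact: integral_powR0_le.
  by rewrite (lower_integralZ mD (powR_ge0 _ _) (fun s _ => @wLp_integrand_ge0 _ _ p kappa g s) (@ae_borel_wLp _ _ p kappa _ _ sg)).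
rewrite -lower_integralD//; last 4 first.
- by move=> s _; rewrite mulr_ge0 ?powR_ge0 ?ltW.
- by move=> s _; rewrite mulr_ge0 ?powR_ge0 ?wLp_integrand_ge0.
- apply: ae_borelM; first by apply: ae_borel_cst; exact: ltW.
  apply: ae_borel_measurable => //; first by move=> s _; exact: powR_ge0.
  by apply: measurable_funTS; exact: measurable_powR.
- apply: ae_borelM; first by apply: ae_borel_cst; exact: powR_ge0.
  exact: ae_borel_wLp.
apply: le_integral_leb => //.
  by move=> s _; rewrite addr_ge0// mulr_ge0 ?powR_ge0 ?wLp_integrand_ge0// ltW.
apply: ae_leb_all => s /=; rewrite in_itv /= => /andP[s0 _].
have a0 : 0 < al * s `^ (1 - ga - 1) by rewrite mulr_gt0// powR_gt0.
apply: le_trans (le_young (ltW p1) a0 (normr_ge0 _)) _.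
rewrite lerD2l powRM ?powR_ge0 ?(ltW al0)// -powRrM gtr0_norm// mulrA.
by rewrite (_ : (1 - ga - 1) * (1 - p) = kappa)// /ga; field; rewrite gt_eqF.
Qed.

Lemma wLp_int_L1 (R : realType) (X : normedModType R) (a b : R) (f : R -> X) :
  wLp_int 1 0 a b f = (\int[@leb R]_(s in `]a, b[) (`|f s|)%:E)%E.
Proof. by apply: eq_integral => s _; rewrite powRr0 mul1r powRr1. Qed.

Lemma wLp_L1 (R : realType) (X : normedModType R) (p kappa T : R) (f : R -> X) :
  1 < p -> 0 <= kappa < p - 1 -> 0 < T -> wLp p kappa 0 T f -> wLp 1 0 0 T f.
Proof.
move=> p1 kp T0 [sf f0]; split; first exact: sf.
rewrite wLp_int_L1; apply: (le_lt_trans (integral_norm_wLp p1 kp ltr01 T0 sf)).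
by rewrite powR1 mul1e lte_add_pinfty// ltry.
Qed.

(** For almost every t the norm of c is at most the integral of |h| over (0, t), and such t exist
    arbitrarily close to 0. Applied to a difference, this shows that two derivatives of the same
    function carry the same initial value. *)
Lemma is_deriv_init (R : realType) (X : normedModType R) (T : R) (h : R -> X) (c : X) :
  0 < T -> is_deriv 1 0 0 T (fun=> 0) h c -> c = 0.
Proof.
move=> T0 [[sh h0] H]; have [k [mk k0 hk]] := sm_norm sh.
pose g := k \_ `]0, T[%classic.
have mT : measurable (`]0, T[%classic : set R) by exact: measurable_itv.
have mg : measurable_fun setT g.
  by apply/measurable_restrict => //; exact: measurable_funTS.
have g0 s : 0 <= g s by rewrite /g patchE; case: ifP.
have hg : (\int[@leb R]_(s in `]0%R, T[) (`|h s|)%:E = \int[@leb R]_s (g s)%:E)%E.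
  rewrite (@eq_integral_leb _ _ _ k)// integral_mkcond; apply: eq_integral => s _.
  by rewrite /g !patchE; case: ifP.
have gi : (\int[@leb R]_s (g s)%:E < +oo)%E by rewrite -hg -wLp_int_L1.
apply/eqP; rewrite -normr_le0; apply/ler_addgt0Pr => e e0; rewrite add0r.
have [_ /(_ _) cr _] := (continuous_within_itvP _ T0).1 (cumul_continuous g0 mg gi (ltW T0)).
move: cr; rewrite cumul0// => /cvgrPdist_lt /(_ e e0) [d /= d0 Hd].
have [t [/andP[t0 td] Ht]] := @ae_exists_itv _ 0 (Num.min d T) _ ltac:(by rewrite lt_min d0 T0) H.
move: td; rewrite lt_min => /andP[td tT].
have tI : `]0, T[%classic t by rewrite /= in_itv /= t0 tT.
have := Ht tI; rewrite sub0r => /bochner_norm_le.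
rewrite normrN => hc.
have mt : measurable (`]0, t[%classic : set R) by exact: measurable_itv.
have ft : (@leb R `]0%R, t[ < +oo)%E by rewrite /leb lebesgue_measure_itv /= lte_fin t0 -EFinB ltry.
have {}hc := hc mt ft.
have : ((`|c|)%:E <= (cumul g t)%:E)%E.
  apply: le_trans hc _; rewrite -cumul_fin//; apply: le_integral_leb => //.
  apply: ae_leS hk => s Hs st; have sT := @subset_itvoo_r _ 0 _ _ (ltW tT) _ st.
  by rewrite Hs// /g patchE mem_set.
rewrite lee_fin => hc2; apply: le_trans hc2 _.
have := Hd t; rewrite /= !sub0r !normrN gtr0_norm// => /(_ td t0) /ltW.
exact: le_trans (ler_norm _).
Qed.

(** A simple function below [f] splits along the measurable set [A], so [f] itself may be arbitrary.
    This allows the interpolation integral to be split without measurability of the K-functional. *)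
Lemma lower_integralU_le (d : measure_display) (T : measurableType d) (R : realType)
  (mu : {measure set T -> \bar R}) (A B : set T) (f : T -> \bar R) :
  measurable A -> (forall x, (A `|` B) x -> 0 <= f x)%E ->
  (\int[mu]_(x in A `|` B) f x <= \int[mu]_(x in A) f x + \int[mu]_(x in B) f x)%E.
Proof.
move=> mA f0; rewrite [leLHS]ge0_integralE//=; apply: ge_ereal_sup => _ [h hf <-].
have mh : measurable_fun setT (fun x => (h x)%:E) by apply/measurable_EFinP; exact: measurable_funP.
have h0 x : (0 <= (h x)%:E)%E by rewrite lee_fin.
rewrite -integralT_nnsfun -(setUv A) ge0_integral_setU//; last 3 first.
- exact: measurableC.
- by rewrite setUv.
- by apply/disj_setPCl.
apply: leeD.
  apply: ge0_le_lower_integral => // x Ax; have := hf x.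
  by rewrite patchE mem_set//; left.
rewrite integral_mkcond [leRHS]integral_mkcond; apply: ge0_le_lower_integral.
  by move=> x _; rewrite patchE; case: ifP.
move=> x _; rewrite !patchE; case: ifPn => [/set_mem nA|_]; last first.
  by case: ifPn => // /set_mem Bx; apply: f0; right.
have := hf x; rewrite patchE; case: ifPn => [/set_mem [//|Bx]|nAB].
  by rewrite mem_set.
by case: ifPn => // /set_mem Bx; move: nAB; rewrite notin_setE => -[]; right.
Qed.

(** With x = exp(ln x), identities between real powers become identities between exponents, which
    [ring] and [field] decide; the computations with exponents below rest on this. *)
Lemma powR_expR (R : realType) (x a : R) : expR x `^ a = expR (a * x).
Proof. by rewrite /powR gt_eqF ?expR_gt0// expRK. Qed.

(** * Real interpolation *)

Lemma Kfun_le (R : realType) (X0 X1 : normedModType R) (J : X1 -> X0) (t : R) (x0 : X0) (x1 : X1) :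
  0 <= t -> Kfun J t (x0 + J x1) <= `|x0| + t * `|x1|.
Proof.
move=> t0; apply: ge_inf; last by exists x0, x1.
by exists 0 => r [y0 [y1 [_ ->]]]; rewrite addr_ge0// mulr_ge0.
Qed.

Lemma Kfun_ge0 (R : realType) (X0 X1 : normedModType R) (J : {linear X1 -> X0}) (t : R) (x : X0) :
  0 <= t -> 0 <= Kfun J t x.
Proof.
move=> t0; apply: lb_le_inf.
  by exists (`|x| + t * `|0 : X1|), x, 0; rewrite linear0 addr0.
by move=> r [y0 [y1 [_ ->]]]; rewrite addr_ge0// mulr_ge0.
Qed.

(** The two hypotheses bound x in X_1 (by m) and in the interpolation space with parameters 1 - 1/p
    and infinity (by L). The first is used below [lam], where s^(1/q - 1) is integrable at 0, the
    second above, where p < q makes s^(1/q - 1/p - 1) integrable at infinity. A free [lam] gives an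
    additive interpolation inequality. *)
Lemma interp_int_le (R : realType) (X0 X1 : normedModType R) (J : {linear X1 -> X0}) (p q L m lam : R) (x : X0) :
  1 < p -> p < q -> 0 < lam ->
  (forall s, 0 < s -> Kfun J s x <= s * m) -> (forall s, 0 < s -> Kfun J s x <= L * s `^ (1 - p^-1)) ->
  (interp_int J (1 - q^-1) x <= (m * (lam `^ q^-1 * q) + L * (lam `^ (q^-1 - p^-1) / (p^-1 - q^-1)))%:E)%E.
Proof.
move=> p1 pq lam0 Km KL.
have m0 : 0 <= m by have := le_trans (Kfun_ge0 J x ler01) (Km 1 ltr01); rewrite mul1r.
have L0 : 0 <= L by have := le_trans (Kfun_ge0 J x ler01) (KL 1 ltr01); rewrite powR1 mulr1.
have p0 : 0 < p by lra.
have q0 : 0 < q by lra.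
have pq' : 0 < p^-1 - q^-1 by rewrite subr_gt0 ltf_pV2.
have F0 s : 0 < s -> 0 <= s `^ (- (1 - q^-1)) * Kfun J s x / s.
  by move=> s0; rewrite divr_ge0 ?mulr_ge0 ?powR_ge0 ?Kfun_ge0// ltW.
rewrite /interp_int [X in integral _ X _](_ : _ = `]0, lam[%classic `|` `[lam, +oo[%classic); last first.
  apply/seteqP; split => s /=; rewrite !in_itv /= !andbT.
    by move=> s0; have [ls|sl] := leP lam s; [right|left; rewrite s0].
  by case=> [/andP[]//|]; exact: lt_le_trans.
apply: le_trans (@lower_integralU_le _ _ _ (@lebesgue_measure R) _ _ _ _ _) _.
- exact: measurable_itv.
- by move=> s [] /=; rewrite in_itv /= ?andbT => h; rewrite lee_fin; apply: F0; [case/andP: h|exact: lt_le_trans h].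
rewrite EFinD; apply: leeD.
  apply: (@le_trans _ _ (\int[@leb R]_(s in `]0%R, lam[) (m * s `^ (q^-1 - 1))%:E)%E).
    apply: le_integral_leb.
    - by move=> s /=; rewrite in_itv /= => /andP[s0 _]; exact: F0.
    - by move=> s _; rewrite mulr_ge0 ?powR_ge0.
    - apply: ae_leb_all => s /=; rewrite in_itv /= => /andP[s0 _].
      rewrite opprB ler_pdivrMr//.
      apply: (@le_trans _ _ (s `^ (q^-1 - 1) * (s * m))); first by rewrite ler_wpM2l ?powR_ge0// Km.
      by rewrite le_eqVlt; apply/orP; left; apply/eqP; ring.
  rewrite lower_integralZ//; last 2 first.
  - by move=> s _; exact: powR_ge0.
  - apply: ae_borel_measurable; first exact: measurable_itv.
      by move=> s _; exact: powR_ge0.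
    by apply: measurable_funTS; exact: measurable_powR.
  rewrite EFinM lee_wpmul2l ?lee_fin//.
  have := @integral_powR0_le R q^-1 lam; rewrite invrK invr_gt0 => /(_ q0 lam0); exact.
apply: (@le_trans _ _ (\int[@leb R]_(s in `[lam, +oo[) (L * s `^ (- (p^-1 - q^-1) - 1))%:E)%E).
  apply: le_integral_leb.
  - by move=> s /=; rewrite in_itv /= andbT => s0; apply: F0; exact: lt_le_trans s0.
  - by move=> s _; rewrite mulr_ge0 ?powR_ge0.
  - apply: ae_leb_all => s /=; rewrite in_itv /= andbT => ls.
    have s0 : 0 < s by exact: lt_le_trans ls.
    apply: (@le_trans _ _ (s `^ (- (1 - q^-1)) * (L * s `^ (1 - p^-1)) / s)).
      by rewrite ler_pM2r ?invr_gt0// ler_wpM2l ?powR_ge0// KL.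
    rewrite mulrCA -mulrA ler_wpM2l//.
    have -> : s = expR (ln s) by rewrite lnK// posrE.
    rewrite !powR_expR -expRN -!expRD le_eqVlt; apply/orP; left; apply/eqP; congr expR.
    by move: (p^-1) (q^-1) => a b; ring.
rewrite lower_integralZ//; last 2 first.
- by move=> s _; exact: powR_ge0.
- apply: ae_borel_measurable; first exact: measurable_itv.
    by move=> s _; exact: powR_ge0.
  by apply: measurable_funTS; exact: measurable_powR.
rewrite EFinM lee_wpmul2l ?lee_fin//.
by have := integral_powRy_le pq' lam0; rewrite opprB.
Qed.

(** * Trace estimate for the K-functional *)

Lemma leb_itvoo (R : realType) (a b : R) : a < b -> @leb R `]a, b[%classic = (b - a)%:E.
Proof. by move=> ab; rewrite /leb lebesgue_measure_itv /= lte_fin ab EFinB. Qed.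

(** If the integrand exceeded 2P/h almost everywhere on a window of length h, its integral would be
    at least 2P > P. An almost everywhere property [S] can be imposed on the chosen point as
    well. *)
Lemma weighted_mean_point (R : realType) (X : normedModType R) (p kappa t h P : R) (u : R -> X)
    (S : R -> Prop) : 0 < h -> h <= t -> 0 < P -> (wLp_int p kappa 0 t u <= P%:E)%E ->
  {ae @leb R, forall r, `]0, t[%classic r -> S r} ->
  exists r, [/\ t - h < r < t, S r & `|r| `^ kappa * `|u r| `^ p <= 2 * P / h].
Proof.
move=> h0 ht P0 uP aeS; apply: contrapT => H.
have th : t - h < t by lra.
have sub : (`]t - h, t[%classic : set R) `<=` `]0, t[%classic.
  by move=> r /=; rewrite !in_itv /= => /andP[a b]; rewrite b andbT; lra.
have : ((2 * P / h)%:E * @leb R `](t - h)%R, t[%classic <= P%:E)%E.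
  rewrite -integral_leb_cst; last exact: measurable_itv.
  apply: le_trans uP; apply: (@le_trans _ _ (\int[@leb R]_(r in `](t - h)%R, t[) (`|r| `^ kappa * `|u r| `^ p)%:E)%E).
    apply: le_integral_leb.
    - by move=> r _; rewrite divr_ge0 ?mulr_ge0// ltW.
    - by move=> r _; exact: wLp_integrand_ge0.
    - apply: ae_leS aeS => r Sr rt; rewrite leNgt; apply/negP => lt; apply: H; exists r; split.
      + by move: rt; rewrite /= in_itv.
      + by apply: Sr; exact: sub.
      + exact: ltW.
  by apply: le_integral_leb_subset => // r _; exact: wLp_integrand_ge0.
rewrite leb_itvoo// -EFinM lee_fin (_ : 2 * P / h * (t - (t - h)) = 2 * P); first lra.
by field; rewrite gt_eqF.
Qed.

(** Young's bound with a constant threshold suffices here, since the window stays in (t/2, t), where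
    the weight is at least (t/2)^kappa. *)
Lemma integral_norm_window (R : realType) (X : normedModType R) (p kappa t h a P : R) (g : R -> X) :
  1 < p -> 0 <= kappa -> 0 < a -> 0 < h -> h <= t / 2 -> strongly_meas `]0, t[%classic g ->
  (wLp_int p kappa 0 t g <= P%:E)%E ->
  (\int[@leb R]_(s in `](t - h)%R, t[) (`|g s|)%:E <=
   (a * h + a `^ (1 - p) * (t / 2) `^ (- kappa) * P)%:E)%E.
Proof.
move=> p1 k0 a0 h0 ht sg gP.
have th : t - h < t by lra.
have sub : (`]t - h, t[%classic : set R) `<=` `]0, t[%classic.
  by move=> r /=; rewrite !in_itv /= => /andP[? b]; rewrite b andbT; lra.
have sg' := sm_sub sub sg.
have mI : measurable (`]t - h, t[%classic : set R) by exact: measurable_itv.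
set c := a `^ (1 - p) * (t / 2) `^ (- kappa).
have c0 : 0 <= c by rewrite mulr_ge0 ?powR_ge0.
apply: (@le_trans _ _ (\int[@leb R]_(s in `](t - h)%R, t[) (a + c * (`|s| `^ kappa * `|g s| `^ p))%:E)%E).
  apply: le_integral_leb => //.
    by move=> s _; rewrite addr_ge0 ?(ltW a0)// mulr_ge0// wLp_integrand_ge0.
  apply: ae_leb_all => s /=; rewrite in_itv /= => /andP[s1 s2].
  apply: le_trans (le_young (ltW p1) a0 (normr_ge0 _)) _.
  rewrite lerD2l /c -mulrA ler_wpM2l ?powR_ge0// mulrA -{1}(mul1r (_ `^ p)) ler_wpM2r ?powR_ge0//.
  have t2 : 0 < t / 2 by lra.
  rewrite powRN mulrC ler_pdivlMr ?powR_gt0// mul1r gtr0_norm; last by lra.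
  by apply: ge0_ler_powR => //; rewrite ?nnegrE; lra.
rewrite lower_integralD//; last 4 first.
- by move=> s _; exact: ltW.
- by move=> s _; rewrite mulr_ge0// wLp_integrand_ge0.
- by apply: ae_borel_cst; exact: ltW.
- by apply: ae_borelM; [exact: ae_borel_cst|exact: ae_borel_wLp].
rewrite integral_leb_cst// leb_itvoo// [leRHS]EFinD; apply: leeD.
  by rewrite -EFinM lee_fin subKr.
rewrite (lower_integralZ mI c0 (fun s _ => @wLp_integrand_ge0 _ _ p kappa g s) (@ae_borel_wLp _ _ p kappa _ _ sg')).
rewrite [leRHS]EFinM lee_wpmul2l ?lee_fin//; apply: le_trans gP.
by apply: le_integral_leb_subset => // r _; exact: wLp_integrand_ge0.
Qed.

(** The threshold a = (Q/h)^(1/p) makes both terms of the window estimate multiples of h^(1-1/p)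
    Q^(1/p), the form required of a K-functional bound; [young_powR] is the analogue on the whole
    interval (0, t). *)
Lemma window_powR (R : realType) (p kappa t h Q : R) : 1 < p -> 0 < t -> 0 < h -> 0 < Q ->
  let a := (Q / h) `^ p^-1 in
  a * h + a `^ (1 - p) * (t / 2) `^ (- kappa) * (t `^ kappa * Q) =
  (1 + 2 `^ kappa) * (h `^ (1 - p^-1) * Q `^ p^-1).
Proof.
move=> p1 t0 h0 Q0 /=; have p0 : p != 0 by rewrite gt_eqF//; lra.
set a := _ `^ p^-1; set Z := h `^ _ * _.
have e1 : a * h = Z.
  rewrite /a /Z; have -> : h = expR (ln h) by rewrite lnK// posrE.
  have -> : Q = expR (ln Q) by rewrite lnK// posrE.
  move: (ln h) (ln Q) => lh lQ.
  by rewrite -!expRN !powR_expR -!expRD !powR_expR -!expRD; congr expR; field.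
have e2 : a `^ (1 - p) * (t / 2) `^ (- kappa) * (t `^ kappa * Q) = 2 `^ kappa * Z.
  rewrite /a /Z; have -> : 2 = expR (ln 2) :> R by rewrite lnK// posrE.
  have -> : h = expR (ln h) by rewrite lnK// posrE.
  have -> : t = expR (ln t) by rewrite lnK// posrE.
  have -> : Q = expR (ln Q) by rewrite lnK// posrE.
  move: (ln 2) (ln t) (ln h) (ln Q) => l2 lt lh lQ.
  by rewrite -!expRN !powR_expR -!expRD !powR_expR -!expRD; congr expR; field.
by rewrite e1 e2 mulrDl mul1r.
Qed.

Lemma young_powR (R : realType) (p kappa t Q : R) : 1 < p -> 0 < t -> 0 < Q ->
  let ga := kappa / (p - 1) in let al := t `^ (ga - p^-1) * Q `^ p^-1 in
  al * (t `^ (1 - ga) / (1 - ga)) + al `^ (1 - p) * (t `^ kappa * Q) =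
  (1 + (1 - ga)^-1) * (t `^ (1 - p^-1) * Q `^ p^-1).
Proof.
move=> p1 t0 Q0 /=; have p0 : p != 0 by rewrite gt_eqF//; lra.
have pm : p - 1 != 0 by rewrite gt_eqF//; lra.
set ga := kappa / _; set al := _ * Q `^ _; set Z := t `^ (1 - p^-1) * _.
have e1 : al * t `^ (1 - ga) = Z.
  rewrite /al /Z; have -> : t = expR (ln t) by rewrite lnK// posrE.
  have -> : Q = expR (ln Q) by rewrite lnK// posrE.
  move: (ln t) (ln Q) (ga) (p^-1) => lt lQ ga' pp.
  by rewrite !powR_expR -!expRD; congr expR; ring.
have e2 : al `^ (1 - p) * (t `^ kappa * Q) = Z.
  rewrite /al /Z; have -> : t = expR (ln t) by rewrite lnK// posrE.
  have -> : Q = expR (ln Q) by rewrite lnK// posrE.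
  move: (ln t) (ln Q) => lt lQ.
  rewrite !powR_expR -!expRD !powR_expR -!expRD; congr expR.
  by rewrite /ga; field; rewrite p0 pm.
by rewrite mulrA e1 e2 mulrDl mul1r addrC mulrC.
Qed.

(** The summands belong to the three estimates of the trace bound: h |u(r)| and |u(t) - u(r)| when h
    <= t/2, and |u(t)| alone when h > t/2. *)
Definition Kconst (R : realType) (p kappa : R) : R :=
  (2 `^ (1 + kappa)) `^ p^-1 + (1 + 2 `^ kappa) + 2 * (1 + (1 - kappa / (p - 1))^-1).

(* The splitting [u t = (u t - u r) + u r] with a well chosen [r] in [(t - h, t)] replaces
   the usual averaging over that window. *)
Lemma Kfun_trace_le (R : realType) (X0 X1 : normedModType R) (J : {linear X1 -> X0})
    (p kappa T : R) (u : R -> X1) (g : R -> X0) :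
  1 < p -> 0 <= kappa < p - 1 -> is_deriv p kappa 0 T (J \o u) g 0 ->
  {ae @leb R, forall t, `]0, T[%classic t -> forall P, 0 < P ->
    (wLp_int p kappa 0 t u <= P%:E)%E -> (wLp_int p kappa 0 t g <= P%:E)%E ->
    forall h, 0 < h ->
    Kfun J h (J (u t)) <= Kconst p kappa * (h `^ (1 - p^-1) * (t `^ (- kappa) * P) `^ p^-1)}.
Proof.
move=> p1 kp [[sg _] H]; have [k0 kp1] := andP kp.
have p0 : 0 < p by lra.
have pi1 : p^-1 <= 1 by rewrite invf_le1//; lra.
have ga1 : 0 < 1 - kappa / (p - 1) by rewrite subr_gt0 ltr_pdivrMr; lra.
(* The exceptional null set is that of the integral representation of [J (u t)]. It depends on
   neither [P] nor [h], so [P] may later vary with t. *)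
apply: ae_leS (H) => t Ht tT P P0 uP gP h h0.
move: (tT); rewrite /= in_itv /= => /andP[t0 tT'].
have {Ht} := Ht tT; rewrite /= subr0 => Bt.
set Q := t `^ (- kappa) * P.
have Q0 : 0 < Q by rewrite mulr_gt0 ?powR_gt0.
have PQ : P = t `^ kappa * Q by rewrite /Q powRN mulrA mulfV ?mul1r// gt_eqF// powR_gt0.
have sgt : strongly_meas `]0, t[%classic g by apply: sm_sub sg; apply: subset_itvoo_r; exact: ltW.
set Z := h `^ (1 - p^-1) * Q `^ p^-1.
have Z0 : 0 <= Z by rewrite mulr_ge0 ?powR_ge0.
have i2 : 0 < 2 `^ (1 + kappa) :> R by rewrite powR_gt0.
(* Only for h <= t/2 does a window of length h before t keep away from 0, where the weight may
   degenerate. *)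
have [ht|ht] := leP h (t / 2).
- have Sr : {ae @leb R, forall r, `]0, t[%classic r -> is_bochner `]0, r[%classic g (J (u r))}.
    apply: ae_leS H => r Hr rt; have := Hr (@subset_itvoo_r _ 0 _ _ (ltW tT') _ rt).
    by rewrite /= subr0.
  have ht' : h <= t by lra.
  have [r [/andP[r1 r2] Br ur]] := weighted_mean_point h0 ht' P0 uP Sr.
  have r0 : 0 < r by lra.
  have d1 : `|J (u t) - J (u r)| <= (1 + 2 `^ kappa) * Z.
    have a0 : 0 < (Q / h) `^ p^-1 by rewrite powR_gt0 ?divr_gt0.
    have W := integral_norm_window p1 k0 a0 h0 ht sgt gP.
    rewrite -lee_fin /Z -(@window_powR _ p kappa t h Q p1 t0 h0 Q0) -PQ.
    apply: le_trans W.
    apply: (@le_trans _ _ (\int[@leb R]_(s in `[r, t[) (`|g s|)%:E)%E); last first.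
      apply: le_integral_leb_subset => // s /=; rewrite !in_itv /= => /andP[a b].
      by rewrite b andbT; lra.
    apply: (@bochner_diff_le _ _ `]0, r[%classic) => //.
    - by rewrite leb_itvoo// ltry.
    - by rewrite /leb lebesgue_measure_itv /= lte_fin r2 -EFinB ltry.
    - apply/seteqP; split => s //= -[]; rewrite !in_itv /= => /andP[_ a] /andP[b _].
      by move: (lt_le_trans a b); rewrite ltxx.
    - rewrite (_ : _ `|` _ = `]0, t[%classic)//.
      apply/seteqP; split => s /=; rewrite !in_itv /=.
        by move=> [/andP[a b]|/andP[a b]]; apply/andP; split => //; lra.
      by move=> /andP[a b]; have [sr|rs] := ltP s r; [left; rewrite a|right].
  have d2 : h * `|u r| <= (2 `^ (1 + kappa)) `^ p^-1 * Z.
    have ur2 : `|u r| `^ p <= 2 `^ (1 + kappa) * (Q / h).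
      have tr : (t / 2) `^ kappa <= r `^ kappa.
        by apply: ge0_ler_powR => //; rewrite ?nnegrE; lra.
      have t2 : 0 < (t / 2) `^ kappa by rewrite powR_gt0//; lra.
      rewrite -(ler_pM2l t2); apply: (@le_trans _ _ (2 * P / h)).
        apply: le_trans ur; rewrite gtr0_norm// ler_wpM2r ?powR_ge0//.
      rewrite PQ powRM ?invr_ge0 ?(ltW t0)// powRD ?pnatr_eq0 ?implybT// powRr1//.
      rewrite -powR_inv1// -powRrM mulN1r powRN.
      rewrite le_eqVlt; apply/orP; left; apply/eqP; field.
      by rewrite gt_eqF// gt_eqF// powR_gt0.
    have -> : h * `|u r| = h * (`|u r| `^ p) `^ p^-1 by rewrite -powRrM mulfV ?gt_eqF// powRr1.
    have -> : (2 `^ (1 + kappa)) `^ p^-1 * Z = h * (2 `^ (1 + kappa) * (Q / h)) `^ p^-1.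
      rewrite /Z; have -> : h = expR (ln h) by rewrite lnK// posrE.
      have -> : Q = expR (ln Q) by rewrite lnK// posrE.
      have -> : 2 = expR (ln 2) :> R by rewrite lnK// posrE.
      rewrite -!expRN !powR_expR -!expRD !powR_expR -!expRD; congr expR.
      by move: (p^-1) => pp; ring.
    rewrite ler_pM2l//; apply: ge0_ler_powR; rewrite ?nnegrE ?invr_ge0 ?powR_ge0//.
    + exact: ltW.
    + by rewrite mulr_ge0 ?divr_ge0 ?ltW.
  have := Kfun_le J (J (u t) - J (u r)) (u r) (ltW h0); rewrite subrK => /le_trans; apply.
  apply: (@le_trans _ _ ((1 + 2 `^ kappa) * Z + (2 `^ (1 + kappa)) `^ p^-1 * Z)); first exact: lerD.
  rewrite -mulrDl ler_wpM2r// /Kconst [X in X <= _]addrC lerDl mulr_ge0//.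
  by rewrite addr_ge0// invr_ge0 ltW.
(* For h > t/2 the whole of [J (u t)] is put into [X0]. The zero initial value bounds it by the
   integral of |g| over (0, t), and t < 2h turns t^(1-1/p) into at most 2 h^(1-1/p). *)
- have := Kfun_le J (J (u t)) 0 (ltW h0); rewrite linear0 addr0 normr0 mulr0 addr0 => /le_trans; apply.
  apply: (@le_trans _ _ ((1 + (1 - kappa / (p - 1))^-1) * (t `^ (1 - p^-1) * Q `^ p^-1))).
    rewrite -(@young_powR _ p kappa t Q p1 t0 Q0) -PQ.
    set al := _ * Q `^ _; have al0 : 0 < al by rewrite mulr_gt0 ?powR_gt0.
    rewrite -lee_fin; apply: le_trans (bochner_norm_le _ _ Bt) _; first exact: measurable_itv.
      by rewrite leb_itvoo// ltry.
    apply: le_trans (integral_norm_wLp p1 kp al0 t0 sgt) _.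
    by rewrite EFinD leeD2l// EFinM lee_wpmul2l// lee_fin powR_ge0.
  have c0 : 0 <= 1 + (1 - kappa / (p - 1))^-1 by rewrite addr_ge0// invr_ge0 ltW.
  apply: (@le_trans _ _ (2 * (1 + (1 - kappa / (p - 1))^-1) * Z)).
    rewrite (mulrC 2) -mulrA ler_wpM2l// /Z mulrA ler_wpM2r ?powR_ge0//.
    apply: (@le_trans _ _ ((2 * h) `^ (1 - p^-1))).
      by apply: ge0_ler_powR; rewrite ?nnegrE; lra.
    rewrite powRM ?(ltW h0)// ler_wpM2r ?powR_ge0//.
    rewrite -[leRHS](powRr1 (ler0n R 2)); apply: ler_powR; first by rewrite ler1n.
    by rewrite gerBl invr_ge0 ltW.
  by rewrite ler_wpM2r// /Kconst lerDr !addr_ge0 ?powR_ge0.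
Qed.

Lemma linear_norm_le (R : realType) (X Y : normedModType R) (J : {linear X -> Y}) :
  continuous J -> exists2 c, 0 < c & forall x, `|J x| <= c * `|x|.
Proof.
move=> cJ; have /linear_boundedP := (linear_bounded_continuous J).2 cJ.
move=> [M [_ HM]]; exists (`|M| + 1); first by rewrite ltr_pwDr.
by apply: HM; rewrite (le_lt_trans (ler_norm _))// ltrDl.
Qed.

(** [interp_int_le] with [lam] = 1 and an auxiliary exponent, the midpoint of 1 and q. It makes
    [B t (J x)] meaningful and bounded for each x in [X1]. *)
Lemma interp_embedding (R : realType) (X0 X1 : normedModType R) (J : {linear X1 -> X0}) (q : R) :
  continuous J -> 1 < q ->
  exists2 c, 0 < c & forall x, in_interp J (1 - q^-1) (J x) /\ interp_norm J (1 - q^-1) (J x) <= c * `|x|.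
Proof.
move=> cJ q1; have [c0 c00 Jc] := linear_norm_le cJ.
pose p := (1 + q) / 2.
have p1 : 1 < p by rewrite /p; lra.
have pq : p < q by rewrite /p; lra.
have p0 : 0 < p by lra.
have q0 : 0 < q by lra.
have pi : 0 < 1 - p^-1 by rewrite subr_gt0 invf_lt1.
have pq' : 0 < p^-1 - q^-1 by rewrite subr_gt0 ltf_pV2.
exists (q + (1 + c0) / (p^-1 - q^-1)).
  by rewrite addr_gt0// divr_gt0// addr_gt0.
move=> x.
have K1 s : 0 < s -> Kfun J s (J x) <= s * `|x|.
  by move=> s0; have := Kfun_le J 0 x (ltW s0); rewrite add0r normr0 add0r.
have K2 s : 0 < s -> Kfun J s (J x) <= ((1 + c0) * `|x|) * s `^ (1 - p^-1).
  move=> s0; have [s1|s1] := leP s 1.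
    apply: le_trans (K1 s s0) _; rewrite mulrC (mulrC (1 + c0)) -mulrA ler_wpM2l//.
    apply: (@le_trans _ _ (s `^ (1 - p^-1))); last by rewrite ler_peMl ?powR_ge0// lerDl ltW.
    by apply: ger1_powR; rewrite ?s0// gerBl invr_ge0 ltW.
  have := Kfun_le J (J x) 0 (ltW s0); rewrite linear0 addr0 normr0 mulr0 addr0 => /le_trans; apply.
  apply: le_trans (Jc x) _; rewrite -[leLHS]mulr1; apply: ler_pM => //.
  - by rewrite mulr_ge0// ltW.
  - by rewrite ler_wpM2r// lerDr.
  - rewrite -[leLHS](powRr0 s); apply: ler_powR; exact: ltW.
have := interp_int_le p1 pq ltr01 K1 K2; rewrite !powR1 !mul1r => H.
have fin : (interp_int J (1 - q^-1) (J x) < +oo)%E by apply: le_lt_trans H (ltry _).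
split; first exact: fin.
have ge0 : (0 <= interp_int J (1 - q^-1) (J x))%E.
  apply: (@integral_ge0 _ _ _ (@lebesgue_measure R)) => s /=; rewrite in_itv /= andbT => s0.
  by rewrite lee_fin divr_ge0 ?mulr_ge0 ?powR_ge0 ?Kfun_ge0// ltW.
rewrite -lee_fin /interp_norm fineK; last by rewrite ge0_fin_numE.
by apply: le_trans H _; rewrite lee_fin [leRHS]mulrDl (mulrC q) lerD2l mulrAC.
Qed.

(** * Pointwise estimate of the perturbation *)

Lemma powRD_le (R : realType) (p x y : R) : 0 <= p -> 0 <= x -> 0 <= y ->
  (x + y) `^ p <= 2 `^ p * (x `^ p + y `^ p).
Proof.
move=> p0 x0 y0; have := @powR_normD_le R R^o p x y p0.
by rewrite !ger0_norm// addr_ge0.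
Qed.

(** The constant C_delta of the pointwise estimate. Its power delta^(p-q) has a negative exponent,
    the price of a small coefficient in front of |x|^p. *)
Definition Bconst (R : realType) (p q kappa delta : R) : R :=
  2 `^ p * ((Kconst p kappa / (p^-1 - q^-1)) `^ p * delta `^ (p - q)).

Lemma Kconst_ge0 (R : realType) (p kappa : R) : 1 < p -> 0 <= kappa < p - 1 -> 0 <= Kconst p kappa.
Proof.
move=> p1 /andP[k0 kp]; have ga1 : 0 < 1 - kappa / (p - 1) by rewrite subr_gt0 ltr_pdivrMr; lra.
by rewrite /Kconst !addr_ge0 ?powR_ge0// mulr_ge0// addr_ge0// invr_ge0 ltW.
Qed.

Lemma Bconst_ge0 (R : realType) (p q kappa delta : R) : 0 <= Bconst p q kappa delta.
Proof. by rewrite /Bconst !mulr_ge0 ?powR_ge0. Qed.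

(* [lambda = (delta / b)^q] in the interpolation inequality: the weight [b ^ q] comes out
   with exponent one, which is the Gronwall form of the perturbation estimate. *)
Lemma perturb_pointwise (R : realType) (X0 X1 : normedModType R) (J : {linear X1 -> X0})
    (p q kappa delta t b P : R) (x : X1) (y : X0) :
  1 < p -> p < q -> 0 <= kappa < p - 1 -> 0 < delta -> 0 < t -> 0 < P ->
  (forall h, 0 < h ->
    Kfun J h (J x) <= Kconst p kappa * (h `^ (1 - p^-1) * (t `^ (- kappa) * P) `^ p^-1)) ->
  `|y| <= b * interp_norm J (1 - q^-1) (J x) ->
  t `^ kappa * `|y| `^ p <=
    (2 * (q * delta)) `^ p * (t `^ kappa * `|x| `^ p) + Bconst p q kappa delta * (`|b| `^ q * P).
Proof.
move=> p1 pq kp d0 t0 P0 HK yb.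
have p0 : 0 < p by lra.
have q0 : 0 < q by lra.
have Kc0 := Kconst_ge0 p1 kp.
have pq' : 0 < p^-1 - q^-1 by rewrite subr_gt0 ltf_pV2.
have ge0 : (0 <= interp_int J (1 - q^-1) (J x))%E.
  apply: (@integral_ge0 _ _ _ (@lebesgue_measure R)) => s /=; rewrite in_itv /= andbT => s0.
  by rewrite lee_fin divr_ge0 ?mulr_ge0 ?powR_ge0 ?Kfun_ge0// ltW.
(* For [b <= 0] the hypothesis forces y = 0; the splitting point (delta / b)^q is formed only for
   positive b. *)
have [b0|b0] := leP b 0.
  have -> : `|y| = 0.
    apply/le_anti; rewrite normr_ge0 andbT; apply: le_trans yb _.
    by rewrite mulr_le0_ge0// fine_ge0.
  rewrite powR0 ?gt_eqF// mulr0 addr_ge0// mulr_ge0 ?powR_ge0 ?Bconst_ge0// mulr_ge0 ?powR_ge0//.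
  exact: ltW.
set Q := t `^ (- kappa) * P.
have Q0 : 0 < Q by rewrite mulr_gt0 ?powR_gt0.
set lam := (delta / b) `^ q.
have lam0 : 0 < lam by rewrite powR_gt0// divr_gt0.
have K1 s : 0 < s -> Kfun J s (J x) <= s * `|x|.
  by move=> s0; have := Kfun_le J 0 x (ltW s0); rewrite add0r normr0 add0r.
have K2 s : 0 < s -> Kfun J s (J x) <= (Kconst p kappa * Q `^ p^-1) * s `^ (1 - p^-1).
  by move=> s0; apply: le_trans (HK s s0) _; rewrite -/Q mulrA mulrAC.
have H := interp_int_le p1 pq lam0 K1 K2.
have H' : interp_norm J (1 - q^-1) (J x) <= `|x| * (lam `^ q^-1 * q) +
    Kconst p kappa * Q `^ p^-1 * (lam `^ (q^-1 - p^-1) / (p^-1 - q^-1)).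
  rewrite -lee_fin /interp_norm fineK// ge0_fin_numE//.
  by apply: le_lt_trans H (ltry _).
set k := Kconst p kappa / (p^-1 - q^-1).
have k0 : 0 <= k by rewrite divr_ge0// ltW.
have Hy : `|y| <= q * delta * `|x| + k * (b `^ (q / p) * delta `^ (1 - q / p) * Q `^ p^-1).
  apply: le_trans yb _; apply: (@le_trans _ _ (b * (`|x| * (lam `^ q^-1 * q) +
    Kconst p kappa * Q `^ p^-1 * (lam `^ (q^-1 - p^-1) / (p^-1 - q^-1))))); first by rewrite ler_pM2l.
  have e1 : b * lam `^ q^-1 = delta.
    by rewrite /lam -powRrM mulfV ?gt_eqF// powRr1 ?divr_ge0 ?ltW// mulrC divfK// gt_eqF.
  have e2 : b * lam `^ (q^-1 - p^-1) = b `^ (q / p) * delta `^ (1 - q / p).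
    rewrite /lam; have -> : b = expR (ln b) by rewrite lnK// posrE.
    have -> : delta = expR (ln delta) by rewrite lnK// posrE.
    rewrite -!expRN -!expRD !powR_expR -!expRD; congr expR.
    by field; rewrite !gt_eqF.
  rewrite le_eqVlt; apply/orP; left; apply/eqP.
  transitivity (b * lam `^ q^-1 * q * `|x| + k * (b * lam `^ (q^-1 - p^-1)) * Q `^ p^-1).
    by rewrite /k; move: (p^-1 - q^-1)^-1 => z; ring.
  by rewrite e1 e2; ring.
have z0 : 0 <= b `^ (q / p) * delta `^ (1 - q / p) * Q `^ p^-1 by rewrite !mulr_ge0 ?powR_ge0.
have tk0 : 0 < t `^ kappa by rewrite powR_gt0.
apply: (@le_trans _ _ (t `^ kappa * (2 `^ p * ((q * delta * `|x|) `^ p +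
    (k * (b `^ (q / p) * delta `^ (1 - q / p) * Q `^ p^-1)) `^ p)))).
  rewrite ler_pM2l//.
  apply: le_trans (powRD_le (ltW p0) _ _); last 2 first.
  - by rewrite !mulr_ge0// ltW.
  - by rewrite mulr_ge0.
  apply: ge0_ler_powR => //; rewrite ?nnegrE ?(ltW p0)//.
  by apply: addr_ge0; [apply: mulr_ge0 => //; apply: mulr_ge0; exact: ltW|exact: mulr_ge0].
have qd : 0 <= q * delta by apply: mulr_ge0; exact: ltW.
rewrite le_eqVlt; apply/orP; left; apply/eqP.
rewrite (powRM _ qd (normr_ge0 _)) (powRM _ k0 z0) (powRM _ (ler0n R 2) qd) /Bconst -/k (gtr0_norm b0).
have -> : (b `^ (q / p) * delta `^ (1 - q / p) * Q `^ p^-1) `^ p = b `^ q * delta `^ (p - q) * Q.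
  have -> : b = expR (ln b) by rewrite lnK// posrE.
  have -> : delta = expR (ln delta) by rewrite lnK// posrE.
  have -> : Q = expR (ln Q) by rewrite lnK// posrE.
  rewrite !powR_expR -!expRD !powR_expR; congr expR.
  by field; rewrite gt_eqF.
have -> : P = t `^ kappa * Q by rewrite /Q powRN mulrA mulfV ?mul1r// gt_eqF.
ring.
Qed.

Lemma wLp_int_zero (R : realType) (X : normedModType R) (p kappa T : R) (f : R -> X) :
  0 < p -> strongly_meas `]0, T[%classic f -> wLp_int p kappa 0 T f = 0%E ->
  {ae @leb R, forall t, `]0, T[%classic t -> f t = 0}.
Proof.
move=> p0 sf; have mD : measurable (`]0, T[%classic : set R) by exact: measurable_itv.
have [h [mh h0 fh]] := ae_borel_wLp p kappa sf.
rewrite /wLp_int (eq_integral_leb (fun t _ => wLp_integrand_ge0 p kappa f t) (fun t _ => h0 t) fh) => H.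
have H2 : ae_eq (@lebesgue_measure R) `]0, T[%classic (fun t => (h t)%:E) (cst 0%E).
  apply/(@ae_eq_integral_abs _ _ _ (@lebesgue_measure R) _ mD).
    by apply/measurable_EFinP; exact: measurable_funTS.
  by rewrite -[RHS]H; apply: eq_integral => t _ /=; rewrite ger0_norm.
apply: ae_leS2 fh H2 => t fh H2 tT; have := H2 tT; rewrite -fh// => -[] /eqP.
move: tT; rewrite /= in_itv /= => /andP[t0 _].
by rewrite mulf_eq0 !powR_eq0 !normr_eq0 (gt_eqF t0) /= => /andP[/eqP].
Qed.

Lemma MR_norm_int_le (R : realType) (X0 X1 : normedModType R) (J : X1 -> X0) (p kappa t K : R)
    (u : R -> X1) (g F : R -> X0) (D : R) :
  0 < p -> 0 <= K -> wLp p kappa 0 t u -> wLp p kappa 0 t g -> wLp p kappa 0 t F ->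
  MR_norm J p kappa 0 t u g <= K * wLp_norm p kappa 0 t F ->
  (wLp_int p kappa 0 t F <= D%:E)%E ->
  (wLp_int p kappa 0 t u <= (K `^ p * D)%:E)%E /\ (wLp_int p kappa 0 t g <= (K `^ p * D)%:E)%E.
Proof.
move=> p0 K0 [_ u0] [_ g0] [_ F0] + FD; rewrite /MR_norm ge_max => /andP[hu hg].
have fin (X : normedModType R) (f : R -> X) : (wLp_int p kappa 0 t f < +oo)%E ->
    wLp_int p kappa 0 t f = (fine (wLp_int p kappa 0 t f))%:E.
  by move=> H; rewrite fineK// ge0_fin_numE// wLp_int_ge0.
have pow (X : normedModType R) (f : R -> X) : wLp_norm p kappa 0 t f `^ p = fine (wLp_int p kappa 0 t f).
  by rewrite /wLp_norm -powRrM mulVf ?gt_eqF// powRr1// fine_ge0// wLp_int_ge0.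
have main (X : normedModType R) (f : R -> X) : (wLp_int p kappa 0 t f < +oo)%E ->
    wLp_norm p kappa 0 t f <= K * wLp_norm p kappa 0 t F ->
    (wLp_int p kappa 0 t f <= (K `^ p * D)%:E)%E.
  move=> f0 H; rewrite (fin _ f f0) lee_fin -pow.
  apply: (@le_trans _ _ ((K * wLp_norm p kappa 0 t F) `^ p)).
    by apply: ge0_ler_powR; rewrite ?nnegrE ?(ltW p0)// ?mulr_ge0 ?powR_ge0.
  rewrite powRM ?powR_ge0// pow ler_wpM2l ?powR_ge0//.
  by rewrite -lee_fin -(fin _ F F0).
split; first exact: (main _ u u0 hu).
apply: (main _ g g0); refine (le_trans _ hg).
set y := wLp_norm p kappa 0 t g; have y0 : 0 <= y by exact: powR_ge0.
rewrite {1}(_ : y = (y `^ p) `^ p^-1); last by rewrite -powRrM mulfV ?powRr1// gt_eqF.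
apply: ge0_ler_powR; rewrite ?nnegrE ?invr_ge0 ?(ltW p0) ?powR_ge0 ?addr_ge0 ?powR_ge0//.
by rewrite lerDr powR_ge0.
Qed.

(** [MR] provides a derivative in the weighted space with an unspecified initial value, [strong_sol]
    one in L^1 with value 0. Subtracting the two representations leaves the zero function, so the
    values agree. *)
Lemma MR_init (R : realType) (X0 X1 : normedModType R) (J : X1 -> X0) (Aop : R -> X1 -> X0)
    (p kappa T : R) (f : R -> X0) (u : R -> X1) :
  1 < p -> 0 <= kappa < p - 1 -> 0 < T -> MR J p kappa 0 T u -> strong_sol J Aop 0 T f 0 u ->
  exists g, is_deriv p kappa 0 T (J \o u) g 0.
Proof.
move=> p1 kp T0 [_ [_ [g [c dg]]]] [_ [_ [_ [g1 [dg1 _]]]]].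
exists g; suff -> : 0 = c by [].
have dg' : is_deriv 1 0 0 T (J \o u) g c by split; [exact: (wLp_L1 p1 kp T0 dg.1)|exact: dg.2].
have := is_derivB ler01 dg' dg1; rewrite subr0.
rewrite (_ : (fun t => _ - _) = (fun=> 0)); last by apply/funext => t; rewrite subrr.
by move/(is_deriv_init T0).
Qed.

(** * Completeness *)

Lemma cvg_geometric_increments (R : realType) (X : completeNormedModType R) (f : nat -> X) (M : R) :
  (forall n, `|f n.+1 - f n| <= M / 2 ^+ n.+1) ->
  exists l, f @ \oo --> l /\ forall n, `|l - f n| <= M / 2 ^+ n.
Proof.
move=> H.
have M0 : 0 <= M by have := le_trans (normr_ge0 _) (H 0%N); rewrite pmulr_lge0// invr_gt0.
(* Keeping the remainder [M / 2 ^+ (n + k)] on the right makes the induction on [k] close. *)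
have H2 n k : `|f (n + k)%N - f n| <= M / 2 ^+ n - M / 2 ^+ (n + k).
  elim: k => [|k IH]; first by rewrite addn0 !subrr normr0.
  rewrite addnS -[X in `|X|](subrKA (f (n + k)%N)); apply: le_trans (ler_normD _ _) _.
  apply: le_trans (lerD (H _) IH) _.
  rewrite exprS; have e0 : 2 ^+ (n + k) != 0 :> R by rewrite expf_neq0.
  have -> : M / 2 ^+ (n + k) = 2 * (M / (2 * 2 ^+ (n + k))) by field.
  lra.
have H3 n k : `|f (n + k)%N - f n| <= M / 2 ^+ n.
  by apply: le_trans (H2 n k) _; rewrite gerBl divr_ge0// exprn_ge0.
have cf : cvgn f.
  have : cvgn (series (telescope f)).
    apply: normed_cvg; apply: (@series_le_cvg _ _ (geometric (M / 2) 2^-1)).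
    - by move=> n; exact: normr_ge0.
    - by move=> n /=; rewrite mulr_ge0 ?divr_ge0// exprn_ge0// invr_ge0.
    - move=> n /=; apply: le_trans (H n) _; rewrite exprS exprVn le_eqVlt; apply/orP; left; apply/eqP.
      by field; rewrite expf_neq0.
    - by apply: is_cvg_geometric_series; rewrite ger0_norm ?invr_ge0// invf_lt1// ltr1n.
  rewrite telescopeK => /cvg_ex [l cl]; apply/cvg_ex; exists (l + f 0%N).
  have c3 : (fun n => (f n - f 0%N) + f 0%N) @ \oo --> l + f 0%N.
    by apply: cvgD => //; exact: cvg_cst.
  by move: c3; under eq_fun do rewrite subrK.
have /cvg_ex[l cl] := cf; exists l; split => // n.
have c2 : (fun m => `|f m - f n|) @ \oo --> `|l - f n|.
  by apply: cvg_norm; apply: cvgB => //; exact: cvg_cst.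
by apply: (@cvg_le_cst _ _ _ _ n c2) => m nm; have := H3 n (m - n)%N; rewrite subnKC.
Qed.

Lemma powR_invK (R : realType) (x p : R) : 0 <= x -> 0 < p -> (x `^ p) `^ p^-1 = x.
Proof. by move=> x0 p0; rewrite -powRrM mulfV ?powRr1// gt_eqF. Qed.

Lemma powR_exprV (R : realType) (p : R) (n : nat) : ((2 ^+ n)^-1) `^ p = (2 `^ (- p)) ^+ n :> R.
Proof.
elim: n => [|n IH]; first by rewrite !expr0 invr1 powR1.
rewrite !exprS invfM powRM ?invr_ge0 ?exprn_ge0// IH; congr (_ * _).
by rewrite -powR_inv1// -powRrM mulN1r.
Qed.

Lemma ae_forall_leb (R : realType) (P : nat -> R -> Prop) :
  (forall n, {ae @leb R, forall t, P n t}) -> {ae @leb R, forall t, forall n, P n t}.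
Proof. exact: (@ae_foralln _ _ _ (@lebesgue_measure R)). Qed.

(* With ratio [2^-p / 2] the increments are summable after multiplication by [2^(p(n+1))],
   which yields the pointwise bound [|f_{n+1} - f_n| <= 2^-(n+1) G^(1/p)] with [G] integrable. *)
Lemma wLp_complete (R : realType) (X : completeNormedModType R) (p kappa T C : R) (f : nat -> R -> X) :
  0 < p -> 0 < T -> 0 < C -> (forall n, wLp p kappa 0 T (f n)) ->
  (forall n, (wLp_int p kappa 0 T (fun t => f n.+1 t - f n t)%R <= (C * (2 `^ (- p) / 2) ^+ n)%:E)%E) ->
  exists F C', [/\ 0 < C', wLp p kappa 0 T F &
    forall n, (wLp_int p kappa 0 T (fun t => F t - f n t)%R <= (C' * (2 `^ (- p)) ^+ n)%:E)%E].
Proof.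
move=> p0 T0 C0 wf Hf; have mD : measurable (`]0, T[%classic : set R) by exact: measurable_itv.
have sd n : strongly_meas `]0, T[%classic (fun t => f n.+1 t - f n t).
  exact: (smB (wf n.+1).1 (wf n).1).
have [k hk] := choice (fun n => ae_borel_wLp p kappa (sd n)).
(* [c n] is 2^(p(n+1)): one term of the sum [G] controls the p-th power of 2^(n+1) times the n-th
   increment. *)
pose c n := 2 `^ p * (2 `^ p) ^+ n : R.
have c0 n : 0 <= c n by rewrite mulr_ge0 ?exprn_ge0 ?powR_ge0.
pose G t := (\sum_(0 <= n <oo) (c n * k n t)%:E)%E.
have k0 n t : 0 <= k n t by have [] := hk n.
have mk n : measurable_fun setT (k n) by have [] := hk n.
have ck0 n t : (0 <= (c n * k n t)%:E)%E by rewrite lee_fin mulr_ge0.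
have mck n : measurable_fun (`]0, T[%classic : set R) (fun t => (c n * k n t)%:E).
  by apply/measurable_EFinP; apply: measurable_funTS; exact: measurable_funM.
have mG : measurable_fun (`]0, T[%classic : set R) G by exact: ge0_emeasurable_sum.
have G0 t : (0 <= G t)%E by apply: nneseries_ge0.
have IG : (\int[@leb R]_(t in `]0%R, T[) G t <= (2 `^ p * C * 2)%:E)%E.
  rewrite /G (@integral_nneseries _ _ _ (@lebesgue_measure R))//.
  (* The powers of 2^p cancel: c_n C (2^-p / 2)^n = 2^p C / 2^n, written with n + 1 to fit
     [epsilon_trick]. *)
  apply: (@le_trans _ _ (\sum_(0 <= n <oo) (cst 0 n + (2 `^ p * C * 2 / (2 ^ n.+1)%:R)%:E))%E).
    apply: lee_nneseries => [n *|n *].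
      by apply: (@integral_ge0 _ _ _ (@lebesgue_measure R)) => t _; exact: ck0.
    rewrite /cst add0e.
    have := Hf n; rewrite /wLp_int (eq_integral_leb (fun t _ => wLp_integrand_ge0 p kappa _ t) (fun t _ => k0 n t) (let: And3 _ _ h := hk n in h)) => h.
    rewrite (_ : integral _ _ _ = (c n)%:E * \int[@leb R]_(t in `]0%R, T[) (k n t)%:E)%E; last first.
      apply: (lower_integralZ mD (c0 n) (fun t _ => k0 n t)).
      by apply: ae_borel_measurable => //; apply: measurable_funTS.
    apply: le_trans (lee_wpmul2l _ h) _; first by rewrite lee_fin.
    rewrite -EFinM lee_fin /c powRN natrX exprS exprMn !exprVn le_eqVlt; apply/orP; left; apply/eqP.
    by field; rewrite !expf_neq0// gt_eqF// powR_gt0.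
  apply: le_trans (epsilon_trick _ _ _) _ => //.
    by rewrite !mulr_ge0 ?powR_ge0 ?ltW.
  by rewrite eseries0// add0e.
have aeG : {ae @leb R, forall t, `]0, T[%classic t -> G t \is a fin_num}.
  apply: (@integrable_ae _ _ _ (@lebesgue_measure R) _ mD); apply/integrableP; split => //.
  apply: le_lt_trans (ltry (2 `^ p * C * 2)); apply: le_trans IG.
  by rewrite le_eqVlt; apply/orP; left; apply/eqP; apply: eq_integral => t _; rewrite gee0_abs.
have aek : {ae @leb R, forall t, forall n, `]0, T[%classic t -> `|t| `^ kappa * `|f n.+1 t - f n t| `^ p = k n t}.
  by apply: ae_forall_leb => n; have [] := hk n.
pose F t := limn (fun n => f n t).
have good : {ae @leb R, forall t, `]0, T[%classic t -> (fun n => f n t) @ \oo --> F t /\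
    forall n, `|t| `^ kappa * `|F t - f n t| `^ p <= (2 `^ (- p)) ^+ n * fine (G t)}.
  apply: ae_leS2 aeG aek => t Gf kt tT.
  move: (tT); rewrite /= in_itv /= => /andP[t0 _].
  have tk0 : 0 < `|t| `^ kappa by rewrite powR_gt0// normr_gt0 gt_eqF.
  set g := fine (G t) / `|t| `^ kappa.
  have g0 : 0 <= g by rewrite divr_ge0 ?powR_ge0// fine_ge0.
  have bd n : `|f n.+1 t - f n t| <= g `^ p^-1 / 2 ^+ n.+1.
    have h1 : c n * k n t <= fine (G t).
      rewrite -lee_fin fineK; last exact: Gf.
      apply: le_trans (nneseries_lim_ge n.+1 _); last by move=> *; exact: ck0.
      by rewrite big_nat_recr//= leeDr// sume_ge0.
    have h2 : (2 ^+ n.+1 * `|f n.+1 t - f n t|) `^ p <= g.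
      rewrite /g ler_pdivlMr// powRM ?exprn_ge0//.
      apply: le_trans h1; rewrite -(kt n tT) /c.
      have -> : (2 ^+ n.+1) `^ p = 2 `^ p * (2 `^ p) ^+ n :> R.
        rewrite -!powR_mulrn// ?powR_ge0// -!powRrM -powRD ?pnatr_eq0 ?implybT//.
        by congr (_ `^ _); rewrite -natr1; ring.
      by rewrite le_eqVlt; apply/orP; left; apply/eqP; ring.
    rewrite ler_pdivlMr ?exprn_gt0// mulrC.
    have h3 : 0 <= 2 ^+ n.+1 * `|f n.+1 t - f n t| by rewrite mulr_ge0// exprn_ge0.
    rewrite -[leLHS](powR_invK h3 p0).
    by apply: ge0_ler_powR; rewrite ?nnegrE ?invr_ge0 ?(ltW p0) ?powR_ge0.
  have [l [cl Hl]] := cvg_geometric_increments bd.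
  have Fl : F t = l by apply: cvg_lim => //; exact: norm_hausdorff.
  rewrite Fl; split => // n.
  apply: (@le_trans _ _ (`|t| `^ kappa * (g `^ p^-1 / 2 ^+ n) `^ p)).
    rewrite ler_pM2l//; apply: ge0_ler_powR; rewrite ?nnegrE ?(ltW p0)//.
    by rewrite divr_ge0 ?powR_ge0// exprn_ge0.
  rewrite powRM ?powR_ge0 ?invr_ge0 ?exprn_ge0// -powRrM mulVf ?gt_eqF// powRr1//.
  rewrite /g mulrA mulrC (mulrC (`|t| `^ kappa)) divfK ?gt_eqF// ler_wpM2r ?fine_ge0//.
  by rewrite powR_exprV.
have D0 : (@leb R `]0%R, T[%classic < +oo)%E by rewrite leb_itvoo// ltry.
have sF : strongly_meas `]0, T[%classic F.
  apply: (@sm_lim _ _ _ f F mD D0); first by move=> n; exact: (wf n).1.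
  by apply: ae_leS good => t H /H [].
have est n : (wLp_int p kappa 0 T (fun t => F t - f n t)%R <= (2 `^ p * C * 2 * (2 `^ (- p)) ^+ n)%:E)%E.
  apply: (@le_trans _ _ (\int[@leb R]_(t in `]0%R, T[) (((2 `^ (- p)) ^+ n)%:E * G t))%E).
    apply: (@ae_ge0_le_lower_integral _ _ _ (@lebesgue_measure R)).
    - by move=> t _; rewrite lee_fin mulr_ge0 ?powR_ge0.
    - by move=> t _; rewrite mule_ge0// lee_fin exprn_ge0 ?powR_ge0.
    - apply: ae_leS2 aeG good => t Gf H tT; have [_ /(_ n)] := H tT.
      by rewrite -{2}(fineK (Gf tT)) -EFinM lee_fin.
  rewrite (@ge0_integralZl_EFin _ _ _ (@lebesgue_measure R))// ?exprn_ge0 ?powR_ge0//.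
  by rewrite mulrC EFinM lee_wpmul2l// lee_fin exprn_ge0 ?powR_ge0.
exists F, (2 `^ p * C * 2); split.
- by rewrite !mulr_gt0// powR_gt0.
- have wd : wLp p kappa 0 T (fun t => F t - f 0%N t).
    split; first exact: (smB sF (wf 0%N).1).
    exact: (le_lt_trans (est 0%N) (ltry _)).
  have := wLpD (ltW p0) wd (wf 0%N).
  by rewrite (_ : (fun t => _ + _) = F)//; apply/funext => t; rewrite subrK.
- exact: est.
Qed.

(** * The perturbed problem *)

(* [E t] is [B t \o J]; [E_interp] is the bound [|B t| <= b t] on the interpolation space. *)
Record perturbation (R : realType) (X0 X1 : normedModType R) (J : {linear X1 -> X0}) (q T N : R)
    (E : R -> X1 -> X0) (b : R -> R) : Prop := Perturbation {
  E_add : forall t x y, E t (x + y) = E t x + E t y;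
  E_scale : forall t c x, E t (c *: x) = c *: E t x;
  E_meas : forall x, strongly_meas `[0, T]%classic (fun t => E t x);
  E_interp : forall t, 0 <= t <= T -> forall x, `|E t x| <= b t * interp_norm J (1 - q^-1) (J x);
  E_bmeas : measurable_fun `]0, T[%classic b;
  E_bfin : Lq_fin q 0 T b;
  E_bnorm : Lq_norm q 0 T b = N }.

(** Extension by zero gives a nonnegative integrable Borel function on the whole line, as the lemmas
    on [cumul] expect; its [cumul] is the function beta. *)
Definition bweight (R : realType) (q T : R) (b : R -> R) : R -> R :=
  (fun t => `|b t| `^ q) \_ `]0, T[%classic.

Lemma bweight_ge0 (R : realType) (q T : R) (b : R -> R) (t : R) : 0 <= bweight q T b t.
Proof. by rewrite /bweight patchE; case: ifP => // _; exact: powR_ge0. Qed.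

Lemma bweight_in (R : realType) (q T : R) (b : R -> R) (t : R) : 0 < t < T ->
  bweight q T b t = `|b t| `^ q.
Proof. by move=> tT; rewrite /bweight patchE mem_set//= in_itv. Qed.

Lemma measurable_bweight (R : realType) (q T : R) (b : R -> R) :
  measurable_fun `]0, T[%classic b -> measurable_fun setT (bweight q T b).
Proof.
move=> mb; have mD : measurable (`]0, T[%classic : set R) by exact: measurable_itv.
apply/measurable_restrict => //; rewrite setTI.
apply: (measurableT_comp (measurable_powR q)).
exact: (measurableT_comp (@normr_measurable R setT)).
Qed.

Lemma integral_bweight (R : realType) (q T : R) (b : R -> R) :
  (\int[@leb R]_s (bweight q T b s)%:E = \int[@leb R]_(t in `]0%R, T[) (`|b t| `^ q)%:E)%E.
Proof.
rewrite [RHS]integral_mkcond; apply: eq_integral => s _.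
by rewrite /bweight !patchE; case: ifP.
Qed.

Lemma cumul_bweight_le (R : realType) (q T N : R) (b : R -> R) (t : R) : 0 < q ->
  Lq_fin q 0 T b -> Lq_norm q 0 T b = N -> cumul (bweight q T b) t <= N `^ q.
Proof.
move=> q0 bf <-; rewrite /Lq_norm -powRrM mulVf ?gt_eqF// powRr1; last first.
  by apply: fine_ge0; apply: (@integral_ge0 _ _ _ (@lebesgue_measure R)) => s _; rewrite lee_fin powR_ge0.
have bi : (\int[@leb R]_s (bweight q T b s)%:E < +oo)%E by rewrite integral_bweight.
rewrite -lee_fin -cumul_fin//; last by move=> s; exact: bweight_ge0.
rewrite fineK; last first.
  rewrite ge0_fin_numE//.
  by apply: (@integral_ge0 _ _ _ (@lebesgue_measure R)) => s _; rewrite lee_fin powR_ge0.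
rewrite -integral_bweight; apply: le_integral_leb_subset => // s _; exact: bweight_ge0.
Qed.

(** For fixed t, [b t] and the embedding of [X1] into the interpolation space make [E t] bounded on
    [X1]. Hence [E t (u t)] is the limit of [E t] on step functions, which are finite sums of
    indicators times the measurable [E t x]. *)
Lemma perturb_sm (R : realType) (X0 X1 : normedModType R) (J : {linear X1 -> X0}) (q T N : R)
    (E : R -> X1 -> X0) (b : R -> R) (tau : R) (u : R -> X1) :
  continuous J -> 1 < q -> perturbation J q T N E b -> 0 < tau <= T ->
  strongly_meas `]0, tau[%classic u -> strongly_meas `]0, tau[%classic (fun t => E t (u t)).
Proof.
move=> cJ q1 HE /andP[t0 tT] [s [ms cs]].
have [c c0 Hc] := interp_embedding cJ q1.
have mD : measurable (`]0, tau[%classic : set R) by exact: measurable_itv.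
have sub : (`]0, tau[%classic : set R) `<=` `[0, T]%classic.
  by move=> t /=; rewrite !in_itv /= => /andP[a b']; apply/andP; split; [exact: ltW|apply: ltW; exact: lt_le_trans tT].
have E0 t : E t 0 = 0 by rewrite -(scale0r (0 : X1)) (E_scale HE) scale0r.
apply: (@sm_lim _ _ _ (fun n t => E t (step_fun (s n) t)) _ mD).
- by rewrite leb_itvoo// ltry.
- move=> n; rewrite /step_fun; elim: (st_n (s n)) => [|m IH].
    rewrite (_ : (fun t => _) = (fun=> 0)); first exact: sm_cst0.
    by apply/funext => t; rewrite big_ord0 E0.
  rewrite (_ : (fun t => _) = (fun t => E t (\sum_(i < m) \1_(st_A (s n) i) t *: st_x (s n) i) +
      \1_(st_A (s n) m) t *: E t (st_x (s n) m))); last first.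
    by apply/funext => t; rewrite big_ord_recr /= (E_add HE) (E_scale HE).
  apply: smD => //; apply: sm_indic; first exact: ms.
  by apply: sm_sub (E_meas HE _); apply: subset_trans sub; exact: subIsetl.
- apply: ae_leS cs => t Ht tD.
  have tI : 0 <= t <= T by have := sub _ tD; rewrite /= in_itv.
  apply/cvgrPdist_le => /= e e0.
  have b0 : 0 <= `|b t| * c by rewrite mulr_ge0// ltW.
  have /cvgrPdist_lt /(_ (e / (`|b t| * c + 1))) := Ht tD.
  rewrite divr_gt0// ?ltr_wpDl// => /(_ isT); apply: filterS => n hn.
  have -> : E t (u t) - E t (step_fun (s n) t) = E t (u t - step_fun (s n) t).
    by rewrite -scaleN1r -(E_scale HE) -(E_add HE) scaleN1r.
  apply: le_trans (E_interp HE tI _) _.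
  apply: (@le_trans _ _ (`|b t| * (c * `|u t - step_fun (s n) t|))).
    apply: le_trans (ler_norm _) _; rewrite normrM ler_wpM2l// ger0_norm; first exact: (Hc _).2.
    apply: fine_ge0; apply: (@integral_ge0 _ _ _ (@lebesgue_measure R)) => r /=; rewrite in_itv /= andbT => r0.
    by rewrite lee_fin divr_ge0 ?mulr_ge0 ?powR_ge0 ?Kfun_ge0// ltW.
  rewrite mulrA; apply: (@le_trans _ _ ((`|b t| * c + 1) * (e / (`|b t| * c + 1)))).
    by apply: ler_pM => //; [rewrite lerDl|exact: ltW].
  by rewrite mulrC divfK// gt_eqF// ltr_wpDl.
Qed.

(** The pointwise estimate is integrated with P = D exp(lam beta(t)), which depends on t. The term
    with b becomes the integral of |b|^q exp(lam beta), at most 2 / lam times exp(lam beta(tau)). *)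
Lemma perturb_wLp_int (R : realType) (X0 X1 : normedModType R) (J : {linear X1 -> X0})
    (p q kappa T N delta lam D : R) (E : R -> X1 -> X0) (b : R -> R) (tau : R) (u : R -> X1) (g : R -> X0) :
  1 < p -> p < q -> 0 <= kappa < p - 1 -> 0 < delta -> 0 < lam -> 0 < D ->
  perturbation J q T N E b -> 0 < tau <= T ->
  strongly_meas `]0, tau[%classic u -> is_deriv p kappa 0 tau (J \o u) g 0 ->
  (forall t, 0 < t <= tau ->
    (wLp_int p kappa 0 t u <= (D * expR (lam * cumul (bweight q T b) t))%:E)%E /\
    (wLp_int p kappa 0 t g <= (D * expR (lam * cumul (bweight q T b) t))%:E)%E) ->
  (wLp_int p kappa 0 tau (fun t => E t (u t)) <=
    (((2 * (q * delta)) `^ p + Bconst p q kappa delta * (2 / lam)) * (D * expR (lam * cumul (bweight q T b) tau)))%:E)%E.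
Proof.
move=> p1 pq kp d0 lam0 D0 HE /andP[t0 tT] su dg Hb.
set be := cumul (bweight q T b).
have w0 := bweight_ge0 q T b.
have mw := measurable_bweight q (E_bmeas HE).
have wi : (\int[@leb R]_s (bweight q T b s)%:E < +oo)%E by rewrite integral_bweight; exact: (E_bfin HE).
have mD : measurable (`]0, tau[%classic : set R) by exact: measurable_itv.
have Bc := Bconst_ge0 p q kappa delta.
have qd : 0 <= (2 * (q * delta)) `^ p by exact: powR_ge0.
pose w t := bweight q T b t * expR (lam * be t).
have ww0 t : 0 <= w t by rewrite mulr_ge0 ?expR_ge0.
have BD : 0 <= Bconst p q kappa delta * D by rewrite mulr_ge0// ltW.
have wborel : ae_borel `]0, tau[%classic w.
  apply: (@ae_borel_sub _ _ setT) => //; apply: ae_borel_measurable => //.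
  apply: measurable_funM => //; apply: (measurableT_comp (@measurable_expR R)).
  apply: measurable_funM => //; apply: nondecreasing_measurable => //.
  exact: cumul_mono.
have uborel := ae_borel_wLp p kappa su.
have K := Kfun_trace_le p1 kp dg.
apply: (@le_trans _ _ (\int[@leb R]_(t in `]0%R, tau[)
    ((2 * (q * delta)) `^ p * (`|t| `^ kappa * `|u t| `^ p) + Bconst p q kappa delta * D * w t)%:E)%E).
  apply: le_integral_leb.
  - by move=> t _; rewrite mulr_ge0 ?powR_ge0.
  - by move=> t _; rewrite addr_ge0// mulr_ge0// wLp_integrand_ge0.
  - apply: ae_leS K => t Kt tI; have {}Kt := Kt tI.
    move: tI; rewrite /= in_itv /= => /andP[tp tt].
    have tT' : t < T by exact: lt_le_trans tT.
    have [Hu Hg] := Hb t ltac:(by rewrite tp ltW).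
    have P0 : 0 < D * expR (lam * be t) by rewrite mulr_gt0 ?expR_gt0.
    have tI : 0 <= t <= T by rewrite !ltW.
    have := perturb_pointwise p1 pq kp d0 tp P0 (Kt _ P0 Hu Hg) (E_interp HE tI (u t)).
    rewrite (gtr0_norm tp) => /le_trans; apply; rewrite lerD2l /w bweight_in ?tp//.
    by rewrite le_eqVlt; apply/orP; left; apply/eqP; ring.
rewrite lower_integralD//; last 4 first.
- by move=> t _; rewrite mulr_ge0// wLp_integrand_ge0.
- by move=> t _; rewrite mulr_ge0.
- by apply: ae_borelM => //; exact: ae_borel_cst.
- by apply: ae_borelM => //; exact: ae_borel_cst.
rewrite [X in (X + _)%E](lower_integralZ mD qd (fun t _ => wLp_integrand_ge0 p kappa u t) uborel).
rewrite (lower_integralZ mD BD (fun t _ => ww0 t) wborel).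
rewrite [leRHS](_ : _ = ((2 * (q * delta)) `^ p * (D * expR (lam * be tau)))%:E +
   (Bconst p q kappa delta * (2 / lam) * (D * expR (lam * be tau)))%:E)%E; last by rewrite -EFinD -mulrDl.
apply: leeD.
  rewrite [leRHS]EFinM lee_wpmul2l ?lee_fin//; have tauI : 0 < tau <= tau by rewrite t0 lexx.
  exact: (Hb tau tauI).1.
apply: (@le_trans _ _ ((Bconst p q kappa delta * D)%:E * (2 / lam * expR (lam * be tau))%:E)%E).
  rewrite lee_wpmul2l ?lee_fin//.
  apply: le_trans (integral_expR_cumul w0 mw wi lam0 (ltW t0)) _.
  by rewrite lee_fin; apply: ler_wpM2l; [apply: divr_ge0 => //; exact: ltW|rewrite gerBl].
by rewrite -EFinM lee_fin le_eqVlt; apply/orP; left; apply/eqP; field; rewrite gt_eqF.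
Qed.

(** F -> E (S F) contracts sup_t exp(-lam beta(t)) Phi_t(F), the p-th power of a norm, by the factor
    [rho]. Here [v] is any solution on (0, tau): it is S F in the existence proof and a given
    perturbed solution in the a priori estimate. *)
Definition contracts (R : realType) (X0 X1 : normedModType R) (J : X1 -> X0) (p kappa T rho lam : R)
    (beta : R -> R) (A E : R -> X1 -> X0) : Prop :=
  forall (F : R -> X0) (tau : R) (v : R -> X1) (D : R),
    wLp p kappa 0 T F -> 0 < tau <= T -> MR J p kappa 0 tau v -> strong_sol J A 0 tau F 0 v -> 0 < D ->
    (forall t, 0 < t <= tau -> (wLp_int p kappa 0 t F <= (D * expR (lam * beta t))%:E)%E) ->
    forall t, 0 < t <= tau ->
      (wLp_int p kappa 0 t (fun s => E s (v s)) <= (rho * (D * expR (lam * beta t)))%:E)%E.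

(** [delta] makes (2 q delta K)^p equal to rho/2, and [lam] brings the remaining term below rho/2;
    the 1 in [lam] keeps it positive. Both are fixed before T, N, A, E and b, which gives the
    uniformity of the final constant. *)
Lemma perturb_contracts (R : realType) (X0 X1 : normedModType R) (J : {linear X1 -> X0})
    (p q kappa K rho : R) : 1 < p -> p < q -> 0 <= kappa < p - 1 -> 0 < K -> 0 < rho ->
  exists2 lam, 0 < lam & forall (T N : R) (E A : R -> X1 -> X0) (b : R -> R),
    perturbation J q T N E b -> MR_est J p kappa A 0 T K ->
    contracts J p kappa T rho lam (cumul (bweight q T b)) A E.
Proof.
move=> p1 pq kp K0 rho0.
have p0 : 0 < p by lra.
have q0 : 0 < q by lra.
have K0' := ltW K0.
pose delta := (rho / 2) `^ p^-1 / (2 * q * K).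
have d0 : 0 < delta.
  by rewrite divr_gt0// ?mulr_gt0// powR_gt0// divr_gt0.
have Bc := Bconst_ge0 p q kappa delta.
set B := Bconst p q kappa delta in Bc *.
have KP : 0 < K `^ p by rewrite powR_gt0.
have BK : 0 <= B * K `^ p by rewrite mulr_ge0// ltW.
pose lam := (4 * (B * K `^ p) + 1) / rho.
have lamN : 0 < 4 * (B * K `^ p) + 1 by lra.
have lam0 : 0 < lam by rewrite divr_gt0.
exists lam => // T N E A b HE HA F tau v D wF /andP[tau0 tauT] Mv Sv D0 HF t /andP[t0 ttau].
have [g dg] := MR_init p1 kp tau0 Mv Sv.
have KD : 0 < K `^ p * D by rewrite mulr_gt0.
have tT : t <= T by exact: le_trans tauT.
have tI : 0 < t <= T by rewrite t0.
have su : strongly_meas `]0, t[%classic v := (wLp_sub ttau Mv.1).1.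
(* The regularity estimate is used on every (0, s), so the exponential bound passes from F to v and
   its derivative at each time. *)
have bnd s : 0 < s <= t ->
    (wLp_int p kappa 0 s v <= (K `^ p * D * expR (lam * cumul (bweight q T b) s))%:E)%E /\
    (wLp_int p kappa 0 s g <= (K `^ p * D * expR (lam * cumul (bweight q T b) s))%:E)%E.
  move=> /andP[s0 st]; have stau : s <= tau by exact: le_trans ttau.
  have sT : s <= T by exact: le_trans tauT.
  have sI : 0 < s <= T by rewrite s0.
  have ds := is_deriv_sub stau dg.
  have H := HA F wF s sI v (MR_sub stau Mv) (strong_sol_sub stau Sv) g 0 ds.
  have sI' : 0 < s <= tau by rewrite s0.
  rewrite -mulrA.
  exact: (MR_norm_int_le p0 K0' (wLp_sub stau Mv.1) ds.1 (wLp_sub sT wF) H (HF s sI')).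
apply: (le_trans (perturb_wLp_int p1 pq kp d0 lam0 KD HE tI su (is_deriv_sub ttau dg) bnd)).
rewrite lee_fin -/B -[K `^ p * D * _]mulrA mulrA ler_wpM2r ?mulr_ge0 ?expR_ge0 ?(ltW D0)//.
have -> : (2 * (q * delta)) `^ p = rho / 2 / K `^ p.
  have -> : 2 * (q * delta) = (rho / 2) `^ p^-1 / K by rewrite /delta; field; rewrite !gt_eqF.
  rewrite powRM ?powR_ge0 ?invr_ge0// -powRrM mulVf ?gt_eqF// powRr1 ?divr_ge0 ?(ltW rho0)//.
  by congr (_ * _); rewrite -powR_inv1// -powRrM mulN1r powRN.
rewrite mulrDl divfK ?gt_eqF//.
have -> : B * (2 / lam) * K `^ p = rho / 2 * ((4 * (B * K `^ p)) / (4 * (B * K `^ p) + 1)).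
  by rewrite /lam; field; rewrite !gt_eqF.
have : (4 * (B * K `^ p)) / (4 * (B * K `^ p) + 1) <= 1 by rewrite ler_pdivrMr// mul1r lerDl.
set z := _ / (_ + 1) => z1.
have : rho / 2 * z <= rho / 2 by rewrite ler_piMr// divr_ge0// ltW.
lra.
Qed.

(** Only finiteness is at stake: delta = lam = 1, and D exceeds the integrals of both v and its
    derivative. [Aop] is arbitrary, so that the lemma serves solutions of the original and of the
    perturbed equation. *)
Lemma perturb_wLp (R : realType) (X0 X1 : normedModType R) (J : {linear X1 -> X0})
    (p q kappa T N tau : R) (E Aop : R -> X1 -> X0) (b : R -> R) (f : R -> X0) (v : R -> X1) :
  continuous J -> 1 < p -> p < q -> 0 <= kappa < p - 1 -> perturbation J q T N E b -> 0 < tau <= T ->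
  MR J p kappa 0 tau v -> strong_sol J Aop 0 tau f 0 v ->
  wLp p kappa 0 tau (fun t => E t (v t)).
Proof.
move=> cJ p1 pq kp HE tauT Mv Sv; have [tau0 _] := andP tauT.
have q1 : 1 < q by exact: lt_trans pq.
split; first exact: (perturb_sm cJ q1 HE tauT Mv.1.1).
have [g dg] := MR_init p1 kp tau0 Mv Sv.
set D := fine (wLp_int p kappa 0 tau v) + fine (wLp_int p kappa 0 tau g) + 1.
have u0 : 0 <= fine (wLp_int p kappa 0 tau v) by rewrite fine_ge0 ?wLp_int_ge0.
have g0 : 0 <= fine (wLp_int p kappa 0 tau g) by rewrite fine_ge0 ?wLp_int_ge0.
have D0 : 0 < D by exact: (ltr_wpDl (addr_ge0 u0 g0) ltr01).
have uD : fine (wLp_int p kappa 0 tau v) <= D by rewrite /D -addrA lerDl; exact: (addr_ge0 g0 ler01).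
have gD : fine (wLp_int p kappa 0 tau g) <= D by rewrite /D addrAC lerDr; exact: (addr_ge0 u0 ler01).
have bnd (X : normedModType R) (h : R -> X) t : (wLp_int p kappa 0 tau h < +oo)%E ->
    fine (wLp_int p kappa 0 tau h) <= D -> t <= tau ->
    (wLp_int p kappa 0 t h <= (D * expR (1 * cumul (bweight q T b) t))%:E)%E.
  move=> hf hD tt; apply: (@le_trans _ _ D%:E).
    apply: (le_trans (wLp_int_sub p kappa 0 h tt)).
    by rewrite -lee_fin fineK ?ge0_fin_numE ?wLp_int_ge0// in hD.
  by rewrite lee_fin ler_peMr ?(ltW D0)// mul1r -expR0 ler_expR cumul_ge0// => s; exact: bweight_ge0.
have bnds t : 0 < t <= tau ->
    (wLp_int p kappa 0 t v <= (D * expR (1 * cumul (bweight q T b) t))%:E)%E /\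
    (wLp_int p kappa 0 t g <= (D * expR (1 * cumul (bweight q T b) t))%:E)%E.
  move=> /andP[_ tt]; split.
    exact: (bnd _ v t Mv.1.2 uD tt).
  exact: (bnd _ g t dg.1.2 gD tt).
exact: (le_lt_trans (perturb_wLp_int p1 pq kp ltr01 ltr01 D0 HE tauT Mv.1.1 dg bnds) (ltry _)).
Qed.

(** * A priori estimate for the perturbed problem *)

Lemma wLp_restr (R : realType) (X : normedModType R) (p kappa T tau : R) (f : R -> X) :
  0 < p -> tau <= T -> wLp p kappa 0 tau f ->
  wLp p kappa 0 T (fun t => \1_(`]0, tau[%classic : set R) t *: f t).
Proof.
move=> p0 tT [sf f0]; split.
  apply: sm_indic; first exact: measurable_itv.
  by apply: sm_sub sf; exact: subIsetr.
suff -> : wLp_int p kappa 0 T (fun t => \1_(`]0, tau[%classic : set R) t *: f t) = wLp_int p kappa 0 tau f by exact: f0.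
rewrite /wLp_int integral_mkcond [RHS]integral_mkcond; apply: eq_integral => t _.
rewrite !patchE indicE; have [tt|tt] := pselect (`]0, tau[%classic t).
  by rewrite !mem_set ?scale1r//; exact: subset_itvoo_r tt.
by rewrite (memNset tt) scale0r normr0 powR0 ?gt_eqF// mulr0; case: ifP.
Qed.

Lemma indic_itv_scale (R : realType) (X : normedModType R) (tau t : R) (x : X) :
  `]0, tau[%classic t -> \1_(`]0, tau[%classic : set R) t *: x = x.
Proof. by move=> tt; rewrite indicE mem_set// scale1r. Qed.

(** A perturbed solution solves the unperturbed problem with right-hand side f - E v. This lives on
    (0, tau) and is extended by zero, because [MR_est] and [contracts] ask for data on (0, T). *)
Lemma perturb_rhs (R : realType) (X0 X1 : normedModType R) (J : {linear X1 -> X0})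
    (p q kappa T N tau : R) (E A : R -> X1 -> X0) (b : R -> R) (f : R -> X0) (v : R -> X1) :
  continuous J -> 1 < p -> p < q -> 0 <= kappa < p - 1 -> perturbation J q T N E b -> 0 < tau <= T ->
  wLp p kappa 0 T f -> MR J p kappa 0 tau v ->
  strong_sol J (fun t x => A t x + E t x) 0 tau f 0 v ->
  let F := fun t => \1_(`]0, tau[%classic : set R) t *: (f t - E t (v t)) in
  wLp p kappa 0 T F /\ strong_sol J A 0 tau F 0 v.
Proof.
move=> cJ p1 pq kp HE tauT wf Mv Sv F; have [tau0 tT] := andP tauT.
have p0 : 0 < p by lra.
have wE := perturb_wLp cJ p1 pq kp HE tauT Mv Sv.
have wd := wLpB (ltW p0) (wLp_sub tT wf) wE.
split; first exact: (wLp_restr p0 tT wd).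
have [wu [wJ [wA [g [dg H]]]]] := Sv.
split; first exact: wu.
split; first exact: wJ.
split.
  have := wLpB ler01 wA (wLp_L1 p1 kp tau0 wE).
  by rewrite (_ : (fun t => _ - _) = (fun t => A t (v t)))//; apply/funext => t; rewrite addrK.
exists g; split; first exact: dg.
apply: ae_leS H => t Ht tt; rewrite /F (indic_itv_scale _ tt) -(Ht tt).
by rewrite addrA addrK.
Qed.

(** If D bounds the weighted quantity for F = f - E v, so does 2^p a + 2^p rho D = 2^p a + D/2.
    Starting from the finite but uncontrolled [D1], the iteration tends to the fixed point 2 2^p a,
    in which [D1] has disappeared. *)
Lemma contracts_apriori (R : realType) (X0 X1 : normedModType R) (J : {linear X1 -> X0})
    (p q kappa T N tau rho lam a : R) (E A : R -> X1 -> X0) (b : R -> R) (f : R -> X0) (v : R -> X1) :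
  let beta := cumul (bweight q T b) in
  continuous J -> 1 < p -> p < q -> 0 <= kappa < p - 1 -> perturbation J q T N E b -> 0 < tau <= T ->
  0 < rho -> 2 `^ p * rho = 2^-1 -> 0 < lam -> contracts J p kappa T rho lam beta A E ->
  wLp p kappa 0 T f -> MR J p kappa 0 tau v ->
  strong_sol J (fun t x => A t x + E t x) 0 tau f 0 v ->
  0 < a -> (wLp_int p kappa 0 tau f <= a%:E)%E ->
  (wLp_int p kappa 0 tau (fun t => f t - E t (v t))%R <= (2 * 2 `^ p * a * expR (lam * beta tau))%:E)%E.
Proof.
move=> beta cJ p1 pq kp HE tauT rho0 rhoE lam0 HC wf Mv Sv a0 fa; have [tau0 tT] := andP tauT.
have p0 : 0 < p by lra.
pose F t := \1_(`]0, tau[%classic : set R) t *: (f t - E t (v t)).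
have [wF SF] := perturb_rhs cJ p1 pq kp HE tauT wf Mv Sv.
have FE t : t <= tau -> wLp_int p kappa 0 t F = wLp_int p kappa 0 t (fun t => f t - E t (v t)).
  move=> tt; apply: wLp_int_eq; apply: ae_leb_all => s st.
  by rewrite /F indic_itv_scale//; exact: subset_itvoo_r st.
have be0 t : 1 <= expR (lam * beta t).
  rewrite -[leLHS]expR0 ler_expR mulr_ge0 ?(ltW lam0)//; apply: cumul_ge0 => s; exact: bweight_ge0.
set D1 := fine (wLp_int p kappa 0 tau F) + 1.
have D10 : 0 < D1 by rewrite /D1 ltr_wpDl// fine_ge0// wLp_int_ge0.
have a2 : 0 < 2 * 2 `^ p * a by rewrite !mulr_gt0// powR_gt0.
have wE := perturb_wLp cJ p1 pq kp HE tauT Mv Sv.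
have iter n : forall t, 0 < t <= tau ->
    (wLp_int p kappa 0 t F <= ((2 * 2 `^ p * a + D1 / 2 ^+ n) * expR (lam * beta t))%:E)%E.
  elim: n => [|n IH] t /andP[t0 tt].
    apply: (@le_trans _ _ D1%:E).
      apply: (le_trans (wLp_int_sub p kappa 0 F tt)).
      rewrite -[leLHS]fineK; first by rewrite lee_fin lerDl.
      by rewrite ge0_fin_numE ?wLp_int_ge0//; exact: (wLp_sub tT wF).2.
    rewrite lee_fin expr0 divr1 -[leLHS]mulr1; apply: ler_pM => //; first exact: ltW.
    by rewrite lerDr ltW.
  have Dn : 0 < 2 * 2 `^ p * a + D1 / 2 ^+ n by rewrite addr_gt0// divr_gt0// exprn_gt0.
  have tI : 0 < t <= tau by rewrite t0.
  have HE' := HC F tau v _ wF tauT Mv SF Dn IH t tI.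
  rewrite (FE t tt).
  have sf : strongly_meas `]0, t[%classic f := (wLp_sub (le_trans tt tT) wf).1.
  have sE : strongly_meas `]0, t[%classic (fun s => - E s (v s)) := smN (wLp_sub tt wE).1.
  apply: (le_trans (wLp_intD kappa (ltW p0) sf sE)); rewrite wLp_intN.
  have fa' : (wLp_int p kappa 0 t f <= (a * expR (lam * beta t))%:E)%E.
    apply: (le_trans (wLp_int_sub p kappa 0 f tt)); apply: (le_trans fa).
    by rewrite lee_fin ler_peMr// ltW.
  apply: (@le_trans _ _ ((2 `^ p)%:E * ((a * expR (lam * beta t))%:E +
     (rho * ((2 * 2 `^ p * a + D1 / 2 ^+ n) * expR (lam * beta t)))%:E))%E).
    by apply: lee_wpmul2l; [rewrite lee_fin powR_ge0|exact: leeD].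
  rewrite -EFinD -EFinM lee_fin.
  have -> : 2 `^ p * (a * expR (lam * beta t) + rho * ((2 * 2 `^ p * a + D1 / 2 ^+ n) * expR (lam * beta t))) =
     (2 `^ p * a + (2 `^ p * rho) * (2 * 2 `^ p * a + D1 / 2 ^+ n)) * expR (lam * beta t) by ring.
  rewrite rhoE ler_wpM2r ?expR_ge0// exprS.
  have -> : D1 / (2 * 2 ^+ n) = 2^-1 * (D1 / 2 ^+ n) by field; rewrite expf_neq0.
  lra.
rewrite -FE//; apply/lee_addgt0Pr => e e0.
have : (fun n => D1 * (2^-1) ^+ n * expR (lam * beta tau)) @ \oo --> D1 * 0 * expR (lam * beta tau).
  apply: cvgM; last exact: cvg_cst; apply: cvgM; first exact: cvg_cst.
  by apply: cvg_expr; rewrite ger0_norm ?invr_ge0// invf_lt1// ltr1n.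
rewrite mulr0 mul0r => /cvgrPdist_lt /(_ e e0) [n _ /(_ n (leqnn n))] /=.
rewrite sub0r normrN => /ltW /(le_trans (ler_norm _)) hn.
have tauI : 0 < tau <= tau by rewrite tau0 lexx.
apply: (le_trans (iter n tau tauI)).
by rewrite -EFinD lee_fin mulrDl lerD2l -exprVn.
Qed.

Lemma perturb_est (R : realType) (X0 X1 : normedModType R) (J : {linear X1 -> X0})
    (p q kappa T N K rho lam : R) (E A : R -> X1 -> X0) (b : R -> R) :
  let beta := cumul (bweight q T b) in
  continuous J -> 1 < p -> p < q -> 0 <= kappa < p - 1 -> perturbation J q T N E b ->
  0 < rho -> 2 `^ p * rho = 2^-1 -> 0 < lam -> contracts J p kappa T rho lam beta A E ->
  0 < K -> MR_est J p kappa A 0 T K ->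
  MR_est J p kappa (fun t x => A t x + E t x) 0 T (K * (2 * 2 `^ p * expR (lam * N `^ q)) `^ p^-1).
Proof.
move=> beta cJ p1 pq kp HE rho0 rhoE lam0 HC K0 HA f wf tau tauT v Mv Sv g c dg.
have [tau0 tT] := andP tauT.
have p0 : 0 < p by lra.
have q0 : 0 < q by lra.
pose F t := \1_(`]0, tau[%classic : set R) t *: (f t - E t (v t)).
have [wF SF] := perturb_rhs cJ p1 pq kp HE tauT wf Mv Sv.
apply: (le_trans (HA F wF tau tauT v Mv SF g c dg)).
rewrite -mulrA ler_pM2l//.
set C1 := 2 * 2 `^ p * expR (lam * N `^ q).
have C10 : 0 < C1 by rewrite !mulr_gt0 ?powR_gt0 ?expR_gt0.
have If0 : 0 <= fine (wLp_int p kappa 0 tau f) by rewrite fine_ge0// wLp_int_ge0.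
have IF0 : 0 <= fine (wLp_int p kappa 0 tau F) by rewrite fine_ge0// wLp_int_ge0.
have fin (h : R -> X0) : wLp p kappa 0 T h -> (fine (wLp_int p kappa 0 tau h))%:E = wLp_int p kappa 0 tau h.
  by move=> wh; rewrite fineK// ge0_fin_numE ?wLp_int_ge0//; exact: (wLp_sub tT wh).2.
rewrite /wLp_norm -powRM ?(ltW C10)//.
have pI : 0 <= p^-1 by rewrite invr_ge0 ltW.
apply: (ge0_ler_powR pI); [by rewrite nnegrE|rewrite nnegrE; exact: (mulr_ge0 (ltW C10) If0)|].
apply/ler_addgt0Pr => e e0.
(* The a priori bound takes a positive a, while the integral of f may vanish; the surplus e / C1
   costs exactly e after multiplication by [C1]. *)
set a := fine (wLp_int p kappa 0 tau f) + e / C1.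
have a0 : 0 < a by exact: (ltr_wpDl If0 (divr_gt0 e0 C10)).
have fa : (wLp_int p kappa 0 tau f <= a%:E)%E by rewrite -(fin f wf) lee_fin lerDl divr_ge0// ltW.
have := contracts_apriori cJ p1 pq kp HE tauT rho0 rhoE lam0 HC wf Mv Sv a0 fa.
rewrite -(@wLp_int_eq _ _ p kappa 0 tau F); last first.
  by apply: ae_leb_all => s st; rewrite /F indic_itv_scale.
rewrite -(fin F wF) lee_fin => /le_trans; apply.
apply: (@le_trans _ _ (C1 * a)); last by rewrite /a mulrDr [C1 * (e / C1)]mulrC divfK ?gt_eqF.
rewrite /C1 mulrAC ler_wpM2r ?(ltW a0)// ler_wpM2l ?mulr_ge0 ?powR_ge0//.
rewrite ler_expR ler_pM2l//; exact: (cumul_bweight_le tau q0 (E_bfin HE) (E_bnorm HE)).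
Qed.

(** * Existence by Picard iteration *)

Lemma E_sub (R : realType) (X0 X1 : normedModType R) (J : {linear X1 -> X0}) (q T N : R)
    (E : R -> X1 -> X0) (b : R -> R) (t : R) (x y : X1) :
  perturbation J q T N E b -> E t (x - y) = E t x - E t y.
Proof. by move=> HE; rewrite -scaleN1r (E_add HE) (E_scale HE) scaleN1r. Qed.

Lemma opprB_common (V : zmodType) (a x y : V) : - (x - y) = (a - x) - (a - y).
Proof. by rewrite !opprB [RHS]addrC addrA subrK. Qed.

Lemma subr_common (V : zmodType) (a f x y : V) : (a - (f - y)) + (x - y) = a - (f - x).
Proof. by rewrite !opprB -addrA; congr (_ + _); rewrite addrC addrA subrK. Qed.

Lemma powR2N_lt1 (R : realType) (p : R) : 0 < p -> 2 `^ (- p) < 1 :> R.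
Proof.
move=> p0; rewrite powRN invf_lt1 ?powR_gt0//.
have := @gt0_ltr_powR R p p0 1 2; rewrite !nnegrE powR1 => H.
by apply: H; rewrite ?ler01 ?ler0n ?ltr1n.
Qed.

(* Picard iteration for the right-hand side [F = f - E (S F)], [S] the solution operator of [A]:
   only right-hand sides converge, so that no limit of solutions has to be identified. *)
Lemma perturb_exists (R : realType) (X0 X1 : completeNormedModType R) (J : {linear X1 -> X0})
    (p q kappa T N lam : R) (E A : R -> X1 -> X0) (b : R -> R) (f : R -> X0) :
  let beta := cumul (bweight q T b) in
  continuous J -> 1 < p -> p < q -> 0 <= kappa < p - 1 -> 0 < T -> perturbation J q T N E b ->
  0 < lam -> contracts J p kappa T (2 `^ (- p) / 2) lam beta A E ->
  (forall t y z, A t (y - z) = A t y - A t z) ->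
  (forall f, wLp p kappa 0 T f -> exists u, MR J p kappa 0 T u /\ strong_sol J A 0 T f 0 u) ->
  wLp p kappa 0 T f ->
  exists u, MR J p kappa 0 T u /\ strong_sol J (fun t x => A t x + E t x) 0 T f 0 u.
Proof.
move=> beta cJ p1 pq kp T0 HE lam0 HC AB Hex wf.
have p0 : 0 < p by lra.
have p0' := ltW p0.
have TT : 0 < T <= T by rewrite T0 lexx.
set rho := 2 `^ (- p) / 2 in HC.
have rho0 : 0 < rho by rewrite divr_gt0// powR_gt0.
(* The solution operator is made total by choice, with arbitrary values outside the weighted L^p
   space. *)
have [S HS] : exists S : (R -> X0) -> (R -> X1), forall h, wLp p kappa 0 T h ->
    MR J p kappa 0 T (S h) /\ strong_sol J A 0 T h 0 (S h).
  suff /choice[S HS] : forall h, exists u, wLp p kappa 0 T h -> MR J p kappa 0 T u /\ strong_sol J A 0 T h 0 u.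
    by exists S.
  move=> h.
  have [/Hex [u Hu]|nh] := pselect (wLp p kappa 0 T h); first by exists u => _; exact: Hu.
  by exists (fun=> 0) => wh; case: (nh wh).
pose Fn := fix Fn n := if n is m.+1 then (fun t => f t - E t (S (Fn m) t)) else (fun=> 0 : X0).
have wES h : wLp p kappa 0 T h -> wLp p kappa 0 T (fun t => E t (S h t)).
  by move=> wh; exact: (perturb_wLp cJ p1 pq kp HE TT (HS h wh).1 (HS h wh).2).
have wF n : wLp p kappa 0 T (Fn n).
  elim: n => [|n IH]; last exact: (wLpB p0' wf (wES _ IH)).
  split; first exact: sm_cst0.
  rewrite /wLp_int; under eq_integral do rewrite /= normr0 powR0 ?gt_eqF// mulr0.
  by rewrite integral0 ltry.
have be1 t : 1 <= expR (lam * beta t).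
  rewrite -[leLHS]expR0 ler_expR mulr_ge0 ?(ltW lam0)//; apply: cumul_ge0 => s; exact: bweight_ge0.
(* [S h - S k] solves the problem with right-hand side h - k, and [contracts] accepts any solution;
   linearity of [S], a mere choice function, is never invoked. *)
have diff h k D : wLp p kappa 0 T h -> wLp p kappa 0 T k -> 0 < D ->
    (forall t, 0 < t <= T -> (wLp_int p kappa 0 t (fun s => h s - k s)%R <= (D * expR (lam * beta t))%:E)%E) ->
    forall t, 0 < t <= T ->
      (wLp_int p kappa 0 t (fun s => E s (S h s) - E s (S k s))%R <= (rho * (D * expR (lam * beta t)))%:E)%E.
  move=> wh wk D0 Hd t tT.
  have Ss := strong_solB AB (HS h wh).2 (HS k wk).2; rewrite subr0 in Ss.
  have := HC _ T _ D (wLpB p0' wh wk) TT (MRB p0' (HS h wh).1 (HS k wk).1) Ss D0 Hd t tT.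
  rewrite (@wLp_int_eq _ _ _ _ _ _ _ (fun s => E s (S h s) - E s (S k s)))//.
  by apply: ae_leb_all => s _; exact: (E_sub _ _ _ HE).
set D := fine (wLp_int p kappa 0 T (fun t => Fn 1%N t - Fn 0%N t)) + 1.
have D0 : 0 < D by rewrite ltr_wpDl// fine_ge0// wLp_int_ge0.
have inc n : forall t, 0 < t <= T ->
    (wLp_int p kappa 0 t (fun s => Fn n.+1 s - Fn n s)%R <= (rho ^+ n * D * expR (lam * beta t))%:E)%E.
  elim: n => [|n IH] t tT.
    have [_ tT'] := andP tT.
    apply: (@le_trans _ _ D%:E).
      apply: (le_trans (wLp_int_sub p kappa 0 (fun s => Fn 1%N s - Fn 0%N s) tT')).
      rewrite -[leLHS]fineK; first by rewrite lee_fin lerDl.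
      by rewrite ge0_fin_numE ?wLp_int_ge0//; exact: (wLpB p0' (wF 1%N) (wF 0%N)).2.
    by rewrite lee_fin expr0 mul1r ler_peMr// ltW.
  have Dn : 0 < rho ^+ n * D by rewrite mulr_gt0// exprn_gt0.
  have := diff _ _ _ (wF n.+1) (wF n) Dn IH t tT.
  rewrite -wLp_intN (@wLp_int_eq _ _ _ _ _ _ _ (fun s => Fn n.+2 s - Fn n.+1 s)).
    by rewrite mulrA [rho * (rho ^+ n * D)]mulrA -exprS.
  by apply: ae_leb_all => s _; exact: opprB_common.
set C := D * expR (lam * beta T).
have C0 : 0 < C by rewrite mulr_gt0// expR_gt0.
have incT n : (wLp_int p kappa 0 T (fun s => Fn n.+1 s - Fn n s)%R <= (C * rho ^+ n)%:E)%E.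
  by apply: (le_trans (inc n T TT)); rewrite lee_fin /C -mulrA [leLHS]mulrC.
have [F [C' [C'0 wFoo est]]] := wLp_complete p0 T0 C0 wF incT.
pose u := S F; have [Mu Su] := HS F wFoo.
have wE := wES F wFoo.
pose r t := F t - (f t - E t (u t)).
have wr : wLp p kappa 0 T r := wLpB p0' wFoo (wLpB p0' wf wE).
pose z := 2 `^ (- p) : R.
have z0 : 0 < z by rewrite powR_gt0.
have z1 : z < 1 := powR2N_lt1 p0.
(* The residual is (F - F_{n+1}) + (E (S F) - E (S F_n)) for every n. Both parts decay like z^n, the
   second by contraction applied to F - F_n, so the residual vanishes. *)
have rn n : (wLp_int p kappa 0 T r <= (2 `^ p * C' * (z + rho * expR (lam * beta T)) * z ^+ n)%:E)%E.
  have Dn : 0 < C' * z ^+ n by rewrite mulr_gt0// exprn_gt0.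
  have h1 t : 0 < t <= T -> (wLp_int p kappa 0 t (fun s => F s - Fn n s)%R <= (C' * z ^+ n * expR (lam * beta t))%:E)%E.
    move=> /andP[_ tT]; apply: (le_trans (wLp_int_sub p kappa 0 (fun s => F s - Fn n s) tT)).
    by apply: (le_trans (est n)); rewrite lee_fin ler_peMr// ltW.
  have h2 := diff _ _ _ wFoo (wF n) Dn h1 T TT.
  have s1 : strongly_meas `]0, T[%classic (fun s => F s - Fn n.+1 s) := (wLpB p0' wFoo (wF n.+1)).1.
  have s2 : strongly_meas `]0, T[%classic (fun s => E s (S F s) - E s (S (Fn n) s)).
    exact: (wLpB p0' wE (wES _ (wF n))).1.
  have := wLp_intD kappa p0' s1 s2.
  rewrite (@wLp_int_eq _ _ _ _ _ _ _ r); last first.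
    by apply: ae_leb_all => s _; exact: subr_common.
  move=> /le_trans; apply.
  apply: (@le_trans _ _ ((2 `^ p)%:E * ((C' * z ^+ n.+1)%:E + (rho * (C' * z ^+ n * expR (lam * beta T)))%:E))%E).
    by apply: lee_wpmul2l; [rewrite lee_fin powR_ge0|apply: leeD; [exact: est|exact: h2]].
  by rewrite -EFinD -EFinM lee_fin exprS le_eqVlt; apply/orP; left; apply/eqP; ring.
have r0 : wLp_int p kappa 0 T r = 0%E.
  apply/le_anti; rewrite wLp_int_ge0 andbT; apply/lee_addgt0Pr => e e0; rewrite add0e.
  set c := 2 `^ p * C' * (z + rho * expR (lam * beta T)) in rn.
  have : (fun n => c * z ^+ n) @ \oo --> c * 0.
    by apply: cvgM; [exact: cvg_cst|apply: cvg_expr; rewrite gtr0_norm].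
  rewrite mulr0 => /cvgrPdist_lt /(_ e e0) [n _ /(_ n (leqnn n))] /=.
  rewrite sub0r normrN => /ltW /(le_trans (ler_norm _)) hn.
  by apply: (le_trans (rn n)); rewrite lee_fin.
have rae := wLp_int_zero p0 wr.1 r0.
exists u; split; first exact: Mu.
have [wu [wJ [wA [g [dg H]]]]] := Su.
split; first exact: wu.
split; first exact: wJ.
split; first exact: (wLpD ler01 wA (wLp_L1 p1 kp T0 wE)).
exists g; split; first exact: dg.
apply: ae_leS2 rae H => t rt Ht tT.
by rewrite addrA (Ht tT); have /eqP := rt tT; rewrite /r subr_eq0 => /eqP ->; rewrite subrK.
Qed.

(** * Uniqueness and conclusion *)

Lemma MR_norm_zero (R : realType) (X0 X1 : normedModType R) (J : X1 -> X0) (p kappa T : R)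
    (v : R -> X1) : 0 < p -> MR J p kappa 0 T v -> MR_norm_le J p kappa 0 T v 0 ->
  {ae @leb R, forall t, `]0, T[%classic t -> v t = 0}.
Proof.
move=> p0 [[sv v0] [_ [g [c dg]]]] /(_ g c dg); rewrite /MR_norm ge_max => /andP[h _].
apply: (@wLp_int_zero _ _ p kappa T v p0 sv).
have : wLp_norm p kappa 0 T v = 0 by apply/le_anti; rewrite h powR_ge0.
move=> /eqP; rewrite /wLp_norm powR_eq0 => /andP[/eqP h0 _].
by rewrite -(@fineK _ (wLp_int p kappa 0 T v)) ?h0// ge0_fin_numE ?wLp_int_ge0.
Qed.

Theorem theorem2p5 (R : realType) (X0 X1 : completeNormedModType R)
  (J : {linear X1 -> X0})
  (J_inj : injective J) (J_cont : continuous J)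
  (J_dense : closure (range J) = setT)
  (p q kappa : R) (hp : 1 < p) (hkappa : 0 <= kappa < p - 1) (hq : p < q)
  (M N : R) :
  exists C : R,
  forall (T : R) (A : R -> {linear X1 -> X0}) (B : R -> X0 -> X0) (b : R -> R),
    0 < T ->
    (* A(t) in L(X1,X0), strongly measurable in the strong operator topology *)
    (forall t, 0 <= t <= T -> exists c : R, forall x, `|A t x| <= c * `|x|) ->
    (forall x, strongly_meas `[0, T]%classic (fun t => A t x)) ->
    (* ||A v||_{L^p} <= C_A ||v||_{MR^p} *)
    (exists CA : R, forall v : R -> X1, MR J p kappa 0 T v ->
        wLp p kappa 0 T (fun t => A t (v t)) /\
        forall g c, is_deriv p kappa 0 T (J \o v) g c ->
          wLp_norm p kappa 0 T (fun t => A t (v t)) <= CA * MR_norm J p kappa 0 T v g) ->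
    max_reg J p kappa (fun t => A t) 0 T ->
    MR_const J p kappa (fun t => A t) 0 T = M ->
    (* B(t) in L(X_{1-1/q,1}, X0), strongly measurable in the SOT, ||B(t)|| <= b(t) *)
    (forall t, forall x y, in_interp J (1 - q^-1) x -> in_interp J (1 - q^-1) y ->
        B t (x + y) = B t x + B t y) ->
    (forall t c x, in_interp J (1 - q^-1) x -> B t (c *: x) = c *: B t x) ->
    (forall x, in_interp J (1 - q^-1) x -> strongly_meas `[0, T]%classic (fun t => B t x)) ->
    (forall t, 0 <= t <= T -> forall x, in_interp J (1 - q^-1) x ->
        `|B t x| <= b t * interp_norm J (1 - q^-1) x) ->
    measurable_fun `]0, T[%classic b ->
    Lq_fin q 0 T b ->
    Lq_norm q 0 T b = N ->
    max_reg J p kappa (fun t x => A t x + B t (J x)) 0 T /\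
    MR_const J p kappa (fun t x => A t x + B t (J x)) 0 T <= C.
Proof.
have p0 : 0 < p by lra.
have q1 : 1 < q by exact: lt_trans hq.
(* [M + 1] is an admissible constant although the infimum M may not be attained; the maximum with 1
   makes it positive. *)
pose K := Num.max (M + 1) 1.
have K0 : 0 < K by rewrite lt_max ltr01 orbT.
(* One ratio serves the absorption in the a priori estimate and the summability required by
   [wLp_complete]. *)
pose rho : R := 2 `^ (- p) / 2.
have rho0 : 0 < rho by rewrite divr_gt0// powR_gt0.
have rhoE : 2 `^ p * rho = 2^-1 by rewrite /rho powRN mulrA mulfV ?mul1r// gt_eqF// powR_gt0.
have [lam lam0 HC] := perturb_contracts J hp hq hkappa K0 rho0.
exists (K * (2 * 2 `^ p * expR (lam * N `^ q)) `^ p^-1).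
move=> T A B b T0 _ _ _ mrA MA Badd Bscale Bmeas Bbound mb bfin bN.
have [c _ Hc] := interp_embedding J_cont q1.
(* [B t] is linear, bounded and measurable only on the interpolation space, to which every [J x]
   belongs. *)
have HE : perturbation J q T N (fun t x => B t (J x)) b.
  split => //.
  - by move=> t x y; rewrite linearD; apply: Badd; exact: (Hc _).1.
  - by move=> t k x; rewrite linearZ; apply: Bscale; exact: (Hc _).1.
  - by move=> x; apply: Bmeas; exact: (Hc _).1.
  - by move=> t tT x; apply: Bbound => //; exact: (Hc _).1.
have [Hex HK] := mrA.
have HA : MR_est J p kappa (fun t => A t) 0 T K.
  by apply: MR_est_mono (MR_est_const HK); rewrite MA le_max lexx.
have {}HC := HC T N _ _ b HE HA.
have est := perturb_est J_cont hp hq hkappa HE rho0 rhoE lam0 HC K0 HA.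
split; last by apply: (MR_const_le _ est); rewrite mulr_ge0 ?powR_ge0// ltW.
split; last by exists (K * (2 * 2 `^ p * expR (lam * N `^ q)) `^ p^-1); exact: est.
move=> f wf.
have AB t (y z : X1) : A t (y - z) = A t y - A t z by rewrite linearB.
have Hex' h : wLp p kappa 0 T h -> exists u, MR J p kappa 0 T u /\ strong_sol J (fun t => A t) 0 T h 0 u.
  by move=> /Hex [u [Mu [Su _]]]; exists u.
have [u [Mu Su]] := perturb_exists J_cont hp hq hkappa T0 HE lam0 HC AB Hex' wf.
exists u; split; [exact: Mu|split; [exact: Su|move=> v Mv Sv]].
have ABE t (y z : X1) : A t (y - z) + B t (J (y - z)) = (A t y + B t (J y)) - (A t z + B t (J z)).
  by rewrite AB (E_sub t y z HE) opprD addrACA.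
(* Uniqueness: the difference solves the perturbed problem with data f - f, so the a priori estimate
   bounds its norm by 0. *)
have Sd := strong_solB ABE Sv Su; rewrite subr0 in Sd.
have TT : 0 < T <= T by rewrite T0 lexx.
have Md := MRB (ltW p0) Mv Mu.
have wd : wLp p kappa 0 T (fun t => f t - f t) := wLpB (ltW p0) wf wf.
have nd := est _ wd T TT _ Md Sd.
have f0 : wLp_norm p kappa 0 T (fun t => f t - f t) = 0.
  rewrite /wLp_norm /wLp_int; under eq_integral do rewrite subrr normr0 powR0 ?gt_eqF// mulr0.
  by rewrite integral0 powR0// gt_eqF// invr_gt0.
rewrite f0 mulr0 in nd.
apply: ae_leS (MR_norm_zero p0 Md nd) => t Ht tT.
by apply/eqP; rewrite -subr_eq0; apply/eqP; exact: Ht.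
Qed.
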